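(* Let $u_0 = \frac{1}{x+\mathrm{i}0} := \lim_{\varepsilon\to 0^+}\frac{1}{x+\mathrm{i}\varepsilon} = \mathrm{vp}\frac1x - \mathrm{i}\pi\delta(x)\in\mathcal{D}'(\mathbb{R})$. For every $c\in\mathbb{R}$, $c\neq 0$, the distribution $u(x,t)\equiv u_0(x)$ (constant in $t$) is a weak solution of the initial value problem $$\frac1c\,\partial_t u+\partial_x u+u^2=0,\qquad u(x,0)=u_0(x),$$ where the square $u^2$ is understood in the sense of Hörmander's product.
   Context: Here $x\in\mathbb{R}$, $t\ge 0$. The limit defining $u_0$ is taken in $\mathcal{D}'(\mathbb{R})$; $\mathrm{vp}\frac1x=\partial_x\log|x|$ is the principal value distribution and $\delta$ the Dirac measure. The distribution $u(x,t)\equiv u_0(x)$ is $u_0\otimes 1$; as a distribution-valued function of $t\ge 0$ it is the constant map $t\mapsto u_0$, and the initial condition is understood in this sense. ''Weak solution'' means that the equation holds in the sense of distributions, all derivatives being distributional derivatives. Hörmander's product: the Fourier transform is $\mathcal{F}\varphi(\xi)=\int e^{-2\pi \mathrm{i}x\xi}\varphi(x)\,dx$. Two distributions $v,w$ satisfy Hörmander's wave front set criterion if for every $(y,\xi)$ with $\xi\ne 0$, $(y,\xi)\in \mathrm{WF}(v)$ implies $(y,-\xi)\notin \mathrm{WF}(w)$. In this case their product $v\cdot w$ is defined as follows: for every point $y$ there are a neighborhood $\Omega_y$ and a test function $\chi_y$ with $\chi_y\equiv1$ on $\Omega_y$ such that the $\mathcal{S}'$-convolution of $\mathcal{F}(\chi_y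 v)$ and $\mathcal{F}(\chi_y w)$ exists; near $y$ one sets $v\cdot w=\mathcal{F}^{-1}(\mathcal{F}(\chi_y v)*\mathcal{F}(\chi_y w))$, and globally one uses a partition of unity. The $\mathcal{S}'$-convolution of $S,T\in\mathcal{S}'(\mathbb{R}^n)$ exists if $(\varphi*\check S)T\in\mathcal{D}'_{L^1}(\mathbb{R}^n)$ for all $\varphi\in\mathcal{S}(\mathbb{R}^n)$, where $\check S(x)=S(-x)$, and then $\langle S*T,\varphi\rangle=\langle(\varphi*\check S)T,1\rangle$. The square is $u^2=u\cdot u$. *)

(* Defs.v *)
From HB Require Import structures.
From mathcomp Require Import all_boot all_order all_algebra.
From mathcomp Require Import all_classical all_reals all_analysis.
From mathcomp.real_closed Require Import complex.

Set Implicit Arguments.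
Unset Strict Implicit.
Unset Printing Implicit Defensive.

Import Order.TTheory GRing.Theory Num.Theory.
Import numFieldNormedType.Exports.
Import ComplexField.Normc.

Local Open Scope classical_set_scope.
Local Open Scope complex_scope.
Local Open Scope ring_scope.

(* [R[i]] is used as the field of complex numbers.  It carries no topology over
   [R] in the library, so derivatives, integrals and limits of complex-valued
   functions are taken on real and imaginary parts. *)

Section SmoothFunctions.
Variables (R : realType) (V : normedModType R).
Implicit Types (f : V -> R[i]) (v p : V) (vs : seq V).

Definition Ref f : V -> R := fun p => complex.Re (f p).
Definition Imf f : V -> R := fun p => complex.Im (f p).

Definition cderive v f : V -> R[i] :=
  fun p => 'D_v (Ref f) p +i* 'D_v (Imf f) p.

Definition cderives vs f : V -> R[i] := foldr cderive f vs.

Definition smooth f :=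
  forall vs,
    [/\ continuous (Ref (cderives vs f)), continuous (Imf (cderives vs f))
      & forall p v, derivable (Ref (cderives vs f)) p v /\
                    derivable (Imf (cderives vs f)) p v].

Definition supp f : set V := closure [set p | f p != 0].

Definition test_fun (Omega : set V) f :=
  [/\ smooth f, compact (supp f) & supp f `<=` Omega].

(* sup over p of (1 + |p|)^k |D^j f (p)| is at most M for all j <= m, the norm
   of the j-th differential being that of a j-linear map. *)
Definition seminorm_le (k m : nat) f (M : R) :=
  forall vs p, (size vs <= m)%N -> all (fun v => `|v| <= 1) vs ->
    (1 + `|p|) ^+ k * normc (cderives vs f p) <= M.

Definition schwartz f :=
  smooth f /\ forall k m, exists M, seminorm_le k m f M.

End SmoothFunctions.

(* A distribution is a functional on all functions [V -> R[i]]; only its values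
   on test functions (resp. Schwartz functions) are meaningful. *)
Section Distributions.
Variables (R : realType) (V : normedModType R).
Local Notation functional := ((V -> R[i]) -> R[i]).
Implicit Types (S T : functional) (Omega : set V).

Definition linear_on (D : set (V -> R[i])) T :=
  forall (a : R[i]) f g, D f -> D g ->
    T (fun p => a * f p + g p) = a * T f + T g.

Definition distribution_on Omega T :=
  linear_on (test_fun Omega) T /\
  forall K, compact K -> K `<=` Omega -> exists m C,
    forall f, test_fun Omega f -> supp f `<=` K ->
    forall M, seminorm_le 0 m f M -> normc (T f) <= C * M.

Definition tempered T :=
  linear_on (@schwartz R V) T /\
  exists k m C, forall f, schwartz f ->
    forall M, seminorm_le k m f M -> normc (T f) <= C * M.

Definition ddistr (v : V) T : functional := fun f => - T (cderive v f).

Definition smul (g : V -> R[i]) T : functional :=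
  fun f => T (fun p => g p * f p).

Definition dirac_distr (a : V) : functional := fun f => f a.

(* The dual of the space of smooth functions vanishing at infinity with all
   their derivatives (topology of uniform convergence of all derivatives), in
   which the test functions are dense. *)
Definition DL1 T :=
  linear_on (test_fun setT) T /\
  exists m C, forall f, test_fun setT f ->
    forall M, seminorm_le 0 m f M -> normc (T f) <= C * M.

Definition approximate_unit (eta : nat -> V -> R[i]) :=
  [/\ forall k, test_fun setT (eta k),
      forall m, exists M, forall k, seminorm_le 0 m (eta k) M
    & forall K, compact K -> \forall k \near \oo, forall p, K p -> eta k p = 1].

(* <T, 1> = l, for T in D'_{L^1} *)
Definition pairing1 T (l : R[i]) :=
  forall eta, approximate_unit eta ->
    normc (T (eta k) - l) @[k --> \oo] --> (0 : R).

(* phi * S^vee, with S^vee the reflection of S: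
   (phi * S^vee)(p) = <S_q, phi (p + q)> *)
Definition conv_reflect (phi : V -> R[i]) S : V -> R[i] :=
  fun p => S (fun q => phi (p + q)).

(* The S'-convolution of S and T exists and equals W. *)
Definition Sconvolution S T W :=
  [/\ tempered S, tempered T
    & forall phi, schwartz phi ->
        DL1 (smul (conv_reflect phi S) T) /\
        pairing1 (smul (conv_reflect phi S) T) (W phi)].

End Distributions.

Section Line.
Variable R : realType.

Definition cint (D : set R) (f : R -> R[i]) : R[i] :=
  (\int[lebesgue_measure]_(x in D) complex.Re (f x)) +i*
  (\int[lebesgue_measure]_(x in D) complex.Im (f x)).

Definition regular (g : R -> R[i]) : (R -> R[i]) -> R[i] :=
  fun phi => cint setT (fun x => g x * phi x).

(* 1 / (x + i eps) *)
Definition inv_x_ieps (eps : R) : (R -> R[i]) -> R[i] :=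
  regular (fun x => (x +i* eps)^-1).

(* 1 / (x + i 0) *)
Definition inv_x_i0 : (R -> R[i]) -> R[i] := fun phi =>
  lim (complex.Re (inv_x_ieps eps phi) @[eps --> 0^'+]) +i*
  lim (complex.Im (inv_x_ieps eps phi) @[eps --> 0^'+]).

(* The principal value of 1 / x, as the derivative of log |x|; the value of
   [ln] at 0 is irrelevant. *)
Definition vp_inv : (R -> R[i]) -> R[i] :=
  ddistr (1 : R) (regular (fun x => (ln `|x|)%:C)).

End Line.

Section Plane.
Variable R : realType.
Local Notation R2 := (R * R)%type.
Local Notation functional := ((R2 -> R[i]) -> R[i]).
Implicit Types (Omega : set R2) (v w T : functional) (p q y xi : R2).

Definition cint2 (f : R2 -> R[i]) : R[i] :=
  (\int[(lebesgue_measure \x lebesgue_measure)%E]_p complex.Re (f p)) +i*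
  (\int[(lebesgue_measure \x lebesgue_measure)%E]_p complex.Im (f p)).

Definition dotp p q : R := p.1 * q.1 + p.2 * q.2.

Definition cis (theta : R) : R[i] := cos theta +i* sin theta.

Definition fourier (phi : R2 -> R[i]) : R2 -> R[i] := fun xi =>
  cint2 (fun p => cis (- (2 * pi * dotp p xi)) * phi p).

Definition fourier_inv (phi : R2 -> R[i]) : R2 -> R[i] := fun p =>
  cint2 (fun xi => cis (2 * pi * dotp p xi) * phi xi).

Definition fourier_distr T : functional := fun phi => T (fourier phi).
Definition fourier_inv_distr T : functional := fun phi => T (fourier_inv phi).

(* The Fourier transform, as a function, of the compactly supported
   distribution chi v. *)
Definition fourier_cut (chi : R2 -> R[i]) v : R2 -> R[i] := fun xi =>
  v (fun p => chi p * cis (- (2 * pi * dotp p xi))).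

Definition open_cone (G : set R2) :=
  open G /\ forall (t : R) xi, 0 < t -> G xi -> G (t *: xi).

Definition rapidly_decreasing_on (G : set R2) (f : R2 -> R[i]) :=
  forall N, exists C : R, forall xi, G xi ->
    (1 + `|xi|) ^+ N * normc (f xi) <= C.

Definition WF Omega v y xi :=
  [/\ Omega y, xi != 0
    & ~ exists chi G, [/\ test_fun Omega chi, chi y != 0, open_cone G, G xi
                        & rapidly_decreasing_on G (fourier_cut chi v)]].

Definition hormander_criterion Omega v w :=
  forall y xi, xi != 0 -> WF Omega v y xi -> ~ WF Omega w y (- xi).

(* The distribution P on Omega is the product of v and w. *)
Definition hormander_product Omega v w P :=
  [/\ distribution_on Omega P, hormander_criterion Omega v w
    & forall y, Omega y -> exists U chi W,
        [/\ open U /\ U y, test_fun Omega chi, forall p, U p -> chi p = 1,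
            Sconvolution (fourier_distr (smul chi v))
                         (fourier_distr (smul chi w)) W
          & forall phi, test_fun U phi -> P phi = fourier_inv_distr W phi]].

Definition spacetime : set R2 := [set p | 0 < p.2].
Definition e_x : R2 := (1, 0).
Definition e_t : R2 := (0, 1).

(* u_0 (x) 1, restricted to the half-plane t > 0 *)
Definition tensor1 (u0 : (R -> R[i]) -> R[i]) : functional :=
  fun phi => u0 (fun x => cint setT (fun t => phi (x, t))).

(* The map U : [0, oo[ -> D'(R) is continuous and represents u. *)
Definition represented_by u (U : R -> (R -> R[i]) -> R[i]) :=
  [/\ forall t, 0 <= t -> distribution_on setT (U t),
      forall phi, test_fun setT phi ->
        {within `[0, +oo[, continuous (fun t => complex.Re (U t phi))} /\
        {within `[0, +oo[, continuous (fun t => complex.Im (U t phi))}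
    & forall phi, test_fun spacetime phi ->
        u phi = cint `[0, +oo[ (fun t => U t (fun x => phi (x, t)))].

(* u is a distribution on t > 0 which solves
   (1/c) d_t u + d_x u + u^2 = 0, u(x,0) = u0, the initial value being that of
   the continuous distribution-valued map U representing u. *)
Definition weak_solution (c : R) (u : functional)
    (U : R -> (R -> R[i]) -> R[i]) (u0 : (R -> R[i]) -> R[i]) :=
  [/\ distribution_on spacetime u,
      exists u2, hormander_product spacetime u u u2 /\
        forall phi, test_fun spacetime phi ->
          (c^-1)%:C * ddistr e_t u phi + ddistr e_x u phi + u2 phi = 0,
      represented_by u U
    & forall phi, test_fun setT phi -> U 0 phi = u0 phi].

End Plane.

(* Main.v *)
(* Since (x + i e)^-1 is a superposition of the exponentials exp(2 i pi s x),
   s > 0, the Fourier transform of a localisation of u = 1/(x+i0) (x) 1 decays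
   rapidly away from the ray xi_1 > 0, xi_2 = 0; hence WF(u) contains no two
   opposite directions.  Quantitatively, if s is such a Fourier transform, then in
   the double integral of s(p) s(q) phi(p + q) both p and q are controlled by
   p + q, so the S'-convolution converges absolutely and is the limit, as e -> 0,
   of the convolutions obtained from (x + i e)^-1.  By Fourier inversion the latter
   give (x + i e)^-2 = - d/dx (x + i e)^-1, so that u^2 = - d_x u, while d_t u = 0.

   The formula u_0 = vp 1/x - i pi delta comes from the real part
   x / (x^2 + e^2) = d/dx (ln (x^2 + e^2) / 2) of (x + i e)^-1 and from its
   imaginary part, a Poisson kernel. *)

Require Import Defs.
From HB Require Import structures.
From mathcomp Require Import all_boot all_order all_algebra.
From mathcomp Require Import all_classical all_reals all_analysis.
From mathcomp.real_closed Require Import complex.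
From mathcomp Require Import ring lra.
From mathcomp Require Import measurable_realfun trigo ftc gauss_integral.

Set Implicit Arguments.
Unset Strict Implicit.
Unset Printing Implicit Defensive.

Import Order.TTheory GRing.Theory Num.Theory.
Import numFieldNormedType.Exports.
Import ComplexField.Normc.

Local Open Scope classical_set_scope.
Local Open Scope complex_scope.
Local Open Scope ring_scope.

(** Since 1/(x+i0) is given only by a limit, each estimate is proved for (x + i e)^-1 with a
    constant free of e, each identity for fixed e > 0, and both are carried over by dominated
    convergence. Two kinds of regularity are in play. The estimates uniform in e rest on the
    Lipschitz constant at 0 of the function integrated against the kernel; for the phase exp(-2 i pi
    x xi) this constant is of order |xi|, so the spectra are only shown to grow at most like 1 +
    |xi| along positive frequencies. The exponents 5 and 6 met later pay for this growth and for
    integrability on the plane. The identities for fixed e use that (x + i e)^-1 times a cutoff is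
    itself a test function, so that Fourier inversion for test functions is enough. The passage to
    the limit in the convolution hinges on the inequality [negw_ineq]: a weight placed on negative
    frequencies alone suffices to bound each of two frequencies through their sum. *)

Lemma eqW d (T : porderType d) (x y : T) : x = y -> (x <= y)%O.
Proof. by move=> ->. Qed.

(** * Complex-valued integrals *)

Section NormC.
Variable R : realType.
Implicit Types z w : R[i].

Lemma normc_ge0 z : 0 <= normc z.
Proof. by case: z => a b; exact: sqrtr_ge0. Qed.

Lemma ler_pM_normc z w (a b : R) : normc z <= a -> normc w <= b ->
  normc z * normc w <= a * b.
Proof. exact: ler_pM (normc_ge0 z) (normc_ge0 w). Qed.

Lemma normcD_le z w : normc (z + w) <= normc z + normc w.
Proof. exact: (@le_normcD R z w). Qed.

Lemma normcN_eq z : normc (- z) = normc z.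
Proof. exact: (@normcN R z). Qed.

Lemma normcB_le z w : normc (z - w) <= normc z + normc w.
Proof. by rewrite -(normcN_eq w); exact: normcD_le. Qed.

Lemma normcBC z w : normc (z - w) = normc (w - z).
Proof. by rewrite -normcN_eq opprB. Qed.

Lemma normc_real (x : R) : normc x%:C = `|x|.
Proof. by rewrite /normc /= expr0n /= addr0 sqrtr_sqr. Qed.

Lemma Re_le_normc z : `|complex.Re z| <= normc z.
Proof.
case: z => a b /=; rewrite -sqrtr_sqr ler_wsqrtr// lerDl; exact: sqr_ge0.
Qed.

Lemma Im_le_normc z : `|complex.Im z| <= normc z.
Proof.
case: z => a b /=; rewrite -sqrtr_sqr ler_wsqrtr// lerDr; exact: sqr_ge0.
Qed.

Lemma normc_le_ReIm z : normc z <= `|complex.Re z| + `|complex.Im z|.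
Proof.
case: z => a b /=; rewrite -[leRHS]ger0_norm ?addr_ge0// -sqrtr_sqr.
rewrite ler_wsqrtr// sqrrD !real_normK ?num_real//.
have := mulr_ge0 (normr_ge0 a) (normr_ge0 b); lra.
Qed.

Lemma normc_cis (t : R) : normc (cis t) = 1.
Proof. by rewrite /cis /normc cos2Dsin2 sqrtr1. Qed.

Lemma cisD (s t : R) : cis (s + t) = cis s * cis t.
Proof. by rewrite /cis cosD sinD; simpc; congr (_ +i* _); ring. Qed.

Lemma cis0 : cis 0 = 1 :> R[i].
Proof. by rewrite /cis cos0 sin0. Qed.

Lemma complexP z w : complex.Re z = complex.Re w -> complex.Im z = complex.Im w -> z = w.
Proof. by case: z w => [a b] [c d] /= -> ->. Qed.

Lemma ReD z w : complex.Re (z + w) = complex.Re z + complex.Re w.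
Proof. by case: z w => [a b] [c d]. Qed.
Lemma ImD z w : complex.Im (z + w) = complex.Im z + complex.Im w.
Proof. by case: z w => [a b] [c d]. Qed.
Lemma ReM z w : complex.Re (z * w) =
  complex.Re z * complex.Re w - complex.Im z * complex.Im w.
Proof. by case: z w => [a b] [c d]. Qed.
Lemma ImM z w : complex.Im (z * w) =
  complex.Re z * complex.Im w + complex.Im z * complex.Re w.
Proof. by case: z w => [a b] [c d]. Qed.
Lemma ReN z : complex.Re (- z) = - complex.Re z.
Proof. by case: z. Qed.
Lemma ImN z : complex.Im (- z) = - complex.Im z.
Proof. by case: z. Qed.
Lemma normc_ieps_gt0 (x e : R) : 0 < e -> 0 < normc (x +i* e).
Proof.
move=> e0; rewrite /= sqrtr_gt0 ltr_wpDl ?sqr_ge0//; exact: exprn_gt0.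
Qed.
End NormC.

Section ccvg.
Variable R : realType.
Implicit Types (u v : nat -> R[i]) (l : R[i]).

(** Written in the form of the conclusion of [pairing1], so that dominated convergence proves the
    latter by conversion. *)
Definition ccvg u l := normc (u n - l) @[n --> \oo] --> (0 : R).

Lemma ccvg_Re u l : ccvg u l -> complex.Re (u n) @[n --> \oo] --> complex.Re l.
Proof.
move=> ul; apply/cvgrPdist_le => e e0.
move/cvgrPdist_le : ul => /(_ e e0); apply: filterS => n.
rewrite sub0r normrN ger0_norm ?normc_ge0// normcBC; apply: le_trans.
by rewrite -ReN -ReD; exact: Re_le_normc.
Qed.

Lemma ccvg_Im u l : ccvg u l -> complex.Im (u n) @[n --> \oo] --> complex.Im l.
Proof.
move=> ul; apply/cvgrPdist_le => e e0.
move/cvgrPdist_le : ul => /(_ e e0); apply: filterS => n.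
rewrite sub0r normrN ger0_norm ?normc_ge0// normcBC; apply: le_trans.
by rewrite -ImN -ImD; exact: Im_le_normc.
Qed.

Lemma ccvgP u l : complex.Re (u n) @[n --> \oo] --> complex.Re l ->
  complex.Im (u n) @[n --> \oo] --> complex.Im l -> ccvg u l.
Proof.
move=> Rul Iul; apply: (@squeeze_cvgr _ _ _ _ (cst 0)
   (fun n => `|complex.Re (u n) - complex.Re l| + `|complex.Im (u n) - complex.Im l|)).
- apply: nearW => n; rewrite normc_ge0/=; apply: (le_trans (normc_le_ReIm _)).
  by rewrite ReD ImD ReN ImN.
- exact: cvg_cst.
- rewrite -[0]addr0; apply: cvgD.
  + rewrite -(normr0 R) -(subrr (complex.Re l)); apply: cvg_norm; apply: cvgB => //; exact: cvg_cst.
  + rewrite -(normr0 R) -(subrr (complex.Im l)); apply: cvg_norm; apply: cvgB => //; exact: cvg_cst.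
Qed.

Lemma ccvg_unique u l l' : ccvg u l -> ccvg u l' -> l = l'.
Proof.
move=> ul ul'; apply: complexP.
- exact: (cvg_unique _ (ccvg_Re ul) (ccvg_Re ul')).
- exact: (cvg_unique _ (ccvg_Im ul) (ccvg_Im ul')).
Qed.

Lemma ccvg_cst l : ccvg (fun=> l) l.
Proof. by rewrite /ccvg subrr normc0; exact: cvg_cst. Qed.

Lemma ccvgM u v l l' : ccvg u l -> ccvg v l' -> ccvg (fun n => u n * v n) (l * l').
Proof.
move=> ul vl; have := (ccvg_Re ul, ccvg_Im ul, ccvg_Re vl, ccvg_Im vl).
move=> [[[a b] c] d]; apply: ccvgP.
- rewrite ReM; under eq_fun do rewrite ReM.
  by apply: cvgB; exact: cvgM.
- rewrite ImM; under eq_fun do rewrite ImM.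
  by apply: cvgD; exact: cvgM.
Qed.

Lemma ccvgD u v l l' : ccvg u l -> ccvg v l' -> ccvg (fun n => u n + v n) (l + l').
Proof.
move=> ul vl; have := (ccvg_Re ul, ccvg_Im ul, ccvg_Re vl, ccvg_Im vl).
move=> [[[a b] c] d]; apply: ccvgP.
- by rewrite ReD; under eq_fun do rewrite ReD; exact: cvgD.
- by rewrite ImD; under eq_fun do rewrite ImD; exact: cvgD.
Qed.

Lemma ccvg_le u l (M : R) : ccvg u l -> (forall n, normc (u n) <= M) -> normc l <= M.
Proof.
move=> ul uM; apply/ler_addgt0Pr => e e0.
move/cvgrPdist_le : ul => /(_ e e0) [n _ /(_ n (leqnn n))] /=.
rewrite sub0r normrN ger0_norm ?normc_ge0// => ne.
have -> : l = u n - (u n - l) by ring.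
by apply: (le_trans (normcB_le _ _)); rewrite lerD.
Qed.

End ccvg.

Section ComplexIntegral.
Context d (T : measurableType d) (R : realType).
Variable m : {measure set T -> \bar R}.
Implicit Types (f : T -> R[i]) (g : T -> R).

(** [cint setT] and [cint2] are convertible to it ([cintTE], [cint2E]). The measure is arbitrary
    because Fubini also uses it on pairs of points of the plane. *)
Definition cI f : R[i] :=
  (\int[m]_x complex.Re (f x)) +i* (\int[m]_x complex.Im (f x)).

Definition cmeas f := measurable_fun setT (fun x => complex.Re (f x)) /\
  measurable_fun setT (fun x => complex.Im (f x)).

Definition rint g := m.-integrable setT (EFin \o g).

Definition cintegrable f := rint (fun x => complex.Re (f x)) /\
  rint (fun x => complex.Im (f x)).

Lemma eq_cI f1 f2 : f1 =1 f2 -> cI f1 = cI f2.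
Proof. by move=> /funext ->. Qed.

Lemma cmeas_cst z : cmeas (fun=> z).
Proof. by split; exact: measurable_cst. Qed.

Lemma cmeasM f1 f2 : cmeas f1 -> cmeas f2 -> cmeas (fun x => f1 x * f2 x).
Proof.
move=> [? ?] [? ?]; split.
- under eq_fun do rewrite ReM.
  by apply: measurable_funB; apply: measurable_funM.
- under eq_fun do rewrite ImM.
  by apply: measurable_funD; apply: measurable_funM.
Qed.

Lemma cmeasD f1 f2 : cmeas f1 -> cmeas f2 -> cmeas (fun x => f1 x + f2 x).
Proof.
move=> [? ?] [? ?]; split.
- by under eq_fun do rewrite ReD; exact: measurable_funD.
- by under eq_fun do rewrite ImD; exact: measurable_funD.
Qed.

Lemma cmeasN f : cmeas f -> cmeas (fun x => - f x).
Proof.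
move=> [mf1 mf2]; split.
- by under eq_fun do rewrite ReN; exact: measurableT_comp mf1.
- by under eq_fun do rewrite ImN; exact: measurableT_comp mf2.
Qed.

Lemma cmeas_real g : measurable_fun setT g -> cmeas (fun x => (g x)%:C).
Proof. by move=> mg; split => //=; exact: measurable_cst. Qed.

Lemma cmeas_lim (fn : nat -> T -> R[i]) f : (forall n, cmeas (fn n)) ->
  (forall x, ccvg (fn^~ x) (f x)) -> cmeas f.
Proof.
move=> mfn fnf; split.
- apply: (@measurable_fun_cvg _ _ _ _ (fun n x => complex.Re (fn n x))).
    by move=> n; exact: (mfn n).1.
  by move=> x _; exact: ccvg_Re.
- apply: (@measurable_fun_cvg _ _ _ _ (fun n x => complex.Im (fn n x))).
    by move=> n; exact: (mfn n).2.
  by move=> x _; exact: ccvg_Im.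
Qed.

Lemma rintZ k g : rint g -> rint (fun x => k * g x).
Proof. by move=> ig; have := integrableZl measurableT k ig. Qed.

Lemma rintD g1 g2 : rint g1 -> rint g2 -> rint (fun x => g1 x + g2 x).
Proof. by move=> i1 i2; have := integrableD measurableT i1 i2. Qed.

Lemma rint_meas g : rint g -> measurable_fun setT g.
Proof. by move=> /integrableP[/measurable_EFinP]. Qed.

Lemma rint_le g1 g2 : measurable_fun setT g1 -> (forall x, `|g1 x| <= g2 x) ->
  rint g2 -> rint g1.
Proof.
move=> mg1 g12; apply: le_integrable => //; first exact/measurable_EFinP.
by move=> x _; rewrite /= lee_fin (le_trans (g12 x))// ler_norm.
Qed.

Lemma cint_dom f g : cmeas f -> (forall x, normc (f x) <= g x) -> rint g ->
  cintegrable f.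
Proof.
move=> [mf1 mf2] fg ig; split.
- by apply: rint_le ig => // x; apply: (le_trans (Re_le_normc _)).
- by apply: rint_le ig => // x; apply: (le_trans (Im_le_normc _)).
Qed.

Lemma cI_lin (a : R[i]) f1 f2 : cintegrable f1 -> cintegrable f2 ->
  cI (fun x => a * f1 x + f2 x) = a * cI f1 + cI f2.
Proof.
move=> [r1 i1] [r2 i2]; apply: complexP.
- rewrite ReD ReM /cI/=.
  under eq_Rintegral do rewrite ReD ReM.
  rewrite RintegralD//; last first.
    by apply: (@integrableB _ _ _ m setT _ (EFin \o (fun x => complex.Re a * _ ))
       (EFin \o (fun x => complex.Im a * _ ))) => //; exact: rintZ.
  rewrite RintegralB//; try exact: rintZ.
  by rewrite !RintegralZl.
- rewrite ImD ImM /cI/=.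
  under eq_Rintegral do rewrite ImD ImM.
  rewrite RintegralD//; last by apply: rintD => //; exact: rintZ.
  rewrite RintegralD//; try exact: rintZ.
  by rewrite !RintegralZl.
Qed.

Lemma cintegrable0 : cintegrable (fun=> 0).
Proof. by split; exact: integrable0. Qed.

Lemma cI0 : cI (fun=> 0) = 0.
Proof. by rewrite /cI /Rintegral integral0. Qed.

Lemma cI_Z (a : R[i]) f : cintegrable f -> cI (fun x => a * f x) = a * cI f.
Proof.
move=> fi; rewrite -[RHS]addr0 -cI0 -(cI_lin _ fi cintegrable0).
by apply: eq_cI => x; rewrite addr0.
Qed.

Lemma cI_D f1 f2 : cintegrable f1 -> cintegrable f2 ->
  cI (fun x => f1 x + f2 x) = cI f1 + cI f2.
Proof.
move=> i1 i2; rewrite -[cI f1]mul1r -cI_lin//.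
by apply: eq_cI => x; rewrite mul1r.
Qed.

(** The factor 2 is the price of bounding real and imaginary parts separately; it reappears in most
    of the constants below. *)
Lemma cI_le f g : cmeas f -> (forall x, normc (f x) <= g x) -> rint g ->
  normc (cI f) <= 2 * \int[m]_x g x.
Proof.
move=> mf fg ig; have [i1 i2] := cint_dom mf fg ig.
apply: (le_trans (normc_le_ReIm _)).
rewrite mulr_natl mulr2n; apply: lerD => /=.
- apply: (le_trans (le_normr_Rintegral measurableT i1)).
  apply: le_Rintegral => //; first exact: integrable_norm.
  by move=> x _; apply: (le_trans (Re_le_normc _)).
- apply: (le_trans (le_normr_Rintegral measurableT i2)).
  apply: le_Rintegral => //; first exact: integrable_norm.
  by move=> x _; apply: (le_trans (Im_le_normc _)).
Qed.

Lemma rint_dct (fn : nat -> T -> R) (f g : T -> R) :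
  (forall n, measurable_fun setT (fn n)) ->
  (forall x, fn n x @[n --> \oo] --> f x) ->
  (forall n x, `|fn n x| <= g x) -> rint g ->
  \int[m]_x fn n x @[n --> \oo] --> \int[m]_x f x.
Proof.
move=> mfn fnf fng ig.
have mf : measurable_fun setT f.
  by apply: (@measurable_fun_cvg _ _ _ _ fn) => // x _; exact: fnf.
have [] := @dominated_convergence _ _ _ m setT measurableT
  (fun n => EFin \o fn n) (EFin \o f) (EFin \o g).
- by move=> n; exact/measurable_EFinP.
- exact/measurable_EFinP.
- by apply: aeW => x _; apply: cvg_EFin; [exact: nearW|exact: fnf].
- exact: ig.
- by apply: aeW => x n _; rewrite /= lee_fin.
move=> i1 _ i2.
apply: fine_cvg; rewrite fineK; last exact: integrable_fin_num.
  exact: i2.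
Qed.

Lemma cI_dct (fn : nat -> T -> R[i]) f g : (forall n, cmeas (fn n)) ->
  (forall x, ccvg (fn^~ x) (f x)) ->
  (forall n x, normc (fn n x) <= g x) -> rint g ->
  ccvg (fun n => cI (fn n)) (cI f).
Proof.
move=> mfn fnf fng ig; apply: ccvgP => /=.
- apply: (@rint_dct (fun n x => complex.Re (fn n x)) _ g) => //.
  + by move=> n; exact: (mfn n).1.
  + by move=> x; exact: (ccvg_Re (fnf x)).
  + by move=> n x; apply: le_trans (fng n x); exact: Re_le_normc.
- apply: (@rint_dct (fun n x => complex.Im (fn n x)) _ g) => //.
  + by move=> n; exact: (mfn n).2.
  + by move=> x; exact: (ccvg_Im (fnf x)).
  + by move=> n x; apply: le_trans (fng n x); exact: Im_le_normc.
Qed.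

End ComplexIntegral.

(** * Fubini's theorem under domination by a product of integrable functions *)

Section ComplexFubini.
Context d1 d2 (T1 : measurableType d1) (T2 : measurableType d2) (R : realType).
Variable m1 : {sigma_finite_measure set T1 -> \bar R}.
Variable m2 : {sigma_finite_measure set T2 -> \bar R}.
Variables (a : T1 -> R) (b : T2 -> R).
Hypotheses (ia : rint m1 a) (ib : rint m2 b).

Lemma rint_section1 (f : T1 * T2 -> R) x : measurable_fun setT f ->
  (forall p, `|f p| <= a p.1 * b p.2) -> rint m2 (fun y => f (x, y)).
Proof.
move=> mf fab; apply: (rint_le _ _ (rintZ (a x) ib)).
  exact: measurableT_comp mf _.
by move=> y; exact: fab.
Qed.

Lemma rint_section2 (f : T1 * T2 -> R) y : measurable_fun setT f ->
  (forall p, `|f p| <= a p.1 * b p.2) -> rint m1 (fun x => f (x, y)).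
Proof.
move=> mf fab; apply: (rint_le _ _ (rintZ (b y) ia)).
  exact: measurableT_comp mf _.
by move=> x; rewrite mulrC; exact: fab.
Qed.

(** Every use of Fubini goes through a bound by a product a(x) b(y), which gives integrability on
    the product and on each section at once. *)
Lemma rint_tensor : rint (m1 \x m2)%E (fun p => a p.1 * b p.2).
Proof.
have mab : measurable_fun setT (fun p : T1 * T2 => a p.1 * b p.2).
  apply: measurable_funM.
  - exact: measurableT_comp (rint_meas ia) _.
  - exact: measurableT_comp (rint_meas ib) _.
apply/integrable12ltyP; first exact/measurable_EFinP.
have nia := integrable_norm ia; have nib := integrable_norm ib.
rewrite (eq_integral (fun x => (`|a x| * \int[m2]_y `|b y|)%:E)); last first.
  move=> x _ /=; under eq_integral do rewrite normrM EFinM.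
  rewrite integralZl//; rewrite EFinM /Rintegral fineK//.
  exact: integrable_fin_num.
have := rintZ (\int[m2]_y `|b y|) nia => /(integrable_lty measurableT).
by under eq_integral do rewrite /= mulrC.
Qed.

Lemma rint_prod (f : T1 * T2 -> R) : measurable_fun setT f ->
  (forall p, `|f p| <= a p.1 * b p.2) -> rint (m1 \x m2)%E f.
Proof. by move=> mf fab; apply: rint_le rint_tensor. Qed.

Lemma rint_fubini1 (f : T1 * T2 -> R) : measurable_fun setT f ->
  (forall p, `|f p| <= a p.1 * b p.2) ->
  \int[m1]_x \int[m2]_y f (x, y) = \int[(m1 \x m2)%E]_p f p.
Proof.
move=> mf fab; have fi := rint_prod mf fab.
rewrite {1 3}/Rintegral -(integral12_prod_meas1 fi); congr fine.
apply: eq_integral => x _; rewrite /Rintegral fineK//.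
by apply: integrable_fin_num => //; exact: rint_section1.
Qed.

Lemma rint_fubini2 (f : T1 * T2 -> R) : measurable_fun setT f ->
  (forall p, `|f p| <= a p.1 * b p.2) ->
  \int[m2]_y \int[m1]_x f (x, y) = \int[(m1 \x m2)%E]_p f p.
Proof.
move=> mf fab; have fi := rint_prod mf fab.
rewrite {1 3}/Rintegral -(integral21_prod_meas1 fi); congr fine.
apply: eq_integral => x _; rewrite /Rintegral fineK//.
by apply: integrable_fin_num => //; exact: rint_section2.
Qed.

Lemma measurable_section_int1 (f : T1 * T2 -> R) : measurable_fun setT f ->
  (forall p, `|f p| <= a p.1 * b p.2) ->
  measurable_fun setT (fun x => \int[m2]_y f (x, y)).
Proof.
move=> mf fab; have fi := rint_prod mf fab.
have := measurable_fubini_F fi => mF.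
by apply: measurableT_comp mF.
Qed.

Lemma measurable_section_int2 (f : T1 * T2 -> R) : measurable_fun setT f ->
  (forall p, `|f p| <= a p.1 * b p.2) ->
  measurable_fun setT (fun y => \int[m1]_x f (x, y)).
Proof.
move=> mf fab; have fi := rint_prod mf fab.
have := measurable_fubini_G fi => mF.
by apply: measurableT_comp mF.
Qed.

Variable F : T1 * T2 -> R[i].
Hypothesis mF : cmeas F.
Hypothesis Fab : forall x y, normc (F (x, y)) <= a x * b y.

Let ReFab p : `|complex.Re (F p)| <= a p.1 * b p.2.
Proof. by case: p => x y; apply: (le_trans (Re_le_normc _)). Qed.

Let ImFab p : `|complex.Im (F p)| <= a p.1 * b p.2.
Proof. by case: p => x y; apply: (le_trans (Im_le_normc _)). Qed.

Lemma cI_fubini1 : cI m1 (fun x => cI m2 (fun y => F (x, y))) = cI (m1 \x m2)%E F.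
Proof.
move: mF => [? ?]; apply: complexP => /=.
- exact: (rint_fubini1 (f := fun p => complex.Re (F p))).
- exact: (rint_fubini1 (f := fun p => complex.Im (F p))).
Qed.

Lemma cI_fubini2 : cI m2 (fun y => cI m1 (fun x => F (x, y))) = cI (m1 \x m2)%E F.
Proof.
move: mF => [? ?]; apply: complexP => /=.
- exact: (rint_fubini2 (f := fun p => complex.Re (F p))).
- exact: (rint_fubini2 (f := fun p => complex.Im (F p))).
Qed.

Lemma cI_swap : cI m1 (fun x => cI m2 (fun y => F (x, y))) =
  cI m2 (fun y => cI m1 (fun x => F (x, y))).
Proof. by rewrite cI_fubini1 cI_fubini2. Qed.

Lemma cmeas_section1 : cmeas (fun x => cI m2 (fun y => F (x, y))).
Proof.
move: mF => [? ?]; split => /=.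
- exact: (measurable_section_int1 (f := fun p => complex.Re (F p))).
- exact: (measurable_section_int1 (f := fun p => complex.Im (F p))).
Qed.

Lemma cmeas_section2 : cmeas (fun y => cI m1 (fun x => F (x, y))).
Proof.
move: mF => [? ?]; split => /=.
- exact: (measurable_section_int2 (f := fun p => complex.Re (F p))).
- exact: (measurable_section_int2 (f := fun p => complex.Im (F p))).
Qed.

Lemma cint_section1 : cintegrable m1 (fun x => cI m2 (fun y => F (x, y))).
Proof.
apply: (cint_dom cmeas_section1 _ (rintZ (2 * \int[m2]_y b y) ia)) => x.
apply: (le_trans (@cI_le _ _ _ m2 _ (fun y => a x * b y) _ (Fab x) (rintZ _ ib))).
  by move: mF => [mF1 mF2]; split; [exact: measurableT_comp mF1 _|exact: measurableT_comp mF2 _].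
by rewrite RintegralZl//; apply: eqW; ring.
Qed.

End ComplexFubini.

Section ProductSigmaFinite.
Context d1 d2 (T1 : measurableType d1) (T2 : measurableType d2) (R : realType).
Variable m1 : {sigma_finite_measure set T1 -> \bar R}.
Variable m2 : {sigma_finite_measure set T2 -> \bar R}.

Let product_sigma_finite : sigma_finite setT (m1 \x m2)%E.
Proof.
have /sigma_finiteP[F [UF Fnd Fm]] := sigma_finiteT m1.
have /sigma_finiteP[G [UG Gnd Gm]] := sigma_finiteT m2.
exists (fun n => F n `*` G n).
  apply/seteqP; split => // -[x y] _.
  have [i _ Fix] : (\bigcup_i F i) x by rewrite -UF.
  have [j _ Gjy] : (\bigcup_i G i) y by rewrite -UG.
  exists (maxn i j) => //; split => /=.
  - by have /subsetPset := Fnd _ _ (leq_maxl i j); exact.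
  - by have /subsetPset := Gnd _ _ (leq_maxr i j); exact.
move=> n; have [mF Foo] := Fm n; have [mG Goo] := Gm n.
split; first exact: measurableX.
by rewrite product_measure1E// lte_mul_pinfty// ge0_fin_numE.
Qed.

(** A name for the product measure to which a sigma-finite structure can be attached; it unfolds to
    the measure of [cint2]. This structure is what allows Fubini on R^2 x R^2, for pairs of
    frequencies. *)
Definition prod_meas : set (T1 * T2)%type -> \bar R := (m1 \x m2)%E.

HB.instance Definition _ := Measure.on prod_meas.

HB.instance Definition _ :=
  @Measure_isSigmaFinite.Build _ _ R prod_meas product_sigma_finite.

Definition prodm : {sigma_finite_measure set (T1 * T2)%type -> \bar R} := prod_meas.

End ProductSigmaFinite.

Section PlaneMeasure.
Variable R : realType.

Definition RL := measurableTypeR R.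
Definition mu1 : {sigma_finite_measure set RL -> \bar R} := @lebesgue_measure R.
Definition mu2 : {sigma_finite_measure set (RL * RL)%type -> \bar R} :=
  prodm mu1 mu1.

Lemma cint2E (f : R * R -> R[i]) : cint2 f = cI mu2 f.
Proof. by []. Qed.
Lemma cintTE (f : R -> R[i]) : cint setT f = cI mu1 f.
Proof. by []. Qed.

Definition meas1 (f : RL -> R) := measurable_fun setT f.
Definition meas2 (f : RL * RL -> R) := measurable_fun setT f.

Lemma continuous_meas1 (f : R -> R) : continuous f -> meas1 f.
Proof. exact: continuous_measurable_fun. Qed.

Lemma meas2_fst (f : R -> R) : meas1 f -> meas2 (fun p => f p.1).
Proof. by move=> cf; apply: measurableT_comp cf _; exact: measurable_fst. Qed.

Lemma meas2_snd (f : R -> R) : meas1 f -> meas2 (fun p => f p.2).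
Proof. by move=> cf; apply: measurableT_comp cf _; exact: measurable_snd. Qed.

End PlaneMeasure.

Section PlaneMeasurability.
Variable R : realType.

(** Rounding down to a multiple of 1/(n+1). Freezing one variable on grid cells reduces
    measurability for the product sigma-algebra, generated by rectangles, to continuity in the other
    variable. *)
Definition grid (n : nat) (x : R) : R := (Num.floor (x * n.+1%:R))%:~R / n.+1%:R.

Lemma grid_cvg x : grid n x @[n --> \oo] --> x.
Proof.
apply/cvgrPdist_le => e e0.
have := @cvg_harmonic R => /cvgrPdist_le /(_ e e0).
apply: filterS => n; rewrite sub0r normrN ger0_norm ?invr_ge0// => ne.
apply: le_trans ne; rewrite /grid /harmonic.
have := floor_itv (x * n.+1%:R); rewrite rmorphD/= => /andP[h1 h2].
have n0 : 0 < n.+1%:R :> R by rewrite ltr0n.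
rewrite -{1}(@mulfK _ n.+1%:R _ x) ?gt_eqF// -mulrBl normrM normfV (ger0_norm (ltW n0)).
rewrite ler_pdivrMr// mulVf ?gt_eqF//.
by rewrite ger0_norm; lra.
Qed.

Lemma grid_cvg2 (x y : R) : ((grid n x, y) @[n --> \oo] --> ((x, y) : R * R)).
Proof. by apply: (@cvg_pair _ _ _ _ (nbhs x) (nbhs y)) => //=; [exact: grid_cvg|exact: cvg_cst]. Qed.

(* The first variable is approximated by a grid. *)
Lemma continuous_meas2 (f : R * R -> R) : continuous f -> meas2 f.
Proof.
move=> cf; apply: (@measurable_fun_cvg _ _ _ _ (fun n p => f (grid n p.1, p.2))).
- move=> n.
  have n0 : 0 < n.+1%:R :> R by rewrite ltr0n.
  pose h (k : int) (p : RL R * RL R) := f (k%:~R / n.+1%:R, p.2).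
  move=> _ Y mY; rewrite setTI.
  rewrite (_ : _ @^-1` Y = \bigcup_(k in [set: int])
    ((fst @^-1` `[k%:~R / n.+1%:R, (k + 1)%:~R / n.+1%:R[%classic) `&` (h k @^-1` Y))); last first.
    apply/seteqP; split => [[x y]/= Yf|[x y] [k _ [/=]]].
      exists (Num.floor (x * n.+1%:R)) => //; split => //=.
      by rewrite in_itv/= ler_pdivrMr// ltr_pdivlMr// floor_itv.
    rewrite in_itv/= ler_pdivrMr// ltr_pdivlMr// => /floor_def kE.
    by rewrite /h/= /grid kE.
  apply: countable_bigcupT_measurable => // k; apply: measurableI.
    rewrite -[X in measurable X]setTI.
    by apply: measurable_fst => //; exact: measurable_itv.
  rewrite -[X in measurable X]setTI.
  apply: (@meas2_snd R (fun y => f (k%:~R / n.+1%:R, y))) => //.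
  apply: continuous_meas1 => y.
  have cp : ((k%:~R / n.+1%:R : R, z) @[z --> y] --> (k%:~R / n.+1%:R : R, y)).
    exact: (@cvg_pair _ _ _ (nbhs (y : R)) (nbhs (k%:~R / n.+1%:R : R)) (nbhs (y : R)) _ _ _ (fun=> k%:~R / n.+1%:R : R) id (cvg_cst _) cvg_id).
  exact: (@cvg_comp _ _ _ _ f _ _ _ cp (cf _)).
- move=> [x y] _; have cp := @grid_cvg2 x y.
  exact: (@cvg_comp _ _ _ _ f _ _ _ cp (cf _)).
Qed.

End PlaneMeasurability.

(** * The distribution 1/(x+i0) *)

Section RealLine.
Variable R : realType.
Notation mu := (@mu1 R).
Implicit Types (a b e x A : R).

Lemma derive_continuous (F f : R -> R) :
  (forall x, is_derive x 1 F (f x)) -> continuous F.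
Proof.
move=> dF x; apply: differentiable_continuous.
by apply/derivable1_diffP; apply: ex_derive; exact: dF.
Qed.

Lemma ftc_itv (F f : R -> R) a b : a < b ->
  (forall x, is_derive x 1 F (f x)) -> continuous f ->
  \int[mu]_(x in `[a, b]) f x = F b - F a.
Proof.
move=> ab dF cf; rewrite /Rintegral (@continuous_FTC2 _ f F)//.
- exact: continuous_subspaceT.
- have cF := derive_continuous dF; split.
  + by move=> x _; apply: ex_derive; exact: dF.
  + exact/cvg_at_right_filter/cF.
  + exact/cvg_at_left_filter/cF.
- by move=> x _; rewrite derive1E; apply: derive_val; exact: dF.
Qed.

Lemma int_supp (f : R -> R) a b : (forall x, ~ (a <= x <= b) -> f x = 0) ->
  \int[mu]_x f x = \int[mu]_(x in `[a, b]) f x.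
Proof.
move=> f0; rewrite [RHS]Rintegral_mkcond; apply: eq_Rintegral => x _.
rewrite patchE; case: ifPn => // /negP xab; apply: f0 => xab'; apply: xab.
by rewrite inE/= in_itv.
Qed.

Definition ind a b (x : R) : R := \1_(`[a, b]%classic) x.

Lemma indE a b x : ind a b x = if a <= x <= b then 1 else 0.
Proof.
rewrite /ind indicE; case: ifPn => [h|/negP h]; first by rewrite mem_set//= in_itv.
by rewrite memNset//= in_itv.
Qed.

Lemma ind_ge0 a b x : 0 <= ind a b x.
Proof. by rewrite indE; case: ifP. Qed.

Lemma ind_le1 a b x : ind a b x <= 1.
Proof. by rewrite indE; case: ifP. Qed.

Lemma rint_ind a b : rint mu (ind a b).
Proof. exact: integrable_indic_itv. Qed.

Lemma int_indM a b (f : R -> R) :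
  \int[mu]_x (ind a b x * f x) = \int[mu]_(x in `[a, b]) f x.
Proof.
rewrite (@int_supp _ a b).
  apply: eq_Rintegral => x; rewrite inE/= in_itv/= => xab.
  by rewrite indE xab mul1r.
by move=> x /negP/negbTE xab; rewrite indE xab mul0r.
Qed.

Lemma int_ind a b : a <= b -> \int[mu]_x ind a b x = b - a.
Proof.
move=> ab; transitivity (\int[mu]_x (ind a b x * 1)).
  by apply: eq_Rintegral => x _; rewrite mulr1.
rewrite int_indM Rintegral_cst//= mul1r lebesgue_measure_itv/= lte_fin.
by move: ab; rewrite le_eqVlt => /predU1P[->|->]//; rewrite ltxx subrr.
Qed.

Lemma sqD_gt0 x e : 0 < e -> 0 < x ^+ 2 + e ^+ 2.
Proof. by move=> e0; rewrite ltr_wpDl ?sqr_ge0// exprn_gt0. Qed.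

Lemma is_derive_lnsq e x : 0 < e ->
  is_derive x 1 (fun y : R => ln (y ^+ 2 + e ^+ 2) / 2) (x / (x ^+ 2 + e ^+ 2)).
Proof.
move=> e0; have x0 := sqD_gt0 x e0.
have h : is_derive x 1 (fun y : R => y ^+ 2 + e ^+ 2) (2 * x).
  apply: is_derive_eq; rewrite /GRing.scale/= /GRing.scale/=. ring.
have h2 := @is_derive1_comp _ (@ln R) (fun y : R => y ^+ 2 + e ^+ 2) x _ _ (is_derive1_ln x0) h.
have h3 := @is_deriveM _ _ (@ln R \o (fun y => y ^+ 2 + e ^+ 2)) (cst 2^-1) x 1 _ _ h2 (is_derive_cst _ _ _).
apply: (is_derive_eq h3); rewrite /GRing.scale/=; field; exact: lt0r_neq0.
Qed.

Lemma is_derive_atanV e x : 0 < e ->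
  is_derive x 1 (fun y : R => atan (y / e)) (e / (x ^+ 2 + e ^+ 2)).
Proof.
move=> e0; have x0 := sqD_gt0 x e0.
have h : is_derive x 1 (fun y : R => y / e) (e^-1).
  apply: is_derive_eq; rewrite /GRing.scale/=. ring.
have h2 := @is_derive1_comp _ (@atan R) (fun y : R => y / e) x _ _ (is_derive1_atan (x / e)) h.
apply: (is_derive_eq h2).
have h3 : 1 + (x / e) ^+ 2 != 0 by rewrite gt_eqF// ltr_pwDl// sqr_ge0.
by field; rewrite !gt_eqF//=.
Qed.

Lemma continuous_divsq (f : R -> R) e : 0 < e -> continuous f ->
  continuous (fun x => f x / (x ^+ 2 + e ^+ 2)).
Proof.
move=> e0 cf x; apply: cvgM; first exact: cf.
apply: cvgV; first by rewrite gt_eqF// sqD_gt0.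
by apply: cvgD; [exact: exprn_continuous|exact: cvg_cst].
Qed.

(** The logarithmic primitive is even and takes equal values at both ends: this is the cancellation
    behind the principal value. *)
Lemma int_xdiv e A : 0 < e -> 0 < A ->
  \int[mu]_(x in `[(- A), A]) (x / (x ^+ 2 + e ^+ 2)) = 0.
Proof.
move=> e0 A0.
rewrite (ftc_itv _ (fun x => is_derive_lnsq x e0)).
- by rewrite sqrrN subrr.
- by rewrite gtrN.
- by apply: (@continuous_divsq id) => // x; exact: cvg_id.
Qed.

(** For every A this tends to pi as e tends to 0, which is the mass of the delta term. *)
Lemma int_ediv e A : 0 < e -> 0 < A ->
  \int[mu]_(x in `[(- A), A]) (e / (x ^+ 2 + e ^+ 2)) = 2 * atan (A / e).
Proof.
move=> e0 A0; rewrite (ftc_itv _ (fun x => is_derive_atanV x e0)).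
- by rewrite mulNr atanN opprK; ring.
- by rewrite gtrN.
- by apply: (@continuous_divsq (cst e)) => // x; exact: cvg_cst.
Qed.

(* Functions on which the limit defining 1/(x+i0) exists: Lipschitz at 0 only,
   which is where the kernel is singular. *)
Definition lip0 A L B (f : R -> R[i]) :=
  [/\ cmeas (f : RL R -> _), forall x, ~ (- A <= x <= A) -> f x = 0,
      forall x, normc (f x - f 0) <= L * `|x| & forall x, normc (f x) <= B].

(** Closed form of the limit for f supported in [-A, A]. On this symmetric interval the principal
    value of 1/x against the constant [f 0] is zero, which leaves an absolutely convergent integral
    of the difference quotient, plus the delta term. *)
Definition inv_i0 A (f : R -> R[i]) : R[i] :=
  cI mu (fun x => (ind (- A) A x)%:C * ((x%:C)^-1 * (f x - f 0)))
  - 'i%C * pi%:C * f 0.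

Lemma inv_iepsE e x : (x +i* e)^-1 = (x / (x ^+ 2 + e ^+ 2)) +i* (- (e / (x ^+ 2 + e ^+ 2))) :> R[i].
Proof. by []. Qed.

Lemma cmeas_inv_ieps e : 0 < e -> cmeas (fun x : RL R => (x +i* e)^-1 : R[i]).
Proof.
move=> e0; split => /=.
- apply: continuous_meas1.
  by apply: (@continuous_divsq id) => // x; exact: cvg_id.
- apply: continuous_meas1 => x; apply: cvgN.
  by apply: (@continuous_divsq (cst e)) => // y; exact: cvg_cst.
Qed.

(** The second alternative is there because 0^-1 is 0, which makes the bound false at x = 0 when e
    is nonzero. *)
Lemma normc_inv_le e x : normc ((x +i* e)^-1 : R[i]) <= `|x|^-1 \/ x = 0.
Proof.
have [->|x0] := eqVneq x 0; [by right|left].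
rewrite normcV lef_pV2 ?posrE ?normr_gt0//; first exact: Re_le_normc (x +i* e).
by apply: lt_le_trans (Re_le_normc (x +i* e)); rewrite normr_gt0.
Qed.

(** The zero of z at x = 0 absorbs the singularity, uniformly in e; e = 0 is allowed and serves for
    the limit kernel 1/x. *)
Lemma normc_divx_le e x L (z : R[i]) : 0 <= L -> normc z <= L * `|x| ->
  normc ((x +i* e)^-1 * z) <= L.
Proof.
move=> L0 zL; rewrite normcM.
have [h|x0] := normc_inv_le e x; last first.
  move: zL; rewrite x0 normr0 mulr0 => zL.
  by rewrite (_ : normc z = 0) ?mulr0//; apply/eqP; rewrite eq_le zL normc_ge0.
have [x0|x0] := eqVneq x 0.
  move: zL; rewrite x0 normr0 mulr0 => zL.
  by rewrite (_ : normc z = 0) ?mulr0//; apply/eqP; rewrite eq_le zL normc_ge0.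
apply: (le_trans (ler_pM_normc h zL)).
by rewrite mulrCA mulVf ?normr_eq0// mulr1.
Qed.

Lemma cmeas_ind a b : cmeas (fun x : RL R => (ind a b x)%:C).
Proof. by apply: cmeas_real; exact: rint_meas (rint_ind a b). Qed.

Lemma normc_ind a b x z : normc ((ind a b x)%:C * z) = ind a b x * normc z.
Proof. by rewrite normcM normc_real ger0_norm// ind_ge0. Qed.

Lemma cI_ind_inv e A : 0 < e -> 0 < A ->
  cI mu (fun x => (ind (- A) A x)%:C * (x +i* e)^-1) = - ('i%C * (2 * atan (A / e))%:C).
Proof.
move=> e0 A0; apply: complexP.
- transitivity (\int[mu]_x (ind (- A) A x * (x / (x ^+ 2 + e ^+ 2)))).
    by apply: eq_Rintegral => x _; rewrite ReM inv_iepsE /= mul0r subr0.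
  rewrite int_indM int_xdiv// ReN ReM /=; ring.
- transitivity (\int[mu]_x (-1 * (ind (- A) A x * (e / (x ^+ 2 + e ^+ 2))))).
    by apply: eq_Rintegral => x _; rewrite ImM inv_iepsE /=; ring.
  rewrite RintegralZl//.
    by rewrite int_indM -(int_ediv e0 A0) ImN ImM /=; ring.
  apply: (@rint_le _ _ _ mu _ (fun x => e^-1 * ind (- A) A x)).
  + apply: measurable_funM; first exact: rint_meas (rint_ind _ _).
    by apply: continuous_meas1; apply: (@continuous_divsq (cst e)) => // y; exact: cvg_cst.
  + move=> x; have x0 := sqD_gt0 x e0.
    rewrite normrM mulrC ger0_norm ?divr_ge0 ?(ltW x0) ?(ltW e0)//.
    rewrite ger0_norm ?ind_ge0// ler_wpM2r ?ind_ge0//.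
    rewrite ler_pdivrMr//.
    rewrite (_ : e^-1 * _ = e^-1 * x ^+ 2 + e); last by field; rewrite gt_eqF.
    by rewrite lerDr mulr_ge0 ?sqr_ge0// invr_ge0 ltW.
  + exact/rintZ/rint_ind.
Qed.

(** Splits f into [f 0] and f - f 0 on [-A, A]: the constant part is integrated exactly by
    [cI_ind_inv], and in the other part the product with the kernel is bounded by L whatever e
    is. *)
Lemma inv_iepsE_lip0 A L B e f : 0 < e -> 0 < A -> 0 <= L -> lip0 A L B f ->
  inv_x_ieps e f =
  cI mu (fun x => (ind (- A) A x)%:C * ((x +i* e)^-1 * (f x - f 0)))
  - 'i%C * (2 * atan (A / e))%:C * f 0.
Proof.
move=> e0 A0 L0 [mf fA fL fB].
rewrite /inv_x_ieps /regular cintTE.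
have cmi := cmeas_inv_ieps e0.
rewrite (@eq_cI _ _ _ mu _ (fun x => f 0 * ((ind (- A) A x)%:C * (x +i* e)^-1)
    + (ind (- A) A x)%:C * ((x +i* e)^-1 * (f x - f 0)))); last first.
  move=> x; rewrite indE; case: ifPn => [|/negP] xA; first by rewrite !mul1r; ring.
  by rewrite (fA _ xA) !mul0r !mulr0 addr0.
rewrite cI_lin.
- by rewrite cI_ind_inv// addrC; congr +%R; ring.
- apply: (@cint_dom _ _ _ mu _ (fun x => e^-1 * ind (- A) A x)).
  + by apply: cmeasM => //; exact: cmeas_ind.
  + move=> x; rewrite normc_ind mulrC ler_wpM2r ?ind_ge0// normcV lef_pV2 ?posrE//.
      by rewrite -[leLHS]gtr0_norm//; exact: Im_le_normc (x +i* e).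
    exact: normc_ieps_gt0.
  + exact/rintZ/rint_ind.
- apply: (@cint_dom _ _ _ mu _ (fun x => L * ind (- A) A x)).
  + apply: cmeasM; first exact: cmeas_ind.
    by apply: cmeasM => //; apply: cmeasD => //; exact: cmeas_cst.
  + by move=> x; rewrite normc_ind mulrC ler_wpM2r ?ind_ge0// normc_divx_le.
  + exact/rintZ/rint_ind.
Qed.

(** 4 A L is the length 2 A times the bound L times the factor 2 of [cI_le]; pi B comes from 2
    atan(A/e) <= pi. The absence of e lets the bound survive the limit. *)
Lemma inv_ieps_bound A L B e f : 0 < e -> 0 < A -> 0 <= L -> lip0 A L B f ->
  normc (inv_x_ieps e f) <= 4 * A * L + pi * B.
Proof.
move=> e0 A0 L0 fl; rewrite (inv_iepsE_lip0 e0 A0 L0 fl).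
have [mf fA fL fB] := fl.
apply: (le_trans (normcB_le _ _)); apply: lerD.
  apply: (le_trans (@cI_le _ _ _ mu _ (fun x => L * ind (- A) A x) _ _ _)).
  - apply: cmeasM; first exact: cmeas_ind.
    apply: cmeasM => //; first exact: cmeas_inv_ieps.
    by apply: cmeasD => //; exact: cmeas_cst.
  - by move=> x; rewrite normc_ind mulrC ler_wpM2r ?ind_ge0// normc_divx_le.
  - exact/rintZ/rint_ind.
  - rewrite RintegralZl//; last exact: rint_ind.
    rewrite int_ind; last by rewrite ge0_cp// ltW.
    by apply: eqW; ring.
rewrite !normcM normc_real (_ : normc 'i%C = 1) ?mul1r; last first.
  by rewrite /normc expr0n/= add0r expr1n sqrtr1.
apply: ler_pM => //; first exact: normc_ge0.
have a0 : 0 <= atan (A / e).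
  by rewrite -(atan0 R) le_atan// divr_ge0// ltW.
rewrite ger0_norm; last by rewrite mulr_ge0.
have := atan_ltpi2 (A / e); lra.
Qed.

End RealLine.

(** * The limit of 1/(x+ie) as e tends to 0 *)

Section InvLimit.
Variable R : realType.
Notation mu := (@mu1 R).
Implicit Types (a b e x A : R).

Lemma ccvg_real (u : nat -> R) (l : R) : u n @[n --> \oo] --> l ->
  ccvg (fun n => (u n)%:C) l%:C.
Proof. by move=> ul; apply: ccvgP => //=; exact: cvg_cst. Qed.

Lemma cvg_atan_div A (u : nat -> R) : 0 < A -> (forall n, 0 < u n) ->
  u n @[n --> \oo] --> (0 : R) -> atan (A / u n) @[n --> \oo] --> pi / 2.
Proof.
move=> A0 u0 uc; apply: (cvg_comp _ _ _ (@cvgy_atan R)).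
apply/cvgryPge => M.
have e0 : 0 < A / (`|M| + 1) by rewrite divr_gt0// ltr_wpDl.
move/cvgrPdist_le : uc => /(_ _ e0); apply: filterS => n.
rewrite sub0r normrN gtr0_norm// => h.
rewrite ler_pdivlMr//; apply: (@le_trans _ _ ((`|M| + 1) * u n)).
  by rewrite ler_pM2r// ler_wpDr// ler_norm.
by rewrite mulrC -ler_pdivlMr// ltr_wpDl.
Qed.

Lemma ccvg_inv_ieps x (u : nat -> R) : x != 0 -> u n @[n --> \oo] --> (0 : R) ->
  ccvg (fun n => (x +i* u n)^-1) (x%:C)^-1.
Proof.
move=> x0 uc; have u2 : x ^+ 2 + u n ^+ 2 @[n --> \oo] --> x ^+ 2 + 0 ^+ 2.
  apply: cvgD; first exact: cvg_cst.
  by rewrite !expr2; under eq_fun do rewrite expr2; exact: cvgM.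
have x2 : x ^+ 2 + 0 ^+ 2 != 0 by rewrite expr0n/= addr0 expf_neq0.
apply: ccvgP => /=.
- by apply: cvgM; [exact: cvg_cst|exact: cvgV].
- by apply: cvgN; apply: cvgM => //; exact: cvgV.
Qed.

(** Dominated convergence is sequential; an arbitrary positive null sequence is taken so that
    [cvg_at_rightP] yields the one-sided limit in e. *)
Lemma inv_ieps_cvg_seq A L B (f : R -> R[i]) (u : nat -> R) : 0 < A -> 0 <= L ->
  lip0 A L B f -> (forall n, 0 < u n) -> u n @[n --> \oo] --> (0 : R) ->
  ccvg (fun n => inv_x_ieps (u n) f) (inv_i0 A f).
Proof.
move=> A0 L0 fl u0 uc.
under [X in ccvg X _]eq_fun do rewrite (inv_iepsE_lip0 (u0 _) A0 L0 fl).
have [mf fA fL fB] := fl.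
apply: ccvgD.
  apply: (@cI_dct _ _ _ mu _ _ (fun x => L * ind (- A) A x)).
  - move=> n; apply: cmeasM; first exact: cmeas_ind.
    apply: cmeasM => //; first exact: cmeas_inv_ieps.
    by apply: cmeasD => //; exact: cmeas_cst.
  - move=> x; apply: ccvgM; first exact: ccvg_cst.
    have [->|x0] := eqVneq x 0.
      rewrite subrr mulr0; under [X in ccvg X _]eq_fun do rewrite mulr0.
      exact: ccvg_cst.
    by apply: ccvgM; [exact: ccvg_inv_ieps|exact: ccvg_cst].
  - by move=> n x; rewrite normc_ind mulrC ler_wpM2r ?ind_ge0// normc_divx_le.
  - exact/rintZ/rint_ind.
have h : ccvg (fun n => (2 * atan (A / u n))%:C) pi%:C.
  apply: ccvg_real; have := cvgM (cvg_cst (2 : R)) (cvg_atan_div A0 u0 uc).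
  by rewrite mulrCA divff// mulr1; exact.
have := ccvgM (ccvgM (ccvg_cst (- 'i%C)) h) (ccvg_cst (f 0)).
by rewrite !mulNr; under [X in ccvg X _]eq_fun do rewrite !mulNr.
Qed.

(** [lim] returns a default value when there is no limit; on the functions of class [lip0] the value
    of [inv_x_i0] is thereby shown to be a genuine limit. *)
Lemma inv_x_i0E A L B (f : R -> R[i]) : 0 < A -> 0 <= L -> lip0 A L B f ->
  inv_x_i0 f = inv_i0 A f.
Proof.
move=> A0 L0 fl; apply: complexP; apply: cvg_lim => //.
- by apply/cvg_at_rightP => u [u0 uc]; exact: ccvg_Re (inv_ieps_cvg_seq A0 L0 fl u0 uc).
- by apply/cvg_at_rightP => u [u0 uc]; exact: ccvg_Im (inv_ieps_cvg_seq A0 L0 fl u0 uc).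
Qed.

Lemma inv_x_i0_cvg A L B (f : R -> R[i]) : 0 < A -> 0 <= L -> lip0 A L B f ->
  normc (inv_x_ieps eps f - inv_x_i0 f) @[eps --> 0^'+] --> (0 : R).
Proof.
move=> A0 L0 fl; rewrite (inv_x_i0E A0 L0 fl).
by apply/cvg_at_rightP => u [u0 uc]; exact: (inv_ieps_cvg_seq A0 L0 fl u0 uc).
Qed.

Definition epsn (n : nat) : R := n.+1%:R^-1.

Lemma epsn_gt0 n : 0 < epsn n.
Proof. by rewrite /epsn invr_gt0. Qed.

Lemma epsn_le1 n : epsn n <= 1.
Proof. by rewrite /epsn invf_le1// ler1n. Qed.

Lemma epsn_cvg : epsn n @[n --> \oo] --> (0 : R).
Proof. exact: cvg_harmonic. Qed.

Lemma inv_epsn_cvg A L B (f : R -> R[i]) : 0 < A -> 0 <= L -> lip0 A L B f ->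
  ccvg (fun n => inv_x_ieps (epsn n) f) (inv_x_i0 f).
Proof.
move=> A0 L0 fl; rewrite (inv_x_i0E A0 L0 fl).
apply: (inv_ieps_cvg_seq A0 L0 fl); [exact: epsn_gt0|exact: epsn_cvg].
Qed.

Lemma inv_x_i0_bound A L B (f : R -> R[i]) : 0 < A -> 0 <= L -> lip0 A L B f ->
  normc (inv_x_i0 f) <= 4 * A * L + pi * B.
Proof.
move=> A0 L0 fl; apply: (ccvg_le (inv_epsn_cvg A0 L0 fl)) => n.
exact: inv_ieps_bound (epsn_gt0 n) A0 L0 fl.
Qed.

Lemma lip0_lin A L L' B B' (a : R[i]) (f g : R -> R[i]) : lip0 A L B f -> lip0 A L' B' g ->
  lip0 A (normc a * L + L') (normc a * B + B') (fun x => a * f x + g x).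
Proof.
move=> [mf fA fL fB] [mg gA gL gB]; split.
- by apply: cmeasD => //; apply: cmeasM => //; exact: cmeas_cst.
- by move=> x xA; rewrite fA// gA// mulr0 addr0.
- move=> x; rewrite (_ : _ - _ = a * (f x - f 0) + (g x - g 0)); last by ring.
  apply: (le_trans (normcD_le _ _)); rewrite mulrDl lerD//.
  by rewrite normcM -mulrA ler_wpM2l ?normc_ge0.
- move=> x; apply: (le_trans (normcD_le _ _)); rewrite lerD//.
  by rewrite normcM ler_wpM2l ?normc_ge0.
Qed.

Lemma inv_x_i0_lin A L L' B B' (a : R[i]) (f g : R -> R[i]) : 0 < A -> 0 <= L ->
  0 <= L' -> lip0 A L B f -> lip0 A L' B' g ->
  inv_x_i0 (fun x => a * f x + g x) = a * inv_x_i0 f + inv_x_i0 g.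
Proof.
move=> A0 L0 L0' fl gl.
have ll := lip0_lin a fl gl.
have l0 : 0 <= normc a * L + L' by rewrite addr_ge0 ?mulr_ge0 ?normc_ge0.
rewrite (inv_x_i0E A0 l0 ll) (inv_x_i0E A0 L0 fl) (inv_x_i0E A0 L0' gl) /inv_i0.
have key (h : R -> R[i]) l b : 0 <= l -> lip0 A l b h -> cintegrable mu
    (fun x => (ind (- A) A x)%:C * ((x%:C)^-1 * (h x - h 0))).
  move=> l0' [mh hA hL hB].
  apply: (@cint_dom _ _ _ mu _ (fun x => l * ind (- A) A x)).
  - apply: cmeasM; first exact: cmeas_ind.
    (* The limit kernel is discontinuous at 0, so its measurability is inherited from the continuous
       kernels (x + i/(n+1))^-1. *)
    apply: (@cmeas_lim _ _ _ (fun n x => (x +i* epsn n)^-1 * (h x - h 0))).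
      move=> n; apply: cmeasM => //; first exact: cmeas_inv_ieps (epsn_gt0 n).
      by apply: cmeasD => //; exact: cmeas_cst.
    move=> x; have [->|x0] := eqVneq x 0.
      rewrite subrr mulr0; under [X in ccvg X _]eq_fun do rewrite mulr0.
      exact: ccvg_cst.
    by apply: ccvgM; [apply: ccvg_inv_ieps => //; exact: epsn_cvg|exact: ccvg_cst].
  - move=> x; rewrite normc_ind mulrC ler_wpM2r ?ind_ge0//.
    exact: (@normc_divx_le _ 0).
  - exact/rintZ/rint_ind.
rewrite (@eq_cI _ _ _ mu _ (fun x => a * ((ind (- A) A x)%:C * ((x%:C)^-1 * (f x - f 0)))
   + ((ind (- A) A x)%:C * ((x%:C)^-1 * (g x - g 0))))); last by move=> x; ring.
by rewrite cI_lin; [ring|exact: key fl|exact: key gl].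
Qed.

Lemma eq_inv_x_i0 (f g : R -> R[i]) : f =1 g -> inv_x_i0 f = inv_x_i0 g.
Proof. by move=> /funext ->. Qed.

End InvLimit.

(** * Test functions and cutoffs *)

Section TestFunctions.
Variables (R : realType) (V : normedModType R).
Implicit Types (f g : V -> R[i]) (v p : V) (Omega : set V).

Lemma cderives_rcons vs v f : cderives vs (cderive v f) = cderives (rcons vs v) f.
Proof. by rewrite /cderives foldr_rcons. Qed.

Lemma smooth_cderive f v : smooth f -> smooth (cderive v f).
Proof. by move=> sf vs; rewrite cderives_rcons; exact: sf. Qed.

Lemma smooth_derivable f : smooth f -> forall p v,
  derivable (Ref f) p v /\ derivable (Imf f) p v.
Proof. by move=> /(_ [::]) [_ _]. Qed.

Lemma smooth_continuous f : smooth f -> continuous (Ref f) /\ continuous (Imf f).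
Proof. by move=> /(_ [::]) []. Qed.

Lemma not_supp f p : ~ supp f p -> f p = 0.
Proof. by move=> fp; apply/eqP/negPn/negP => h; apply: fp; exact: subset_closure. Qed.

Lemma supp_sub f (F : set V) : closed F -> (forall p, ~ F p -> f p = 0) -> supp f `<=` F.
Proof.
move=> cF fF; rewrite /supp; have /closure_id -> := cF.
by apply: closureS => p /eqP fp; apply: contrapT => /fF.
Qed.

Lemma not_supp_cderive f v p : ~ supp f p -> cderive v f p = 0.
Proof.
move=> fp; have oS : open (~` supp f) by rewrite openC; exact: closed_closure.
have nz : \forall q \near p, f q = 0.
  by move: (open_nbhs_nbhs (conj oS fp)); apply: filterS => q; exact: not_supp.
rewrite /cderive.
have -> : 'D_v (Ref f) p = 0.
  have h : \forall q \near p, Ref f q = cst 0 q.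
    by apply: filterS nz => q; rewrite /Ref => ->.
  by rewrite (near_eq_derive _ h) derive_cst.
have -> : 'D_v (Imf f) p = 0.
  have h : \forall q \near p, Imf f q = cst 0 q.
    by apply: filterS nz => q; rewrite /Imf => ->.
  by rewrite (near_eq_derive _ h) derive_cst.
by [].
Qed.

Lemma supp_cderive f v : supp (cderive v f) `<=` supp f.
Proof.
apply: supp_sub; first exact: closed_closure.
by move=> p; exact: not_supp_cderive.
Qed.

Lemma test_fun_cderive Omega f v : test_fun Omega f -> test_fun Omega (cderive v f).
Proof.
move=> [sf cf fO]; split; first exact: smooth_cderive.
- exact: (subclosed_compact (@closed_closure _ _) cf (@supp_cderive f v)).
- by apply: subset_trans fO; exact: supp_cderive.
Qed.

Lemma bounded_supp f Omega : test_fun Omega f ->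
  exists A : R, 0 < A /\ forall p, ~ (`|p| <= A) -> f p = 0.
Proof.
move=> [_ /compact_bounded[M [Mr MA]] _].
exists (`|M| + 1); split; first by rewrite ltr_wpDl.
move=> p pA; apply: not_supp => sp; apply: pA.
by apply: MA => //; rewrite (le_lt_trans (ler_norm _))// ltrDl.
Qed.

Lemma real_bounded (F : V -> R) (K : set V) : compact K -> continuous F ->
  (forall p, ~ K p -> F p = 0) -> exists M : R, 0 <= M /\ forall p, `|F p| <= M.
Proof.
move=> cK cF FK; have [K0|/set0P K0] := eqVneq K set0.
  by exists 0; split=> // p; rewrite FK ?normr0// K0.
have cN : {within K, continuous (fun p => `|F p|)}.
  by apply: continuous_subspaceT => p; apply: cvg_norm; exact: cF.
have [c _ cM] := compact_EVT_max K0 cK cN.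
exists `|F c|; split => // p.
have [pK|/FK ->] := pselect (K p); last by rewrite normr0.
by apply: cM; rewrite inE.
Qed.

Lemma test_fun_bounded Omega f : test_fun Omega f ->
  exists M : R, 0 <= M /\ forall p, normc (f p) <= M.
Proof.
move=> [sf cf _]; have [c1 c2] := smooth_continuous sf.
have z1 p : ~ supp f p -> Ref f p = 0 by move=> /not_supp; rewrite /Ref => ->.
have z2 p : ~ supp f p -> Imf f p = 0 by move=> /not_supp; rewrite /Imf => ->.
have [M1 [M10 h1]] := real_bounded cf c1 z1.
have [M2 [M20 h2]] := real_bounded cf c2 z2.
exists (M1 + M2); split; first exact: addr_ge0.
by move=> p; apply: (le_trans (normc_le_ReIm _)); apply: lerD; [exact: h1|exact: h2].
Qed.

Lemma derive_line (F : V -> R) p v (h : R) : derivable F (p + h *: v) v ->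
  is_derive h 1 (fun s : R => F (p + s *: v)) ('D_v F (p + h *: v)).
Proof.
move=> dF; have e : (fun s : R => s^-1 *: (((fun s : R => F (p + s *: v)) \o shift h) (s *: (1 : R)) - F (p + h *: v)))
   = (fun s => s^-1 *: ((F \o shift (p + h *: v)) (s *: v) - F (p + h *: v))).
  apply/funext => s /=; congr (_ *: (F _ - _)).
  by rewrite [X in (X + h) *: v](_ : _ = s * 1)// mulr1 scalerDl addrCA.
apply: DeriveDef; first by rewrite /derivable e.
by rewrite /derive e.
Qed.

Lemma mvt_line (F : V -> R) p v (h M : R) : (forall q, derivable F q v) ->
  (forall q, `|'D_v F q| <= M) -> `|F (p + h *: v) - F p| <= M * `|h|.
Proof.
move=> dF FM.
have dl (s : R) : is_derive s (1 : R) (fun s : R => F (p + s *: v)) ('D_v F (p + s *: v)).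
  exact: derive_line.
have cl : continuous (fun s : R => F (p + s *: v)) := derive_continuous dl.
have key a b : a <= b -> `|F (p + b *: v) - F (p + a *: v)| <= M * `|b - a|.
  move=> ab; have [c _ ->] := @MVT_segment _ (fun s : R => F (p + s *: v))
      (fun s => 'D_v F (p + s *: v)) a b ab (fun x _ => dl x) (continuous_subspaceT cl).
  by rewrite normrM ler_wpM2r.
have [h0|/ltW h0] := leP 0 h.
  by have := key _ _ h0; rewrite scale0r addr0 subr0.
by have := key _ _ h0; rewrite scale0r addr0 sub0r distrC normrN.
Qed.

Lemma lipschitz_line f p v (h M : R) : smooth f -> (forall q, normc (cderive v f q) <= M) ->
  normc (f (p + h *: v) - f p) <= 2 * M * `|h|.
Proof.
move=> sf fM; apply: (le_trans (normc_le_ReIm _)).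
rewrite ReD ImD ReN ImN -mulrA mulr_natl mulr2n; apply: lerD.
- apply: (@mvt_line (Ref f)); first by move=> q; have [] := smooth_derivable sf q v.
  by move=> q; apply: le_trans (fM q); exact: (Re_le_normc (cderive v f q)).
- apply: (@mvt_line (Imf f)); first by move=> q; have [] := smooth_derivable sf q v.
  by move=> q; apply: le_trans (fM q); exact: (Im_le_normc (cderive v f q)).
Qed.

Lemma cderive_lin (a : R[i]) f g v p : smooth f -> smooth g ->
  cderive v (fun q => a * f q + g q) p = a * cderive v f p + cderive v g p.
Proof.
move=> /smooth_derivable /(_ p v) [f1 f2] /smooth_derivable /(_ p v) [g1 g2].
rewrite /cderive; apply: complexP; rewrite ?ReD ?ImD ?ReM ?ImM/=.
- have h1 : derivable (complex.Re a *: Ref f) p v by exact: derivableZ.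
  have h2 : derivable (complex.Im a *: Imf f) p v by exact: derivableZ.
  rewrite (_ : Ref _ = complex.Re a *: Ref f - complex.Im a *: Imf f + Ref g).
    by rewrite (deriveD (derivableB h1 h2) g1) (deriveB h1 h2) (deriveZ _ f1) (deriveZ _ f2).
  by apply/funext => q; rewrite /Ref/= ReD ReM.
- have h1 : derivable (complex.Re a *: Imf f) p v by exact: derivableZ.
  have h2 : derivable (complex.Im a *: Ref f) p v by exact: derivableZ.
  rewrite (_ : Imf _ = complex.Re a *: Imf f + complex.Im a *: Ref f + Imf g).
    by rewrite (deriveD (derivableD h1 h2) g2) (deriveD h1 h2) (deriveZ _ f2) (deriveZ _ f1).
  by apply/funext => q; rewrite /Imf/= ImD ImM.
Qed.

End TestFunctions.

(** * Real functions of class C^n and the flat function exp(-1/x) *)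

Section SmoothReal.
Variables (R : realType).

(** [smooth] quantifies over lists of directions, which suits neither products nor quotients.
    Counting the order instead allows closure properties to be proved by induction on n; [smooth_sm]
    goes back. *)
Fixpoint sm (V : normedModType R) (n : nat) (F : V -> R) : Prop :=
  continuous F /\ if n is n'.+1 then
    (forall p v, derivable F p v) /\ forall v, sm n' (fun p => 'D_v F p) else True.

Section Closure.
Variable V : normedModType R.
Implicit Types F G : V -> R.

Lemma sm_continuous n F : sm n F -> continuous F.
Proof. by case: n => [|n] []. Qed.

Lemma sm_weaken n F : sm n.+1 F -> sm n F.
Proof.
elim: n F => [|n IH] F [cF [dF sF]]; first by split.
by split=> //; split=> // v; apply: IH; exact: sF.
Qed.

Lemma sm_cst n (c : R) : sm n (fun _ : V => c).
Proof.
elim: n c => [|n IH] c; first by split => // p; exact: cvg_cst.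
split; first by move=> p; exact: cvg_cst.
split; first by move=> p v; exact: derivable_cst.
move=> v; have -> : (fun p => 'D_v (fun _ : V => c) p) = (fun=> 0).
  by apply/funext => p; rewrite derive_cst.
exact: IH.
Qed.

Lemma smD n F G : sm n F -> sm n G -> sm n (fun p => F p + G p).
Proof.
elim: n F G => [|n IH] F G [cF dF] [cG dG].
  by split => // p; apply: cvgD; [exact: cF|exact: cG].
move: dF dG => [dF sF] [dG sG].
split; first by move=> p; apply: cvgD; [exact: cF|exact: cG].
split; first by move=> p v; exact: derivableD.
move=> v; have -> : (fun p => 'D_v (fun p => F p + G p) p) = (fun p => 'D_v F p + 'D_v G p).
  by apply/funext => p; rewrite deriveD.
exact: (IH _ _ (sF v) (sG v)).
Qed.

Lemma smM n F G : sm n F -> sm n G -> sm n (fun p => F p * G p).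
Proof.
elim: n F G => [|n IH] F G sF0 sG0; move: (sF0) (sG0) => [cF dF] [cG dG].
  by split => // p; apply: cvgM; [exact: cF|exact: cG].
move: dF dG => [dF sF] [dG sG].
split; first by move=> p; apply: cvgM; [exact: cF|exact: cG].
split; first by move=> p v; exact: derivableM.
move=> v; have -> : (fun p => 'D_v (fun p => F p * G p) p) = (fun p => F p * 'D_v G p + G p * 'D_v F p).
  by apply/funext => p; rewrite deriveM.
exact: smD (IH _ _ (sm_weaken sF0) (sG v)) (IH _ _ (sm_weaken sG0) (sF v)).
Qed.

(** The derivative of 1/F contains 1/F again, but is needed at one order less: hence the induction
    on n with F fixed. *)
Lemma smV n F : (forall p, F p != 0) -> sm n F -> sm n (fun p => (F p)^-1).
Proof.
move=> F0; elim: n => [|n IH] sF0; move: (sF0) => [cF dF].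
  by split => // p; apply: cvgV; [exact: F0|exact: cF].
move: dF => [dF sF].
split; first by move=> p; apply: cvgV; [exact: F0|exact: cF].
split; first by move=> p v; exact: derivableV.
move=> v; have -> : (fun p => 'D_v (fun p => (F p)^-1) p) =
    (fun p => -1 * ((F p)^-1 * (F p)^-1) * 'D_v F p).
  by apply/funext => p; rewrite deriveV// /GRing.scale/= expr2 invfM mulN1r.
have sV := IH (sm_weaken sF0).
exact: smM (smM (sm_cst n _) (smM sV sV)) (sF v).
Qed.

Lemma smooth_sm (f : V -> R[i]) : (forall n, sm n (Ref f)) -> (forall n, sm n (Imf f)) ->
  smooth f.
Proof.
move=> s1 s2 vs.
have [h1 h2] : (forall n, sm n (Ref (cderives vs f))) /\ (forall n, sm n (Imf (cderives vs f))).
  elim: vs => [//|v vs [IH1 IH2]]; split => n.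
  - by have [_ [_]] := IH1 n.+1; exact.
  - by have [_ [_]] := IH2 n.+1; exact.
split; [exact: sm_continuous (h1 0%N)|exact: sm_continuous (h2 0%N)|].
move=> p v; have [_ [d1 _]] := h1 1%N; have [_ [d2 _]] := h2 1%N; by split.
Qed.

End Closure.

(** For phi affine with linear part L, the difference quotient of F o phi along v is literally that
    of F along L v, which replaces a chain rule. *)
Lemma sm_comp (V W : normedModType R) n (F : V -> R) (phi : W -> V) (L : W -> V) :
  continuous phi -> (forall (h : R) v p, phi (h *: v + p) = h *: L v + phi p) ->
  sm n F -> sm n (fun p => F (phi p)).
Proof.
move=> cphi affphi; elim: n F => [|n IH] F [cF dF].
  by split => // p; apply: (@cvg_comp _ _ _ phi F); [exact: cphi|exact: cF].
move: dF => [dF sF].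
have e p v : (fun h : R => h^-1 *: (((fun p => F (phi p)) \o shift p) (h *: v) - F (phi p)))
   = (fun h => h^-1 *: ((F \o shift (phi p)) (h *: L v) - F (phi p))).
  by apply/funext => h /=; rewrite affphi.
split; first by move=> p; apply: (@cvg_comp _ _ _ phi F); [exact: cphi|exact: cF].
split; first by move=> p v; rewrite /derivable e; exact: dF.
move=> v; have -> : (fun p => 'D_v (fun p => F (phi p)) p) = (fun p => 'D_(L v) F (phi p)).
  by apply/funext => p; rewrite /derive e.
exact: (IH _ (sF (L v))).
Qed.

Lemma derive_scale (F : R -> R) (x v d : R) : is_derive x 1 F d ->
  derivable F x v /\ 'D_v F x = v * d.
Proof.
move=> dF; have /derivable1_diffP df : derivable F x 1 by exact: ex_derive.
split; first exact: diff_derivable.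
rewrite deriveE// -(@derive_val _ _ _ _ _ _ _ dF) deriveE//.
by rewrite -[in LHS](mulr1 v) -[v * 1]/(v *: (1 : R)) linearZ.
Qed.

Lemma sm_derive n (F F' : R -> R) : (forall x : R, is_derive x (1 : R) F (F' x)) ->
  sm n F' -> sm n.+1 F.
Proof.
move=> dF sF'; split; first exact: derive_continuous dF.
split; first by move=> x v; have [] := derive_scale v (dF x).
move=> v; have -> : (fun p => 'D_v F p) = (fun x => v * F' x).
  by apply/funext => x; have [] := derive_scale v (dF x).
exact: (@smM _ n (fun=> v) F' (@sm_cst _ n v) sF').
Qed.

(** The classical flat function exp(-1/x), with the powers x^-k adjoined so that the family becomes
    stable under differentiation ([is_derive_flat]). *)
Definition flat (k : nat) (x : R) : R := if 0 < x then x ^- k * expR (- x^-1) else 0.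

Lemma flat_gt0 x : 0 < x -> 0 < flat 0 x.
Proof. by move=> x0; rewrite /flat x0 expr0 invr1 mul1r expR_gt0. Qed.

Lemma flat_ge0 x : 0 <= flat 0 x.
Proof. by rewrite /flat; case: ifP => // _; rewrite expr0 invr1 mul1r expR_ge0. Qed.

Lemma flat_le0 k x : x <= 0 -> flat k x = 0.
Proof. by move=> x0; rewrite /flat ltNge x0. Qed.

(** Follows from exp(y) >= (y/(k+1))^(k+1) at y = 1/x. The exponent exceeds k by one, which leaves
    the factor |x| and hence a limit 0 at the origin. *)
Lemma flat_bound k (x : R) : `|flat k x| <= k.+1%:R ^+ k.+1 * `|x|.
Proof.
have [x0|x0] := ltP 0 x; last by rewrite flat_le0// normr0 mulr_ge0// exprn_ge0.
rewrite /flat x0 ger0_norm; last by rewrite mulr_ge0 ?expR_ge0// invr_ge0 exprn_ge0// ltW.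
rewrite (gtr0_norm x0) expRN.
have h : (x^-1 / k.+1%:R) ^+ k.+1 <= expR x^-1.
  have -> : expR x^-1 = expR (x^-1 / k.+1%:R) ^+ k.+1 by rewrite -expRM_natl mulrC divfK.
  rewrite lerXn2r ?nnegrE ?expR_ge0 ?divr_ge0 ?invr_ge0 ?(ltW x0)//.
  by rewrite mulrC; apply: le_trans (expR_ge1Dx _); rewrite lerDr.
have k0 : 0 < k.+1%:R :> R by rewrite ltr0n.
have p0 : 0 < (x^-1 / k.+1%:R) ^+ k.+1 by rewrite exprn_gt0// divr_gt0// invr_gt0.
apply: (@le_trans _ _ (x ^- k * ((x^-1 / k.+1%:R) ^+ k.+1)^-1)).
  rewrite ler_wpM2l ?invr_ge0 ?exprn_ge0 ?(ltW x0)// lef_pV2 ?posrE ?expR_gt0//.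
rewrite exprMn -!exprVn invfM -!exprVn !invrK [x ^+ k.+1]exprSr.
by rewrite mulrA mulrA -exprMn mulVf ?gt_eqF// expr1n mul1r mulrC.
Qed.

Lemma is_derive_flat k (x : R) :
  is_derive (x : R) (1 : R) (flat k) (- k%:R * flat k.+1 x + flat k.+2 x).
Proof.
have [x0|x0|->] := ltrgtP x 0.
- have h : \forall y \near x, cst 0 y = flat k y.
    have : \forall y \near x, y < 0 by exact: lt_nbhsl.
    by apply: filterS => y /ltW y0; rewrite flat_le0.
  apply: (@near_eq_is_derive _ _ _ (cst 0) (flat k)) => //.
  by rewrite !flat_le0 ?(ltW x0)// mulr0 addr0; exact: is_derive_cst.
- have h : \forall y \near x, y ^- k * expR (- y^-1) = flat k y.
    have : \forall y \near x, 0 < y by exact: lt_nbhsr.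
    by apply: filterS => y y0; rewrite /flat y0.
  apply: (near_eq_is_derive h).
  have xn0 : x != 0 by rewrite gt_eqF.
  have dV : is_derive x 1 (fun y : R => y^-1) (- x ^- 2).
    apply: DeriveDef; first exact: derivableV.
    by rewrite deriveV// derive_id /GRing.scale/= mulr1.
  have d1 : is_derive x 1 (fun y : R => expR (- y^-1)) (x ^- 2 * expR (- x^-1)).
    have dN : is_derive x 1 (fun y : R => - y^-1) (x ^- 2).
      by apply: is_derive_eq; rewrite opprK.
    have := @is_derive1_comp _ (@expR R) (fun y : R => - y^-1) x _ _ (is_derive_expR _) dN.
    by rewrite mulrC.
  have d2 : is_derive x 1 (fun y : R => y ^- k) (- k%:R * x ^- k.+1).
    rewrite (_ : (fun y => _) = (fun y : R => y^-1) ^+ k); last first.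
      apply/funext => y; elim: k {h} => [|k IH]; first by rewrite !expr0 invr1.
      by rewrite !exprS invfM IH.
    case: k {h} => [|k].
      by rewrite expr0 oppr0 mul0r; exact: is_derive_cst.
    have h3 := @is_deriveX _ _ (fun y : R => y^-1) k.+1 x 1 _ dV.
    by apply: (is_derive_eq h3); rewrite /GRing.scale/= -!exprVn !exprS expr0; ring.
  apply: (is_derive_eq (is_deriveM d2 d1)).
  rewrite /flat x0 /GRing.scale/=.
  by rewrite !exprS !invfM expr0 invr1; ring.
- rewrite !flat_le0// mulr0 addr0.
  have h : (fun s : R => s^-1 *: ((flat k \o shift 0) (s *: (1 : R)) - flat k 0)) @ 0^' --> (0 : R).
    apply/cvgrPdist_le => e e0.
    have C0 : 0 < k.+2%:R ^+ k.+2 :> R by rewrite exprn_gt0.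
    near=> s.
    rewrite sub0r normrN /= (@flat_le0 k 0)// subr0 addr0 [s *: 1]mulr1.
    (* The difference quotient at 0 is the next member of the family, which [flat_bound] sends to
       0. *)
    have -> : s^-1 *: flat k s = flat k.+1 s.
      rewrite /flat; case: ifP => _; last by rewrite scaler0.
      by rewrite /GRing.scale/= exprS invfM mulrA.
    apply: (le_trans (flat_bound _ _)); rewrite mulrC -ler_pdivlMr//.
    near: s.
    have : (fun x : R => `|x|) @ 0^' --> `|0 : R|.
      by apply: cvg_norm; exact: cvg_within.
    rewrite normr0 => /cvgrPdist_le /(_ (e / k.+2%:R ^+ k.+2)).
    rewrite divr_gt0// => /(_ isT); apply: filterS => s.
    by rewrite sub0r normrN normr_id.
  by apply: DeriveDef; [apply/cvg_ex; exists 0|exact: cvg_lim].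
Unshelve. all: by end_near. Qed.

End SmoothReal.

(** * Smooth cutoff functions *)

Section Plateau.
Variables (R : realType).
Implicit Types (a b x A : R).

Lemma sm_flat n k : sm n (@flat R k).
Proof.
elim: n k => [|n IH] k.
  by split => //; exact: derive_continuous (is_derive_flat k).
apply: (sm_derive (is_derive_flat k)).
apply: (@smD _ _ n (fun x => - k%:R * flat k.+1 x)); last exact: IH.
by apply: (@smM _ R n (fun=> - k%:R) (flat k.+1)); [exact: sm_cst|exact: IH].
Qed.

Definition step x : R := flat 0 x / (flat 0 x + flat 0 (1 - x)).

Lemma step_den x : 0 < flat 0 x + flat 0 (1 - x).
Proof.
have [x0|x0] := ltP 0 x; first by rewrite ltr_pwDl ?flat_gt0// flat_ge0.
by rewrite ltr_wpDl ?flat_ge0// flat_gt0// subr_gt0 (le_lt_trans x0).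
Qed.

Lemma step0 x : x <= 0 -> step x = 0.
Proof. by move=> x0; rewrite /step flat_le0// mul0r. Qed.

Lemma step1 x : 1 <= x -> step x = 1.
Proof.
move=> x1; rewrite /step [X in _ + X]flat_le0 ?subr_le0// addr0 divff//.
by rewrite gt_eqF// flat_gt0// (lt_le_trans _ x1).
Qed.

Lemma sm_affine n (F : R -> R) (c d : R) : sm n F -> sm n (fun x => F (c * x + d)).
Proof.
apply: (@sm_comp _ _ _ n F (fun x : R => c * x + d) (fun v => c * v)).
- by move=> x; apply: cvgD; [apply: cvgM; [exact: cvg_cst|exact: cvg_id]|exact: cvg_cst].
- by move=> h v p; rewrite /GRing.scale/=; ring.
Qed.

Lemma sm_step n : sm n step.
Proof.
have s1 : sm n (fun x : R => flat 0 (1 - x)).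
  have := @sm_affine n (flat 0) (-1) 1 (sm_flat n 0).
  by congr sm; apply/funext => x; congr flat; ring.
apply: (smM (sm_flat n 0)); apply: (@smV _ _ n (fun x => flat 0 x + flat 0 (1 - x))).
  by move=> x; rewrite gt_eqF// step_den.
exact: smD (sm_flat n 0) s1.
Qed.

Definition plateau a b c d x : R := step ((x - a) / (b - a)) * step ((d - x) / (d - c)).

Lemma sm_plateau n a b c d : sm n (plateau a b c d).
Proof.
have s1 : sm n (fun x : R => step ((x - a) / (b - a))).
  have := @sm_affine n step (b - a)^-1 (- a / (b - a)) (sm_step n).
  by congr sm; apply/funext => x; congr step; ring.
have s2 : sm n (fun x : R => step ((d - x) / (d - c))).
  have := @sm_affine n step (- (d - c)^-1) (d / (d - c)) (sm_step n).
  by congr sm; apply/funext => x; congr step; ring.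
exact: smM s1 s2.
Qed.

Lemma plateau1 a b c d x : a < b -> c < d -> b <= x <= c -> plateau a b c d x = 1.
Proof.
move=> ab cd /andP[bx xc]; rewrite /plateau !step1 ?mulr1//.
- by rewrite ler_pdivlMr ?subr_gt0// mul1r lerB.
- by rewrite ler_pdivlMr ?subr_gt0// mul1r lerB.
Qed.

Lemma plateau0 a b c d x : a < b -> c < d -> ~ (a <= x <= d) -> plateau a b c d x = 0.
Proof.
move=> ab cd /negP; rewrite negb_and -!ltNge /plateau => /orP[xa|dx].
- by rewrite step0 ?mul0r// ler_pdivrMr ?subr_gt0// mul0r subr_le0 ltW.
- by rewrite [X in _ * X]step0 ?mulr0// ler_pdivrMr ?subr_gt0// mul0r subr_le0 ltW.
Qed.

Lemma Csm_real (V : normedModType R) (F : V -> R) : (forall n, sm n F) ->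
  smooth (fun p => (F p)%:C).
Proof.
move=> sF; apply: smooth_sm => n; first by have := sF n.
exact: (@sm_cst _ V n 0).
Qed.

Lemma sm_fst n (F : R -> R) : sm n F -> sm n (fun p : R * R => F p.1).
Proof.
apply: (@sm_comp _ R (R * R)%type n F fst fst) => //.
by move=> p; exact: cvg_fst.
Qed.

Lemma sm_snd n (F : R -> R) : sm n F -> sm n (fun p : R * R => F p.2).
Proof.
apply: (@sm_comp _ R (R * R)%type n F snd snd) => //.
by move=> p; exact: cvg_snd.
Qed.

Lemma test_fun_tensor (F G : R -> R) a b c d (Omega : set (R * R)) :
  (forall n, sm n F) -> (forall n, sm n G) ->
  (forall x, ~ (a <= x <= b) -> F x = 0) -> (forall x, ~ (c <= x <= d) -> G x = 0) ->
  (forall p, a <= p.1 <= b -> c <= p.2 <= d -> Omega p) ->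
  test_fun Omega (fun p => (F p.1 * G p.2)%:C).
Proof.
move=> sF sG F0 G0 O.
have cK : compact (`[a, b]%classic `*` `[c, d]%classic).
  by apply: compact_setX; exact: segment_compact.
have sub : supp (fun p : R * R => (F p.1 * G p.2)%:C) `<=` (`[a, b]%classic `*` `[c, d]%classic).
  apply: supp_sub; first exact: compact_closed.
  move=> p; rewrite /= !in_itv/= => /not_andP[/F0 ->|/G0 ->]; first by rewrite mul0r.
  by rewrite mulr0.
split.
- by apply: Csm_real => n; apply: smM; [exact: sm_fst|exact: sm_snd].
- by apply: (subclosed_compact (@closed_closure _ _) cK).
- by move=> p /sub [] /=; rewrite !in_itv/=; exact: O.
Qed.

End Plateau.

(** * The Fourier transform on the line *)

Section HalfLine.
Variables (R : realType).
Notation mu := (@mu1 R).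
Implicit Types (a b x A : R).

(** The integrable reference weight: decay estimates are brought to the form C w1, or C w2 on the
    plane, before dominated convergence or Fubini is applied. *)
Definition w1 x : R := (1 + x ^+ 2)^-1.

Lemma w1_gt0 x : 0 < w1 x.
Proof. by rewrite /w1 invr_gt0 ltr_pwDl// sqr_ge0. Qed.

Lemma continuous_w1 : continuous w1.
Proof. exact: (@continuous_oneDsqrV R). Qed.

Lemma rint_w1 : rint mu w1.
Proof.
apply/integrableP; split.
  by apply/measurable_EFinP; apply: continuous_meas1; exact: continuous_w1.
under eq_integral do rewrite /= (gtr0_norm (w1_gt0 _)).
rewrite ge0_symfun_integralT//.
- rewrite (_ : [set x | _] = `[0, +oo[%classic); last by rewrite set_itvcy.
  by rewrite integral0y_oneDsqr -EFinM ltry.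
- by move=> x; exact/ltW/w1_gt0.
- exact: continuous_w1.
- by move=> x; rewrite /w1/= sqrrN.
Qed.

Lemma int_refl (f : R -> R) : rint mu f -> rint mu (fun x => f (- x)) ->
  \int[mu]_x f (- x) = \int[mu]_x f x.
Proof.
move=> fi fNi; have mf := rint_meas fi.
have mN : measurable_fun setT (-%R : RL R -> RL R).
  by apply: continuous_meas1 => x; exact: cvgN.
have e : forall A : set (RL R), measurable A -> A `<=` setT ->
    mu A = pushforward mu (-%R : RL R -> RL R) A.
  by move=> A mA _; exact/esym/lebesgue_measureN.
rewrite /Rintegral; congr fine.
rewrite [RHS](eq_measure_integral (pushforward mu (-%R : RL R -> RL R))); last exact: e.
rewrite (@integral_pushforward _ _ _ _ _ _ mN mu setT (EFin \o f))//.
exact/measurable_EFinP.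
Qed.

Section Exponential.
Variable a : R.
Hypothesis a0 : 0 < a.

(** Two-sided exponential, the summation factor inserted in the Fourier inversion formula; its
    transform is a Poisson kernel ([cI_expc]). *)
Definition expc x : R := expR (- (a * `|x|)).

Lemma continuous_expc : continuous expc.
Proof.
move=> x; apply: (@cvg_comp _ _ _ (fun x => - (a * `|x|)) (@expR R)).
  by apply: cvgN; apply: cvgM; [exact: cvg_cst|apply: cvg_norm; exact: cvg_id].
exact: continuous_expR.
Qed.

Lemma is_derive_expa x : is_derive x (1 : R) (fun s : R => expR (- (a * s))) (- a * expR (- (a * x))).
Proof.
have h : is_derive x (1 : R) (fun s : R => - (a * s)) (- a).
  by apply: is_derive_eq; rewrite /GRing.scale/=; ring.
by have := @is_derive1_comp _ (@expR R) (fun s : R => - (a * s)) x _ _ (is_derive_expR _) h; rewrite mulrC.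
Qed.

Lemma expa_cvg : expR (- (a * x)) @[x --> +oo] --> (0 : R).
Proof.
apply: (@cvg_comp _ _ _ (fun x => a * x) (fun y => expR (- y)) _ (pinfty_nbhs R)); last exact: cvgr_expR.
apply/cvgryPge => M; near=> x; rewrite mulrC -ler_pdivrMr//.
Unshelve. all: by end_near. Qed.

Lemma continuous_expa : continuous (fun s : R => expR (- (a * s))).
Proof. exact: derive_continuous is_derive_expa. Qed.

(** One-sided exponential: its transform is, up to a constant, 1/(x+ie), with frequencies s >= 0
    only ([inv_ieps_laplace]). *)
Definition hexp x : R := if 0 <= x then expR (- (a * x)) else 0.

Lemma hexp_ge0 x : 0 <= hexp x.
Proof. by rewrite /hexp; case: ifP => // _; exact: expR_ge0. Qed.

Lemma hexp_le1 x : hexp x <= 1.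
Proof.
by rewrite /hexp; case: ifP => // x0; rewrite expR_le1// oppr_le0 mulr_ge0// ltW.
Qed.

Lemma hexpE (g : R -> R) : \int[mu]_x (hexp x * g x) =
  \int[mu]_(x in `[0, +oo[) (expR (- (a * x)) * g x).
Proof.
rewrite [RHS]Rintegral_mkcond; apply: eq_Rintegral => x _.
rewrite patchE /hexp; case: ifPn => x0.
  by rewrite ifT// inE/= in_itv/= x0.
by rewrite mul0r ifF//; apply/negbTE; apply: contra x0; rewrite inE/= in_itv/= andbT.
Qed.

Lemma measurable_hexp : meas1 hexp.
Proof.
rewrite /meas1 (_ : hexp = (fun s => expR (- (a * s))) \_ `[0, +oo[); last first.
  apply/funext => x; rewrite patchE /hexp; case: ifPn => x0.
    by rewrite ifT// inE/= in_itv/= x0.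
  by rewrite ifF//; apply/negbTE; apply: contra x0; rewrite inE/= in_itv/= andbT.
apply/(measurable_restrictT _ _).1 => //.
apply: measurable_funTS; exact: (continuous_meas1 continuous_expa).
Qed.

Lemma continuous_within_half (f : R -> R) : continuous f -> {within `[0, +oo[, continuous f}.
Proof. exact: continuous_subspaceT. Qed.

Lemma int_expa : (\int[mu]_(x in `[0%R, +oo[) (expR (- (a * x)))%:E = (a^-1)%:E)%E.
Proof.
have d x : is_derive x (1 : R) (fun s : R => - a^-1 * expR (- (a * s))) (expR (- (a * x))).
  by apply: (is_derive_eq (@is_deriveM _ _ (cst (- a^-1)) _ x 1 _ _ (is_derive_cst _ _ _) (is_derive_expa x))); rewrite /GRing.scale/=; field; rewrite gt_eqF.
rewrite (@ge0_continuous_FTC2y _ _ (fun s : R => - a^-1 * expR (- (a * s))) 0 0).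
- by rewrite mulr0 oppr0 expR0 mulr1 -EFinB sub0r opprK.
- by move=> x _; exact: expR_ge0.
- exact/continuous_within_half/continuous_expa.
- rewrite -[X in _ --> X](mulr0 (- a^-1)); apply: cvgM; first exact: cvg_cst.
  exact: expa_cvg.
- by move=> x _; apply: ex_derive; exact: d.
- apply: cvg_at_right_filter; exact: (derive_continuous d).
- by move=> x _; rewrite derive1E; apply: derive_val; exact: d.
Qed.

Lemma rint_hexp : rint mu hexp.
Proof.
have h : (hexp : R -> R) =1 (fun s => expR (- (a * s))) \_ `[0, +oo[.
  move=> x; rewrite patchE /hexp; case: ifPn => x0.
    by rewrite ifT// inE/= in_itv/= x0.
  by rewrite ifF//; apply/negbTE; apply: contra x0; rewrite inE/= in_itv/= andbT.
apply/integrableP; split; first by apply/measurable_EFinP; exact: measurable_hexp.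
rewrite (_ : integral _ _ _ = (\int[mu]_(x in `[0%R, +oo[) (expR (- (a * x)))%:E)%E).
  by rewrite int_expa ltry.
rewrite [RHS]integral_mkcond; apply: eq_integral => x _.
by rewrite /= ger0_norm ?hexp_ge0// h !patchE; case: ifP.
Qed.

Lemma int_hexp_trig (g G : R -> R) (C : R) : continuous g -> (forall x, `|g x| <= 1) ->
  (forall x, is_derive x (1 : R) G (expR (- (a * x)) * g x)) ->
  (forall x, `|G x| <= C * expR (- (a * x))) ->
  \int[mu]_x (hexp x * g x) = - G 0.
Proof.
move=> cg g1 dG GC.
have ig : rint mu (fun x => hexp x * g x).
  apply: (rint_le _ _ rint_hexp).
    by apply: measurable_funM; [exact: measurable_hexp|exact: continuous_meas1].
  by move=> x; rewrite normrM (ger0_norm (hexp_ge0 x)) ler_piMr// hexp_ge0.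
(* The fundamental theorem on the half-line is applied to a nonnegative integrand: 1 + g is
   nonnegative because |g| <= 1, and the known integral 1/a of the exponential is subtracted at the
   end. *)
have : \int[mu]_x (hexp x * (1 + g x)) = a^-1 - G 0.
  have de x : is_derive x (1 : R) (fun s : R => - a^-1 * expR (- (a * s))) (expR (- (a * x))).
    by apply: (is_derive_eq (@is_deriveM _ _ (cst (- a^-1)) _ x 1 _ _ (is_derive_cst _ _ _) (is_derive_expa x))); rewrite /GRing.scale/=; field; rewrite gt_eqF.
  have d x : is_derive x (1 : R) (fun s => - a^-1 * expR (- (a * s)) + G s) (expR (- (a * x)) * (1 + g x)).
    by have := is_deriveD (de x) (dG x); rewrite mulrDr mulr1.
  rewrite hexpE (@Rintegral_ge0_continuous_FTC2y _ _ (fun s : R => - a^-1 * expR (- (a * s)) + G s) 0 0).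
  - by rewrite mulr0 oppr0 expR0; ring.
  - move=> x _; rewrite mulr_ge0 ?expR_ge0//.
    by have := g1 x; rewrite ler_norml => /andP[]; lra.
  - apply: continuous_within_half => x; apply: cvgM; first exact: continuous_expa.
    by apply: cvgD; [exact: cvg_cst|exact: cg].
  - rewrite -[X in _ --> X](addr0 0); apply: cvgD.
      rewrite -[X in _ --> X](mulr0 (- a^-1)); apply: cvgM; first exact: cvg_cst.
      exact: expa_cvg.
    apply/norm_cvg0P; apply: (@squeeze_cvgr _ _ _ _ (cst 0) (fun x => C * expR (- (a * x)))).
    + by apply: nearW => x; rewrite normr_ge0 GC.
    + exact: cvg_cst.
    + rewrite -[X in _ --> X](mulr0 C); apply: cvgM; first exact: cvg_cst.
      exact: expa_cvg.
  - by move=> x _; apply: ex_derive; exact: d.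
  - apply: cvg_at_right_filter; exact: (derive_continuous d).
  - by move=> x _; rewrite derive1E; apply: derive_val; exact: d.
under eq_Rintegral do rewrite mulrDr.
rewrite RintegralD//; last first.
  by apply: (rint_le _ _ rint_hexp) => [|x]; [under eq_fun do rewrite mulr1; exact: measurable_hexp|rewrite mulr1 ger0_norm// hexp_ge0].
rewrite hexpE; under eq_Rintegral do rewrite mulr1.
rewrite {1}/Rintegral int_expa/= => h; apply: (@addrI _ a^-1); exact: h.
Qed.

End Exponential.
End HalfLine.

(** * 1/(x+ie) as a Laplace transform *)

Section Kernel.
Variables (R : realType).
Notation mu := (@mu1 R).
Implicit Types (a b x A e : R).

Lemma is_derive_cosM b x : is_derive x (1 : R) (fun s : R => cos (b * s)) (- b * sin (b * x)).
Proof.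
have h : is_derive x (1 : R) (fun s : R => b * s) b.
  by apply: is_derive_eq; rewrite /GRing.scale/=; ring.
apply: (is_derive_eq (@is_derive1_comp _ (@cos R) (fun s : R => b * s) x _ _ (is_derive_cos _) h)); ring.
Qed.

Lemma is_derive_sinM b x : is_derive x (1 : R) (fun s : R => sin (b * s)) (b * cos (b * x)).
Proof.
have h : is_derive x (1 : R) (fun s : R => b * s) b.
  by apply: is_derive_eq; rewrite /GRing.scale/=; ring.
apply: (is_derive_eq (@is_derive1_comp _ (@sin R) (fun s : R => b * s) x _ _ (is_derive_sin _) h)); ring.
Qed.

Lemma continuous_cosM b : continuous (fun s : R => cos (b * s)).
Proof. exact: derive_continuous (is_derive_cosM b). Qed.

Lemma continuous_sinM b : continuous (fun s : R => sin (b * s)).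
Proof. exact: derive_continuous (is_derive_sinM b). Qed.

Lemma cos_abs_le1 x : `|cos x| <= 1.
Proof. by rewrite ler_norml cos_geN1 cos_le1. Qed.

Lemma sin_abs_le1 x : `|sin x| <= 1.
Proof. by rewrite ler_norml sin_geN1 sin_le1. Qed.

Lemma is_derive_trigcomb b (p q : R) x : is_derive x (1 : R) (fun s : R => p * cos (b * s) + q * sin (b * s))
  (- p * b * sin (b * x) + q * b * cos (b * x)).
Proof.
have h1 := @is_deriveM _ _ (cst p) _ x 1 _ _ (is_derive_cst _ _ _) (is_derive_cosM b x).
have h2 := @is_deriveM _ _ (cst q) _ x 1 _ _ (is_derive_cst _ _ _) (is_derive_sinM b x).
by apply: (is_derive_eq (is_deriveD h1 h2)); rewrite /GRing.scale/=; ring.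
Qed.

Lemma is_derive_exptrig a b (p q : R) x : is_derive x (1 : R)
  (fun s : R => expR (- (a * s)) * (p * cos (b * s) + q * sin (b * s)))
  (expR (- (a * x)) * ((q * b - a * p) * cos (b * x) - (p * b + a * q) * sin (b * x))).
Proof.
apply: (is_derive_eq (is_deriveM (is_derive_expa a x) (is_derive_trigcomb b p q x))).
by rewrite /GRing.scale/=; ring.
Qed.

Lemma trigcomb_bound b (p q : R) x : `|p * cos (b * x) + q * sin (b * x)| <= `|p| + `|q|.
Proof.
apply: (le_trans (ler_normD _ _)); rewrite !normrM; apply: lerD.
- by rewrite ler_piMr// cos_abs_le1.
- by rewrite ler_piMr// sin_abs_le1.
Qed.

Lemma int_hexp_cos a b : 0 < a ->
  \int[mu]_x (hexp a x * cos (b * x)) = a / (a ^+ 2 + b ^+ 2).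
Proof.
move=> a0; have n0 : a ^+ 2 + b ^+ 2 != 0 by rewrite addrC gt_eqF// sqD_gt0.
(* p and q solve q b - a p = 1 and p b + a q = 0, so that the derivative given by
   [is_derive_exptrig] is the integrand. *)
pose p := - a / (a ^+ 2 + b ^+ 2); pose q := b / (a ^+ 2 + b ^+ 2).
have d x : is_derive x (1 : R) (fun s => expR (- (a * s)) * (p * cos (b * s) + q * sin (b * s)))
    (expR (- (a * x)) * cos (b * x)).
  apply: (is_derive_eq (is_derive_exptrig a b p q x)); congr (_ * _).
  by rewrite /p /q; field.
rewrite (int_hexp_trig a0 (@continuous_cosM b) _ d (C := `|p| + `|q|)).
- by rewrite !mulr0 oppr0 expR0 cos0 sin0 /p; ring.
- by move=> x; exact: cos_abs_le1.
- move=> x; rewrite normrM mulrC (ger0_norm (expR_ge0 _)) ler_wpM2r ?expR_ge0//.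
  exact: trigcomb_bound.
Qed.

Lemma int_hexp_sin a b : 0 < a ->
  \int[mu]_x (hexp a x * sin (b * x)) = b / (a ^+ 2 + b ^+ 2).
Proof.
move=> a0; have n0 : a ^+ 2 + b ^+ 2 != 0 by rewrite addrC gt_eqF// sqD_gt0.
pose p := - b / (a ^+ 2 + b ^+ 2); pose q := - a / (a ^+ 2 + b ^+ 2).
have d x : is_derive x (1 : R) (fun s => expR (- (a * s)) * (p * cos (b * s) + q * sin (b * s)))
    (expR (- (a * x)) * sin (b * x)).
  apply: (is_derive_eq (is_derive_exptrig a b p q x)); congr (_ * _).
  by rewrite /p /q; field.
rewrite (int_hexp_trig a0 (@continuous_sinM b) _ d (C := `|p| + `|q|)).
- by rewrite !mulr0 oppr0 expR0 cos0 sin0 /p; ring.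
- by move=> x; exact: sin_abs_le1.
- move=> x; rewrite normrM mulrC (ger0_norm (expR_ge0 _)) ler_wpM2r ?expR_ge0//.
  exact: trigcomb_bound.
Qed.

Lemma cI_hexp a b : 0 < a ->
  cI mu (fun s => (hexp a s)%:C * cis (b * s)) =
  (a / (a ^+ 2 + b ^+ 2)) +i* (b / (a ^+ 2 + b ^+ 2)).
Proof.
move=> a0; apply: complexP.
- rewrite -[RHS]/(a / (a ^+ 2 + b ^+ 2)) -(int_hexp_cos b a0); apply: eq_Rintegral => x _.
  by rewrite ReM /cis/= mul0r subr0.
- rewrite -[RHS]/(b / (a ^+ 2 + b ^+ 2)) -(int_hexp_sin b a0); apply: eq_Rintegral => x _.
  by rewrite ImM /cis/= mul0r addr0.
Qed.

(** The half-line integral equals 1/(2 pi (e - i x)), that is i/(2 pi (x + i e)), whence the factor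
    - 2 i pi. *)
Lemma inv_ieps_laplace e x : 0 < e ->
  (x +i* e)^-1 = - 'i%C * (2 * pi)%:C *
    cI mu (fun s => (hexp (2 * pi * e) s)%:C * cis (2 * pi * x * s)).
Proof.
move=> e0; have pi0 : 0 < 2 * pi :> R by rewrite mulr_gt0// pi_gt0.
have n0 := sqD_gt0 x e0.
move: (2 * pi) pi0 => c c0; rewrite cI_hexp ?mulr_gt0//.
have cn : c != 0 by rewrite gt_eqF.
have n2 : x ^+ 2 + e ^+ 2 != 0 by rewrite gt_eqF.
have n3 : (c * e) ^+ 2 + (c * x) ^+ 2 != 0.
  by rewrite !exprMn -mulrDr addrC mulf_neq0// expf_neq0.
rewrite inv_iepsE; apply: complexP; rewrite ?ReM ?ImM ?ReN ?ImN ?ReM ?ImM /=.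
- by field; rewrite n3 n2.
- by field; rewrite n3 n2.
Qed.

End Kernel.

(** * Decay of Fourier transforms by integration by parts *)

Section Decay.
Variables (R : realType).
Notation mu := (@mu1 R).
Implicit Types (a b x A e w : R).

Definition ft (f : R -> R[i]) (xi : R) : R[i] :=
  cI mu (fun x => f x * cis (- (2 * pi * (x * xi)))).

Lemma rint_bounded (f : R -> R) A M : meas1 f -> (forall x, ~ (- A <= x <= A) -> f x = 0) ->
  (forall x, `|f x| <= M) -> rint mu f.
Proof.
move=> mf f0 fM; apply: (rint_le mf _ (rintZ M (rint_ind (- A) A))) => x.
rewrite indE; case: ifPn => [_|/negP/f0 ->]; first by rewrite mulr1.
by rewrite mulr0 normr0.
Qed.

Lemma le_int_bounded (f : R -> R) A M : 0 <= A -> meas1 f -> (forall x, ~ (- A <= x <= A) -> f x = 0) ->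
  (forall x, `|f x| <= M) -> `|\int[mu]_x f x| <= 2 * A * M.
Proof.
move=> A0 mf f0 fM; have fi := rint_bounded mf f0 fM.
apply: (le_trans (le_normr_Rintegral measurableT fi)).
apply: (@le_trans _ _ (\int[mu]_x (M * ind (- A) A x))).
  apply: le_Rintegral => //; first exact: integrable_norm.
    exact/rintZ/rint_ind.
  move=> x _; rewrite indE; case: ifPn => [_|/negP/f0 ->]; first by rewrite mulr1.
  by rewrite mulr0 normr0.
rewrite RintegralZl//; last exact: rint_ind.
by rewrite int_ind ?ge0_cp//; apply: eqW; ring.
Qed.

Lemma int_derive0 (G g : R -> R) A : 0 <= A -> (forall x : R, is_derive x (1 : R) G (g x)) -> continuous g ->
  (forall x, ~ (- A <= x <= A) -> G x = 0) -> (forall x, ~ (- A <= x <= A) -> g x = 0) ->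
  \int[mu]_x g x = 0.
Proof.
(* The endpoints are moved by 1 because G is known to vanish only strictly outside [-A, A]; this
   also keeps the interval nondegenerate when A = 0. *)
move=> A0 dG cg G0 g0; rewrite (@int_supp _ _ (- (A + 1)) (A + 1)).
  rewrite (ftc_itv _ dG cg); last by lra.
  by rewrite !G0 ?subrr//; move=> /andP[]; lra.
by move=> x xA; apply: g0 => /andP[h1 h2]; apply: xA; apply/andP; split; lra.
Qed.

(** A compactly supported function listed together with all its derivatives. Shifting the list is
    one integration by parts, and the notion applies to restrictions of plane functions to lines
    ([chain_line]). *)
Definition chain A (F : nat -> R -> R) :=
  (forall k (x : R), is_derive x (1 : R) (F k) (F k.+1 x)) /\
  (forall k x, ~ (- A <= x <= A) -> F k x = 0).

Lemma chain_continuous A F : chain A F -> forall k, continuous (F k).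
Proof. by move=> [dF _] k; exact: derive_continuous (dF k). Qed.
Arguments chain_continuous {A F} _ k.

(** Integration by parts gives w int F cos = - int F' sin and w int F sin = int F' cos. Each step
    exchanges sine and cosine, so the two bounds are proved together. *)
Lemma chain_decay N A M F w : 0 <= A -> chain A F ->
  (forall k x, (k <= N)%N -> `|F k x| <= M) ->
  `|w| ^+ N * `|\int[mu]_x (F 0%N x * cos (w * x))| <= 2 * A * M /\
  `|w| ^+ N * `|\int[mu]_x (F 0%N x * sin (w * x))| <= 2 * A * M.
Proof.
move=> A0; elim: N F => [|N IH] F cF FM.
  have cF0 := chain_continuous cF 0%N; have [dF F0] := cF.
  rewrite expr0 !mul1r; split; apply: le_int_bounded => //.
  - by apply: continuous_meas1 => x; apply: cvgM; [exact: cF0|exact: continuous_cosM].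
  - by move=> x xA; rewrite F0// mul0r.
  - by move=> x; rewrite normrM (le_trans _ (FM 0%N x _))// ler_piMr// cos_abs_le1.
  - by apply: continuous_meas1 => x; apply: cvgM; [exact: cF0|exact: continuous_sinM].
  - by move=> x xA; rewrite F0// mul0r.
  - by move=> x; rewrite normrM (le_trans _ (FM 0%N x _))// ler_piMr// sin_abs_le1.
have cF0 := chain_continuous cF 0%N; have cF1 := chain_continuous cF 1%N.
have [dF F0] := cF.
have [||IHc IHs] := IH (fun k => F k.+1).
- by split=> k; [exact: dF|exact: F0].
- by move=> k x kN; exact: FM.
have ri k (g : R -> R) : continuous g -> (forall x, `|g x| <= 1) -> (k <= N.+1)%N ->
    continuous (F k) -> rint mu (fun x => F k x * g x).
  move=> cg g1 kN cFk; apply: (@rint_bounded _ A M).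
  - by apply: continuous_meas1 => x; apply: cvgM; [exact: cFk|exact: cg].
  - by move=> x xA; rewrite F0// mul0r.
  - by move=> x; rewrite normrM (le_trans _ (FM k x _))// ler_piMr.
have r0c : rint mu (fun x => F 0%N x * cos (w * x)).
  by apply: ri => //; [exact: continuous_cosM|move=> x; exact: cos_abs_le1].
have r0s : rint mu (fun x => F 0%N x * sin (w * x)).
  by apply: ri => //; [exact: continuous_sinM|move=> x; exact: sin_abs_le1].
have r1c : rint mu (fun x => F 1%N x * cos (w * x)).
  by apply: ri => //; [exact: continuous_cosM|move=> x; exact: cos_abs_le1].
have r1s : rint mu (fun x => F 1%N x * sin (w * x)).
  by apply: ri => //; [exact: continuous_sinM|move=> x; exact: sin_abs_le1].
have ec : w * \int[mu]_x (F 0%N x * cos (w * x)) = - \int[mu]_x (F 1%N x * sin (w * x)).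
  apply/eqP; rewrite -subr_eq0 opprK -RintegralZl// -RintegralD//; last exact: rintZ.
  apply/eqP; apply: (@int_derive0 (fun x => F 0%N x * sin (w * x)) _ A) => //.
  - move=> x; apply: (is_derive_eq (is_deriveM (dF 0%N x) (is_derive_sinM w x))).
    by rewrite /GRing.scale/=; ring.
  - move=> x; apply: cvgD; last by apply: cvgM; [exact: cF1|exact: continuous_sinM].
    by apply: cvgM; [exact: cvg_cst|apply: cvgM; [exact: cF0|exact: continuous_cosM]].
  - by move=> x xA; rewrite F0// mul0r.
  - by move=> x xA; rewrite !F0// !mul0r mulr0 addr0.
have es : w * \int[mu]_x (F 0%N x * sin (w * x)) = \int[mu]_x (F 1%N x * cos (w * x)).
  apply/eqP; rewrite -subr_eq0 -RintegralZl// -RintegralB//; last exact: rintZ.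
  apply/eqP; apply: (@int_derive0 (fun x => - 1 * (F 0%N x * cos (w * x))) _ A) => //.
  - move=> x; apply: (is_derive_eq (@is_deriveM _ _ (cst (-1)) _ x 1 _ _ (is_derive_cst _ _ _) (is_deriveM (dF 0%N x) (is_derive_cosM w x)))).
    by rewrite /GRing.scale/=; ring.
  - move=> x; apply: cvgB; last by apply: cvgM; [exact: cF1|exact: continuous_cosM].
    by apply: cvgM; [exact: cvg_cst|apply: cvgM; [exact: cF0|exact: continuous_sinM]].
  - by move=> x xA; rewrite F0// mul0r mulr0.
  - by move=> x xA; rewrite !F0// !mul0r mulr0 subr0.
rewrite exprSr -!mulrA -!normrM ec es normrN; split.
- by rewrite mulrA.
- by rewrite mulrA.
Qed.

Lemma ft_reim (f : R -> R[i]) xi w : w = 2 * pi * xi -> rint mu (fun x => complex.Re (f x)) -> rint mu (fun x => complex.Im (f x)) ->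
  normc (ft f xi) <=
    (`|\int[mu]_x (complex.Re (f x) * cos (w * x))| + `|\int[mu]_x (complex.Re (f x) * sin (w * x))|) +
    (`|\int[mu]_x (complex.Im (f x) * cos (w * x))| + `|\int[mu]_x (complex.Im (f x) * sin (w * x))|).
Proof.
move=> wE r1 r2.
have ri (g h : R -> R) : continuous g -> (forall x, `|g x| <= 1) -> rint mu h ->
    rint mu (fun x => h x * g x).
  move=> cg g1 hi; have := integrable_norm hi => hi'.
  apply: (rint_le _ _ hi') => [|x].
    by apply: measurable_funM; [exact: rint_meas hi|exact: continuous_meas1].
  by rewrite normrM/= ler_piMr.
have cc := @continuous_cosM R w; have cs := @continuous_sinM R w.
have c1 x : `|cos (w * x)| <= 1 := cos_abs_le1 _.
have s1 x : `|sin (w * x)| <= 1 := sin_abs_le1 _.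
have eR : complex.Re (ft f xi) = \int[mu]_x (complex.Re (f x) * cos (w * x)) + \int[mu]_x (complex.Im (f x) * sin (w * x)).
  rewrite -RintegralD//; try exact: ri.
  apply: eq_Rintegral => x _; rewrite ReM /cis/= cosN sinN mulrN opprK.
  by rewrite wE [x * xi]mulrC !mulrA.
have eI : complex.Im (ft f xi) = \int[mu]_x (complex.Im (f x) * cos (w * x)) - \int[mu]_x (complex.Re (f x) * sin (w * x)).
  rewrite -RintegralB//; try exact: ri.
  apply: eq_Rintegral => x _; rewrite ImM /cis/= cosN sinN mulrN addrC.
  by rewrite wE [x * xi]mulrC !mulrA.
apply: (le_trans (normc_le_ReIm _)); rewrite eR eI.
have h1 := ler_normD (\int[mu]_x (complex.Re (f x) * cos (w * x))) (\int[mu]_x (complex.Im (f x) * sin (w * x))).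
have h2 := ler_normB (\int[mu]_x (complex.Im (f x) * cos (w * x))) (\int[mu]_x (complex.Re (f x) * sin (w * x))).
lra.
Qed.

(** 8 A M adds four real integrals of size at most 2 A M. The factor 2^N comes from 1 + |xi| <= 2
    max(1, |xi|), with the case |xi| <= 1 using order 0 and the other one order N. *)
Lemma ft_decay N A M (f : R -> R[i]) F G xi : 0 <= A -> chain A F -> chain A G ->
  (forall x, f x = F 0%N x +i* G 0%N x) ->
  (forall k x, (k <= N)%N -> `|F k x| <= M) -> (forall k x, (k <= N)%N -> `|G k x| <= M) ->
  (1 + `|xi|) ^+ N * normc (ft f xi) <= 2 ^+ N * (8 * A * M).
Proof.
move=> A0 cF cG fE FM GM.
have rb (H : nat -> R -> R) : chain A H -> (forall k x, (k <= N)%N -> `|H k x| <= M) ->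
   rint mu (H 0%N).
  move=> cH HM; apply: (@rint_bounded _ A M).
  - exact: continuous_meas1 (chain_continuous cH 0%N).
  - exact: cH.2.
  - by move=> x; exact: HM.
have reE : (fun x => complex.Re (f x)) = F 0%N by apply/funext => x; rewrite fE.
have imE : (fun x => complex.Im (f x)) = G 0%N by apply/funext => x; rewrite fE.
have [w wE] : exists w, w = 2 * pi * xi by exists (2 * pi * xi).
have := @ft_reim f xi w wE; rewrite reE imE => /(_ (rb _ cF FM) (rb _ cG GM)) /=.
under [X in `|X| + _ + _ ]eq_Rintegral do rewrite fE/=.
under [X in _ + `|X| + _ ]eq_Rintegral do rewrite fE/=.
under [X in _ + (`|X| + _) ]eq_Rintegral do rewrite fE/=.
under [X in _ + (_ + `|X|) ]eq_Rintegral do rewrite fE/=.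
move=> h.
have bnd n : (n <= N)%N -> `|w| ^+ n * normc (ft f xi) <= 8 * A * M.
  move=> nN.
  have [|a1 a2] := @chain_decay n A M F w A0 cF.
    by move=> k x kn; apply: FM; exact: leq_trans nN.
  have [|b1 b2] := @chain_decay n A M G w A0 cG.
    by move=> k x kn; apply: GM; exact: leq_trans nN.
  apply: (@le_trans _ _ _ _ _ (ler_wpM2l _ h)); first exact: exprn_ge0.
  rewrite !mulrDr; lra.
have x2 : `|xi| <= `|w|.
  rewrite wE normrM ler_peMl// ger0_norm ?mulr_ge0 ?pi_ge0//.
  have := pi_ge2 R; lra.
have n0 := normc_ge0 (ft f xi).
have [x1|x1] := leP `|xi| 1.
  apply: (@le_trans _ _ (2 ^+ N * normc (ft f xi))).
    rewrite ler_wpM2r// lerXn2r ?nnegrE ?addr_ge0//; lra.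
  rewrite ler_wpM2l// ?exprn_ge0//.
  by have := bnd 0%N; rewrite expr0 mul1r; exact.
apply: (@le_trans _ _ ((2 * `|xi|) ^+ N * normc (ft f xi))).
  rewrite ler_wpM2r// lerXn2r ?nnegrE ?addr_ge0 ?mulr_ge0//; lra.
rewrite exprMn -[leLHS]mulrA ler_wpM2l ?exprn_ge0//.
apply: le_trans (bnd N (leqnn _)).
by rewrite ler_wpM2r// lerXn2r ?nnegrE.
Qed.

End Decay.

Section MeasCis.
Context d (T : measurableType d) (R : realType).

Lemma cmeas_cis (g : T -> R) : measurable_fun setT g -> cmeas (fun x => cis (g x)).
Proof.
move=> mg; split => /=.
- apply: (@measurableT_comp _ _ _ _ _ _ (@cos R)) mg.
  by apply: continuous_measurable_fun; exact: continuous_cos.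
- apply: (@measurableT_comp _ _ _ _ _ _ (@sin R)) mg.
  by apply: continuous_measurable_fun; exact: continuous_sin.
Qed.

End MeasCis.

(** * Fourier inversion on the line *)

Section Inversion.
Variables (R : realType).
Notation mu := (@mu1 R).
Implicit Types (a b x A e w : R).

Lemma meas2_phase (c : R) : meas2 (fun p : RL R * RL R => c * (p.1 * p.2)).
Proof.
apply: measurable_funM; first exact: measurable_cst.
by apply: measurable_funM; [exact: measurable_fst|exact: measurable_snd].
Qed.

Lemma meas1_phase (c y : R) : meas1 (fun x => c * (x * y)).
Proof.
apply: measurable_funM; first exact: measurable_cst.
by apply: measurable_funM; [exact: measurable_id|exact: measurable_cst].
Qed.

Lemma meas1_phaseN (c y : R) : meas1 (fun x => - (c * (x * y))).
Proof.
have -> : (fun x => - (c * (x * y))) = (fun x => - c * (x * y)).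
  by apply/funext => x; rewrite mulNr.
exact: meas1_phase.
Qed.

Lemma meas1_phaseC (c y : R) : meas1 (fun x => c * (y * x)).
Proof.
have -> : (fun x => c * (y * x)) = (fun x => c * (x * y)).
  by apply/funext => x; rewrite [y * x]mulrC.
exact: meas1_phase.
Qed.

(** Measurability in xi comes from Fubini, which asks for integrability in xi as well: the weight
    [w1 xi] provides it and is divided out afterwards. *)
Lemma cmeas_ft (v : R -> R[i]) (a : R -> R) : cmeas (v : RL R -> _) ->
  (forall x, normc (v x) <= a x) -> rint mu a -> cmeas (ft v : RL R -> _).
Proof.
move=> mv va ia.
have e : (ft v : RL R -> _) = (fun xi => ((w1 xi)^-1)%:C *
    cI mu (fun x => v x * cis (- (2 * pi) * (x * xi)) * (w1 xi)%:C)).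
  apply/funext => xi.
  have m1 : cmeas (fun x : RL R => v x * cis (- (2 * pi) * (x * xi))).
    by apply: cmeasM => //; apply: cmeas_cis; exact: meas1_phase.
  rewrite (@eq_cI _ _ _ mu _ (fun x => (w1 xi)%:C * (v x * cis (- (2 * pi) * (x * xi))))); last first.
    by move=> x; rewrite mulrC.
  rewrite cI_Z; last first.
    by apply: (cint_dom m1 _ ia) => x; rewrite normcM normc_cis mulr1.
  rewrite mulrA -rmorphM mulVf ?gt_eqF ?w1_gt0// rmorph1 mul1r.
  by apply: eq_cI => x; rewrite mulNr.
rewrite e; apply: cmeasM.
  apply: cmeas_real; apply: continuous_meas1 => x; apply: cvgV; last exact: continuous_w1.
  by rewrite gt_eqF// w1_gt0.
apply: (@cmeas_section2 _ _ _ _ _ mu mu a (@w1 R) ia (@rint_w1 R)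
  (fun p => v p.1 * cis (- (2 * pi) * (p.1 * p.2)) * (w1 p.2)%:C)).
- apply: cmeasM.
    apply: cmeasM; last by apply: cmeas_cis; exact: meas2_phase.
    by split; [apply: measurableT_comp mv.1 _|apply: measurableT_comp mv.2 _].
  by apply: cmeas_real; apply: meas2_snd; apply: continuous_meas1; exact: continuous_w1.
- move=> x y; rewrite !normcM normc_cis mulr1 normc_real gtr0_norm ?w1_gt0//.
  by rewrite ler_wpM2r// ltW// w1_gt0.
Qed.

Lemma int_halves (f : R -> R) : rint mu f -> rint mu (fun x => f (- x)) ->
  \int[mu]_x f x = \int[mu]_(x in `[0, +oo[) (f x + f (- x)).
Proof.
move=> fi fNi.
have m0 : measurable (`[0, +oo[%classic : set (RL R)) by exact: measurable_itv.
have ig : rint mu (f \_ `]-oo, 0]).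
  rewrite /rint -restrict_EFin.
  by apply/(integrable_mkcond _ _).1 => //; apply: integrableS fi.
have iNg : rint mu (fun x => (f \_ `]-oo, 0]) (- x)).
  rewrite (_ : (fun x => _) = (fun x => f (- x)) \_ `[0, +oo[); last first.
    by apply/funext => x; rewrite !patchE !mem_setE !in_itv/= andbT oppr_le0.
  rewrite /rint -restrict_EFin.
  by apply/(integrable_mkcond _ _).1 => //; apply: integrableS fNi.
rewrite RintegralD//; last 2 first.
- by apply: integrableS fi.
- by apply: integrableS fNi.
have -> : \int[mu]_(x in `[0, +oo[) f (- x) = \int[mu]_(x in `]-oo, 0]) f x.
  rewrite [LHS]Rintegral_mkcond [RHS]Rintegral_mkcond -(int_refl ig iNg).
  by apply: eq_Rintegral => x _; rewrite !patchE !mem_setE !in_itv/= andbT oppr_le0.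
rewrite addrC -(@Rintegral_itv_bndo_bndc R -oo%O 0 f); last by apply: integrableS fi.
rewrite -Rintegral_setU//.
- by rewrite -itv_bndbnd_setU// set_itvE.
- by rewrite -itv_bndbnd_setU// set_itvE.
- apply/disj_setPS => y [/=]; rewrite !in_itv/= andbT => h1 h2.
  by move: h1; rewrite ltNge h2.
Qed.

Lemma expc_ge0 a x : 0 <= expc a x.
Proof. exact: expR_ge0. Qed.

Lemma expcN a x : expc a (- x) = expc a x.
Proof. by rewrite /expc normrN. Qed.

Lemma rint_expc a : 0 < a -> rint mu (expc a).
Proof.
move=> a0; apply/integrableP; split.
  by apply/measurable_EFinP; apply: continuous_meas1; exact: continuous_expc.
under eq_integral do rewrite /= (ger0_norm (expR_ge0 _)).
rewrite ge0_symfun_integralT//.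
- rewrite (_ : [set x | _] = `[0, +oo[%classic); last by rewrite set_itvcy.
  rewrite (_ : integral _ _ _ = (\int[mu]_(x in `[0%R, +oo[) (expR (- (a * x)))%:E)%E).
    by rewrite int_expa// -EFinM ltry.
  apply: eq_integral => x; rewrite inE/= in_itv/= andbT => x0.
  by rewrite /expc ger0_norm.
- exact: continuous_expc.
- by move=> x; rewrite /= normrN.
Qed.

(** The sine part is odd and the cosine part is twice its half-line integral. As a function of b the
    result is a Poisson kernel of width a. *)
Lemma cI_expc a b : 0 < a ->
  cI mu (fun s => (expc a s)%:C * cis (b * s)) = (2 * a / (a ^+ 2 + b ^+ 2))%:C.
Proof.
move=> a0.
have ri (g : R -> R) : continuous g -> (forall x, `|g x| <= 1) -> rint mu (fun x => expc a x * g x).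
  move=> cg g1; apply: (rint_le _ _ (rint_expc a0)) => [|x].
    by apply: continuous_meas1 => x; apply: cvgM; [exact: continuous_expc|exact: cg].
  by rewrite normrM (ger0_norm (expR_ge0 _)) ler_piMr// expR_ge0.
have rc : rint mu (fun x => expc a x * cos (b * x)).
  by apply: ri => [|x]; [exact: continuous_cosM|exact: cos_abs_le1].
have rs : rint mu (fun x => expc a x * sin (b * x)).
  by apply: ri => [|x]; [exact: continuous_sinM|exact: sin_abs_le1].
have rNc : rint mu (fun x => expc a (- x) * cos (b * - x)).
  by apply: eq_integrable rc => // x _ /=; rewrite expcN mulrN cosN.
have rNs : rint mu (fun x => expc a (- x) * sin (b * - x)).
  apply: (rint_le _ _ (integrable_norm rs)) => [|x].
    under eq_fun do rewrite expcN mulrN sinN mulrN.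
    exact: measurableT_comp (rint_meas rs).
  by rewrite /= expcN mulrN sinN mulrN normrN.
apply: complexP.
- transitivity (\int[mu]_x (expc a x * cos (b * x))).
    by apply: eq_Rintegral => x _; rewrite ReM /cis/= mul0r subr0.
  rewrite (int_halves rc rNc).
  have rh : rint mu (fun x => hexp a x * cos (b * x)).
    apply: (rint_le _ _ (rint_hexp a0)) => [|x].
      by apply: measurable_funM; [exact: measurable_hexp|apply: continuous_meas1; exact: continuous_cosM].
    by rewrite normrM (ger0_norm (hexp_ge0 _ _)) ler_piMr ?cos_abs_le1// hexp_ge0.
  transitivity (\int[mu]_x (2 * (hexp a x * cos (b * x)))).
    under [RHS]eq_Rintegral do rewrite mulrCA.
    rewrite hexpE; apply: eq_Rintegral => x; rewrite inE/= in_itv/= andbT => x0.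
    by rewrite expcN mulrN cosN /expc ger0_norm//; ring.
  rewrite RintegralZl//.
  by rewrite int_hexp_cos//= mulrA.
- transitivity (\int[mu]_x (expc a x * sin (b * x))).
    by apply: eq_Rintegral => x _; rewrite ImM /cis/= mul0r addr0.
  rewrite (int_halves rs rNs) /Rintegral integral0_eq// => x _.
  by rewrite expcN mulrN sinN mulrN subrr.
Qed.

Lemma is_derive_atan_shift e (c x : R) : 0 < e ->
  is_derive x (1 : R) (fun y : R => atan ((y - c) / e)) (e / ((x - c) ^+ 2 + e ^+ 2)).
Proof.
move=> e0; have h : is_derive x (1 : R) (fun y : R => y - c) 1.
  by apply: is_derive_eq; rewrite subr0.
by apply: (is_derive_eq (@is_derive1_comp _ (fun y => atan (y / e)) (fun y => y - c) x _ _
  (is_derive_atanV (x - c) e0) h)); rewrite mulr1.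
Qed.

Lemma continuous_poisson e c : 0 < e -> continuous (fun y : R => e / ((y - c) ^+ 2 + e ^+ 2)).
Proof.
move=> e0 y.
have cB : (fun z : R => z - c) z @[z --> y] --> y - c by apply: cvgB; [exact: cvg_id|exact: cvg_cst].
apply: (@cvg_comp _ _ _ (fun z => z - c) (fun z => e / (z ^+ 2 + e ^+ 2)) _ _ _ cB).
by apply: (@continuous_divsq R (cst e)) => // z; exact: cvg_cst.
Qed.

Lemma int_poisson e c A : 0 < e -> 0 < A ->
  \int[mu]_y (ind (c - A) (c + A) y * (e / ((y - c) ^+ 2 + e ^+ 2))) = 2 * atan (A / e).
Proof.
move=> e0 A0; rewrite int_indM (ftc_itv _ (fun x => is_derive_atan_shift c x e0)).
- rewrite [c + A]addrC addrK addrAC subrr sub0r mulNr atanN; ring.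
- lra.
- exact: continuous_poisson.
Qed.

Lemma poisson_le e c y : 0 < e -> 0 <= e / ((y - c) ^+ 2 + e ^+ 2) <= e^-1.
Proof.
move=> e0; have n0 := sqD_gt0 (y - c) e0.
rewrite divr_ge0 ?(ltW e0) ?(ltW n0)//= ler_pdivrMr//.
rewrite (_ : e^-1 * _ = e^-1 * (y - c) ^+ 2 + e); last by field; rewrite gt_eqF.
by rewrite lerDr mulr_ge0 ?sqr_ge0// invr_ge0 ltW.
Qed.

(** Same splitting as for 1/(x+ie), now around x: the constant v(x) meets the exact mass 2
    atan(A'/e), and the difference is dominated by L because e |y - x| <= (y - x)^2 + e^2. *)
Lemma poisson_cvg (v : R -> R[i]) A L B x (u : nat -> R) : 0 < A -> 0 <= L -> cmeas (v : RL R -> _) ->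
  (forall y, ~ (- A <= y <= A) -> v y = 0) -> (forall y, normc (v y - v x) <= L * `|y - x|) ->
  (forall y, normc (v y) <= B) -> (forall n, 0 < u n) -> u n @[n --> \oo] --> (0 : R) ->
  ccvg (fun n => cI mu (fun y => (u n / ((y - x) ^+ 2 + u n ^+ 2))%:C * v y)) (pi%:C * v x).
Proof.
move=> A0 L0 mv vA vL vB u0 uc.
(* The window centred at x must contain the support [-A, A]. *)
pose A' := A + `|x|; have A'0 : 0 < A' by rewrite ltr_wpDr.
pose J := ind (x - A') (x + A').
have mP n : cmeas (fun y : RL R => (u n / ((y - x) ^+ 2 + u n ^+ 2))%:C).
  by apply: cmeas_real; apply: continuous_meas1; exact: continuous_poisson.
have iJ : rint mu J := rint_ind _ _.
have e n : cI mu (fun y => (u n / ((y - x) ^+ 2 + u n ^+ 2))%:C * v y) =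
   (2 * atan (A' / u n))%:C * v x +
   cI mu (fun y => (J y)%:C * ((u n / ((y - x) ^+ 2 + u n ^+ 2))%:C * (v y - v x))).
  rewrite (@eq_cI _ _ _ mu _ (fun y => v x * (J y * (u n / ((y - x) ^+ 2 + u n ^+ 2)))%:C +
     (J y)%:C * ((u n / ((y - x) ^+ 2 + u n ^+ 2))%:C * (v y - v x)))); last first.
    move=> y; rewrite /J indE; case: ifPn => [_|/negP yA].
      by rewrite mul1r rmorph1 mul1r; ring.
    rewrite mul0r rmorph0 mul0r mulr0 addr0 vA ?mulr0// => yA'; apply: yA.
    move: yA' => /andP[h1 h2]; have := ler_norm x; have := ler_norm (- x).
    by rewrite normrN /A' => h3 h4; apply/andP; split; lra.
  rewrite cI_lin.
  - rewrite mulrC; congr (_ * _ + _); apply: complexP => /=.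
      exact: int_poisson.
    by rewrite /Rintegral integral0.
  - apply: (@cint_dom _ _ _ mu _ (fun y => (u n)^-1 * J y)).
    + apply: cmeas_real; apply: measurable_funM; first exact: rint_meas iJ.
      by apply: continuous_meas1; exact: continuous_poisson.
    + move=> y; have /andP[p0 p1] := poisson_le x y (u0 n).
      rewrite normc_real ger0_norm; last by rewrite mulr_ge0// ind_ge0.
      by rewrite mulrC ler_wpM2r// ind_ge0.
    + exact: rintZ.
  - apply: (@cint_dom _ _ _ mu _ (fun y => (u n)^-1 * (B + B) * J y)).
    + apply: cmeasM; first exact: cmeas_ind.
      by apply: cmeasM => //; apply: cmeasD => //; exact: cmeas_cst.
    + move=> y; have /andP[p0 p1] := poisson_le x y (u0 n).
      rewrite normc_ind mulrC ler_wpM2r ?ind_ge0// normcM normc_real ger0_norm//.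
      apply: ler_pM => //; first exact: normc_ge0.
      by apply: (le_trans (normcB_le _ _)); rewrite lerD.
    + exact: rintZ.
under [X in ccvg X _]eq_fun do rewrite e.
have -> : pi%:C * v x = pi%:C * v x + 0 by rewrite addr0.
apply: ccvgD.
  apply: ccvgM; last exact: ccvg_cst.
  apply: ccvg_real; have := cvgM (cvg_cst (2 : R)) (cvg_atan_div A'0 u0 uc).
  by rewrite mulrCA divff// mulr1; exact.
rewrite -(@cI0 _ _ _ mu); apply: (@cI_dct _ _ _ mu _ _ (fun y => L * J y)).
- move=> n; apply: cmeasM; first exact: cmeas_ind.
  by apply: cmeasM => //; apply: cmeasD => //; exact: cmeas_cst.
- move=> y; have [->|yx] := eqVneq y x.
    by rewrite [v x - v x]subrr; under [X in ccvg X _]eq_fun do rewrite !mulr0; exact: ccvg_cst.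
  have yx2 : (y - x) ^+ 2 + 0 ^+ 2 != 0 by rewrite expr0n/= addr0 expf_neq0// subr_eq0.
  have h : u n / ((y - x) ^+ 2 + u n ^+ 2) @[n --> \oo] --> (0 : R).
    rewrite -[X in _ --> X](mul0r ((y - x) ^+ 2 + 0 ^+ 2)^-1); apply: cvgM => //; apply: cvgV => //.
    by apply: cvgD; [exact: cvg_cst|rewrite !expr2; under eq_fun do rewrite expr2; exact: cvgM].
  have := ccvgM (ccvg_cst (J y)%:C) (ccvgM (ccvg_real h) (ccvg_cst (v y - v x))).
  by rewrite mul0r mulr0.
- move=> n y; rewrite normc_ind mulrC ler_wpM2r ?ind_ge0// normcM normc_real.
  have /andP[p0 p1] := poisson_le x y (u0 n); rewrite ger0_norm//.
  apply: (le_trans (ler_wpM2l p0 (vL y))).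
  rewrite mulrCA ler_piMr//.
  have n0 := sqD_gt0 (y - x) (u0 n); rewrite mulrAC ler_pdivrMr// mul1r.
  rewrite -(real_normK (num_real (y - x))).
  have := sqr_ge0 (u n - `|y - x|); have := sqr_ge0 (`|y - x|); have := sqr_ge0 (u n).
  have := mulr_ge0 (ltW (u0 n)) (normr_ge0 (y - x)); rewrite sqrrB; lra.
- exact: rintZ.
Qed.

Lemma poisson_kernelE e x y : 0 < e ->
  2 * (2 * pi * e) / ((2 * pi * e) ^+ 2 + (2 * pi * (x - y)) ^+ 2) =
  pi^-1 * (e / ((y - x) ^+ 2 + e ^+ 2)).
Proof.
move=> e0; have n0 := sqD_gt0 (y - x) e0; have := pi_gt0 R.
move: (pi : R) => q q0; have qn := lt0r_neq0 q0.
have n3 : (2 * q * e) ^+ 2 + (2 * q * (x - y)) ^+ 2 != 0.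
  rewrite (_ : _ + _ = (2 * q) ^+ 2 * ((y - x) ^+ 2 + e ^+ 2)); last by ring.
  by rewrite mulf_neq0 ?(gt_eqF n0)// expf_neq0// mulf_neq0.
by field; rewrite (gt_eqF n0) n3 qn.
Qed.

(** Insert the factor exp(-a |xi|). As a tends to 0 the integral tends to the inversion integral,
    while Fubini turns it into the Poisson integral of v, which tends to v(x); the limits agree by
    uniqueness. *)
Lemma ft_inversion (v : R -> R[i]) A L B C x : 0 < A -> 0 <= L -> cmeas (v : RL R -> _) ->
  (forall y, ~ (- A <= y <= A) -> v y = 0) -> (forall y, normc (v y - v x) <= L * `|y - x|) ->
  (forall y, normc (v y) <= B) -> (forall xi, normc (ft v xi) <= C * w1 xi) ->
  cI mu (fun xi => ft v xi * cis (2 * pi * (x * xi))) = v x.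
Proof.
move=> A0 L0 mv vA vL vB vC.
have vdom y : normc (v y) <= B * ind (- A) A y.
  rewrite indE; case: ifPn => [_|/negP /vA ->]; first by rewrite mulr1.
  by rewrite normc0 mulr0.
have iB : rint mu (fun y => B * ind (- A) A y) by exact/rintZ/rint_ind.
have mft : cmeas (ft v : RL R -> _) := cmeas_ft mv vdom iB.
have pi0 : 0 < 2 * pi :> R by rewrite mulr_gt0// pi_gt0.
pose a n : R := 2 * pi * epsn R n; have a0 n : 0 < a n by rewrite mulr_gt0// epsn_gt0.
pose I n := cI mu (fun xi => (expc (a n) xi)%:C * (ft v xi * cis (2 * pi * (x * xi)))).
have c1 : ccvg I (cI mu (fun xi => ft v xi * cis (2 * pi * (x * xi)))).
  apply: (@cI_dct _ _ _ mu _ _ (fun xi => C * w1 xi)).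
  - move=> n; apply: cmeasM; first by apply: cmeas_real; apply: continuous_meas1; exact: continuous_expc.
    apply: cmeasM => //; apply: cmeas_cis.
    exact: meas1_phaseC.
  - move=> xi; have h : expc (a n) xi @[n --> \oo] --> (1 : R).
      rewrite -(expR0 R); apply: (@cvg_comp _ _ _ (fun n => - (a n * `|xi|)) (@expR R)); last exact: continuous_expR.
      rewrite -oppr0; apply: cvgN; rewrite -(mul0r `|xi|); apply: cvgM; last exact: cvg_cst.
      by rewrite -(mulr0 (2 * pi)); apply: cvgM; [exact: cvg_cst|exact: epsn_cvg].
    by have := ccvgM (ccvg_real h) (ccvg_cst (ft v xi * cis (2 * pi * (x * xi)))); rewrite mul1r.
  - move=> n xi; rewrite normcM normc_real ger0_norm ?expR_ge0// normcM normc_cis mulr1.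
    apply: le_trans (vC xi); rewrite ler_piMl ?normc_ge0//.
    by rewrite expR_le1 oppr_le0 mulr_ge0// ltW.
  - exact/rintZ/rint_w1.
have e n : I n = (pi^-1)%:C * cI mu (fun y => (epsn R n / ((y - x) ^+ 2 + epsn R n ^+ 2))%:C * v y).
  pose F (p : RL R * RL R) := v p.1 * cis (- (2 * pi) * (p.1 * p.2)) * ((expc (a n) p.2)%:C * cis (2 * pi * (x * p.2))).
  have sw := @cI_swap _ _ _ _ _ mu mu _ _ iB (rint_expc (a0 n)) F.
  transitivity (cI mu (fun xi => cI mu (fun y => F (y, xi)))).
    apply: eq_cI => xi; rewrite /F/=.
    rewrite (@eq_cI _ _ _ mu (fun y => _) (fun y => ((expc (a n) xi)%:C * cis (2 * pi * (x * xi))) * (v y * cis (- (2 * pi * (y * xi)))))); last first.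
      by move=> y; rewrite mulrC mulNr.
    rewrite cI_Z; first by rewrite /ft mulrA mulrAC.
    apply: (cint_dom _ _ iB) => [|y]; last by rewrite normcM normc_cis mulr1.
    apply: cmeasM; first exact: mv.
    by apply: cmeas_cis; exact: meas1_phaseN.
  rewrite -sw.
  - rewrite -cI_Z; last first.
      apply: (@cint_dom _ _ _ mu _ (fun y => (epsn R n)^-1 * (B * ind (- A) A y))).
      + apply: cmeasM; last exact: mv.
        by apply: cmeas_real; apply: continuous_meas1; apply: continuous_poisson; exact: epsn_gt0.
      + move=> y; have /andP[p0 p1] := poisson_le x y (epsn_gt0 R n).
        rewrite normcM normc_real (ger0_norm p0).
        exact: (ler_pM p0 (normc_ge0 _) p1 (vdom y)).
      + exact: (rintZ _ iB).
    apply: eq_cI => y; rewrite /F/=.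
    rewrite (@eq_cI _ _ _ mu (fun y => _) (fun s => v y * ((expc (a n) s)%:C * cis ((2 * pi * (x - y)) * s)))); last first.
      move=> s; rewrite -mulrA; congr (_ * _); rewrite mulrCA -cisD; congr (_ * cis _); ring.
    rewrite cI_Z.
      rewrite (cI_expc _ (a0 n)) mulrC mulrA -rmorphM; congr (_%:C * _).
      exact: poisson_kernelE (epsn_gt0 R n).
    apply: (@cint_dom _ _ _ mu _ (expc (a n))); last exact: rint_expc.
      apply: cmeasM; first by apply: cmeas_real; apply: continuous_meas1; exact: continuous_expc.
      apply: cmeas_cis; apply: measurable_funM; first exact: measurable_cst.
      exact: measurable_id.
    by move=> s; rewrite normcM normc_cis mulr1 normc_real (ger0_norm (expc_ge0 _ _)).
  - apply: cmeasM.
      apply: cmeasM; last by apply: cmeas_cis; exact: meas2_phase.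
      by split; [apply: measurableT_comp mv.1 _|apply: measurableT_comp mv.2 _].
    apply: cmeasM.
      by apply: cmeas_real; apply: meas2_snd; apply: continuous_meas1; exact: continuous_expc.
    apply: cmeas_cis; apply: (@meas2_snd R (fun s => 2 * pi * (x * s))).
    exact: meas1_phaseC.
  - move=> y s; rewrite /F/= !normcM !normc_cis !mulr1 normc_real (ger0_norm (expc_ge0 _ _)).
    exact: (ler_wpM2r (expc_ge0 _ _) (vdom y)).
have c2 : ccvg I (v x).
  have h := poisson_cvg A0 L0 mv vA vL vB (epsn_gt0 R) (@epsn_cvg R).
  have := ccvgM (ccvg_cst (pi^-1)%:C) h.
  rewrite mulrA -rmorphM (mulVf (lt0r_neq0 (pi_gt0 R))) rmorph1 mul1r.
  by under [X in ccvg X _]eq_fun do rewrite -e.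
exact: ccvg_unique c1 c2.
Qed.

End Inversion.

Section TestChains.
Variables (R : realType) (V : normedModType R).
Implicit Types (f : V -> R[i]) (v p : V).

Lemma test_fun_supp_bounded Omega f : test_fun Omega f ->
  exists A : R, 0 < A /\ forall p, supp f p -> `|p| <= A.
Proof.
move=> [_ /compact_bounded[M [Mr MA]] _].
exists (`|M| + 1); split; first by rewrite ltr_wpDl.
by move=> p sp; apply: MA => //; rewrite (le_lt_trans (ler_norm _))// ltrDl.
Qed.

Lemma test_fun_cderives Omega f vs : test_fun Omega f -> test_fun Omega (cderives vs f).
Proof. by move=> tf; elim: vs => [//|v vs IH]; exact: test_fun_cderive. Qed.

Lemma supp_cderives f vs : supp (cderives vs f) `<=` supp f.
Proof.
elim: vs => [//|v vs IH]; apply: subset_trans IH; exact: supp_cderive.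
Qed.

Lemma bounded_cderives Omega f N v : test_fun Omega f -> exists M : R, 0 <= M /\
  forall k p, (k <= N)%N -> normc (cderives (nseq k v) f p) <= M.
Proof.
move=> tf; elim: N => [|N [M [M0 IH]]].
  have [M [M0 h]] := test_fun_bounded tf; exists M; split => // k p.
  by rewrite leqn0 => /eqP ->; exact: h.
have [M' [M'0 h]] := test_fun_bounded (test_fun_cderives (nseq N.+1 v) tf).
exists (M + M'); split; first exact: addr_ge0.
move=> k p; rewrite leq_eqVlt => /predU1P[->|]; first by apply: (le_trans (h p)); rewrite lerDr.
by rewrite ltnS => /IH kM; apply: (le_trans (kM p)); rewrite lerDl.
Qed.

Lemma chain_line Omega f v p A : test_fun Omega f ->
  (forall s : R, ~ (- A <= s <= A) -> ~ supp f (p + s *: v)) ->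
  chain A (fun k s => Ref (cderives (nseq k v) f) (p + s *: v)) /\
  chain A (fun k s => Imf (cderives (nseq k v) f) (p + s *: v)).
Proof.
move=> tf sA; have sk k : smooth (cderives (nseq k v) f).
  by have [] := test_fun_cderives (nseq k v) tf.
have z k s : ~ (- A <= s <= A) -> cderives (nseq k v) f (p + s *: v) = 0.
  by move=> /sA h; apply: not_supp => h'; apply: h; exact: supp_cderives h'.
split; split.
- move=> k x; apply: derive_line; have [] := smooth_derivable (sk k) (p + x *: v) v; by [].
- by move=> k s /(z k); rewrite /Ref => ->.
- move=> k x; apply: derive_line; have [] := smooth_derivable (sk k) (p + x *: v) v; by [].
- by move=> k s /(z k); rewrite /Imf => ->.
Qed.

(** C does not depend on the base point p: the bound is uniform over all parallel lines, as needed
    when one variable is frozen in [FT_xdecay]. *)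
Lemma ft_line_rapid Omega f v N A : 0 <= A -> test_fun Omega f -> exists C : R, 0 <= C /\ forall p xi,
  (forall s : R, ~ (- A <= s <= A) -> ~ supp f (p + s *: v)) ->
  (1 + `|xi|) ^+ N * normc (ft (fun s => f (p + s *: v)) xi) <= C.
Proof.
move=> A0 tf; have [M [M0 hM]] := bounded_cderives N v tf.
exists (2 ^+ N * (8 * A * M)); split; first by rewrite mulr_ge0 ?exprn_ge0// !mulr_ge0.
move=> p xi sA; have [c1 c2] := chain_line tf sA.
apply: (@ft_decay _ N A M _ _ _ xi A0 c1 c2).
- by move=> x; apply: complexP.
- by move=> k x kN; apply: le_trans (hM k _ kN); exact: Re_le_normc.
- by move=> k x kN; apply: le_trans (hM k _ kN); exact: Im_le_normc.
Qed.

End TestChains.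

(** * The spectrum of a localised 1/(x+ie) *)

Section TestLine.
Variable R : realType.
Notation mu := (@mu1 R).
Implicit Types f : R -> R[i].

Lemma supp_itv Omega f A : test_fun Omega f -> (forall x, supp f x -> `|x| <= A) ->
  forall x, ~ (- A <= x <= A) -> f x = 0.
Proof.
by move=> tf fA x xA; apply: not_supp => /fA; rewrite ler_norml.
Qed.

Lemma test_fun_cmeas Omega f : test_fun Omega f -> cmeas (f : RL R -> _).
Proof.
by move=> [/smooth_continuous[c1 c2] _ _]; split; exact: continuous_meas1.
Qed.

Lemma ft_rapid Omega f N : test_fun Omega f -> exists C : R, 0 <= C /\ forall xi,
  (1 + `|xi|) ^+ N * normc (ft f xi) <= C.
Proof.
move=> tf; have [A [A0 fA]] := test_fun_supp_bounded tf.
have [C [C0 h]] := @ft_line_rapid _ R Omega f 1 N A (ltW A0) tf.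
exists C; split => // xi; have := h 0 xi.
have -> : (fun s : R => f (0 + s *: (1 : R))) = f.
  by apply/funext => s; rewrite add0r [s *: 1]mulr1.
apply => s sA; rewrite add0r [s *: 1]mulr1 => /fA.
by rewrite ler_norml.
Qed.

Lemma test_fun_lipschitz Omega f : test_fun Omega f -> exists L : R, 0 <= L /\
  forall x y, normc (f y - f x) <= L * `|y - x|.
Proof.
move=> tf; have [M [M0 hM]] := test_fun_bounded (test_fun_cderive (1 : R) tf).
exists (2 * M); split; first by rewrite mulr_ge0.
move=> x y; have [sf _ _] := tf.
have := @lipschitz_line R R f x (1 : R) (y - x) M sf hM.
by rewrite [(y - x) *: 1]mulr1 subrKC.
Qed.

Lemma w1_le (x : R) : (1 + `|x|) ^- 2 <= w1 x.
Proof.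
have h : 1 + x ^+ 2 <= (1 + `|x|) ^+ 2.
  by rewrite sqrrD expr1n mul1r real_normK ?num_real// lerD2r lerDl mulrn_wge0.
by rewrite /w1 lef_pV2 ?posrE ?exprn_gt0 ?ltr_pwDl ?sqr_ge0.
Qed.

Lemma le_w1 (x c C : R) : 0 <= c -> (1 + `|x|) ^+ 2 * c <= C -> c <= C * w1 x.
Proof.
move=> c0 h; have x0 : 0 < (1 + `|x|) ^+ 2 by rewrite exprn_gt0// ltr_pwDl.
have C0 : 0 <= C by apply: le_trans h; rewrite mulr_ge0// ltW.
apply: (@le_trans _ _ (C * (1 + `|x|) ^- 2)); last by rewrite ler_wpM2l// w1_le.
by rewrite ler_pdivlMr// mulrC.
Qed.

Lemma test_fun_inversion Omega f x : test_fun Omega f ->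
  cI mu (fun xi => ft f xi * cis (2 * pi * (x * xi))) = f x.
Proof.
move=> tf; have [A [A0 fA]] := test_fun_supp_bounded tf.
have [C [C0 fC]] := ft_rapid 2 tf; have [L [L0 fL]] := test_fun_lipschitz tf.
have [B [B0 fB]] := test_fun_bounded tf.
apply: (@ft_inversion R f A L B C) => //.
- exact: test_fun_cmeas tf.
- exact: supp_itv tf fA.
- by move=> xi; apply: le_w1 => //; exact: normc_ge0.
Qed.

Lemma cis_lipschitz (a b : R) : normc (cis a - cis b) <= 2 * `|a - b|.
Proof.
have key (F F' : R -> R) : (forall x : R, is_derive x (1 : R) F (F' x)) -> (forall x, `|F' x| <= 1) ->
    forall x y, `|F x - F y| <= `|x - y|.
  move=> dF F1.
  have h x y : y <= x -> `|F x - F y| <= `|x - y|.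
    move=> yx; have [c _ ->] := @MVT_segment _ F F' y x yx (fun x _ => dF x)
      (continuous_subspaceT (derive_continuous dF)).
    by rewrite normrM ler_piMl.
  by move=> x y; have [/h//|/ltW/h] := leP y x; rewrite distrC [`|y - x|]distrC.
apply: (le_trans (normc_le_ReIm _)); rewrite mulr_natl mulr2n; apply: lerD.
- apply: (key (@cos R) (fun x => - sin x)) => x.
  by rewrite normrN sin_abs_le1.
- apply: (key (@sin R) (@cos R)) => x.
  exact: cos_abs_le1.
Qed.

(** The oscillation costs a Lipschitz constant proportional to |xi|, with 4 pi = 2 x 2 pi by
    [cis_lipschitz]. This is the source of the factor 1 + |xi| in all spectral bounds. *)
Lemma lip0_phase A L B f (xi : R) : 0 <= B -> lip0 A L B f ->
  lip0 A (L + B * (4 * pi * `|xi|)) B (fun x => f x * cis (- (2 * pi * (x * xi)))).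
Proof.
move=> B0 [mf fA fL fB]; split.
- apply: cmeasM => //; apply: cmeas_cis.
  exact: meas1_phaseN.
- by move=> x xA; rewrite fA// mul0r.
- move=> x; rewrite mul0r mulr0 oppr0 cis0 mulr1.
  have -> : f x * cis (- (2 * pi * (x * xi))) - f 0 =
    (f x - f 0) + f x * (cis (- (2 * pi * (x * xi))) - cis 0) by rewrite cis0; ring.
  apply: (le_trans (normcD_le _ _)); rewrite [leRHS]mulrDl; apply: lerD; first exact: fL.
  rewrite normcM -[leRHS]mulrA; apply: ler_pM_normc; [exact: fB|].
  apply: (le_trans (cis_lipschitz _ _)); rewrite subr0 normrN !normrM.
  rewrite (ger0_norm (pi_ge0 R)) (ger0_norm (ler0n R 2)).
  move: (pi : R) (`|x|) (`|xi|) => q X Y; nra.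
- by move=> x; rewrite normcM normc_cis mulr1.
Qed.

Lemma test_fun_lip0 Omega f : test_fun Omega f -> exists A L B : R,
  [/\ 0 < A, 0 <= L, 0 <= B & lip0 A L B f].
Proof.
move=> tf; have [A [A0 fA]] := test_fun_supp_bounded tf.
have [L [L0 fL]] := test_fun_lipschitz tf; have [B [B0 fB]] := test_fun_bounded tf.
exists A, L, B; split => //; split => //.
- exact: test_fun_cmeas tf.
- exact: supp_itv tf fA.
- by move=> x; have := fL 0 x; rewrite subr0.
Qed.

Lemma meas1_scale (c : R) : meas1 (fun s => c * s).
Proof.
by apply: continuous_meas1 => s; apply: cvgM; [exact: cvg_cst|exact: cvg_id].
Qed.

(* The spectrum of a localisation of 1/(x+i0) decays only in the negative
   direction; this weight ignores the positive frequencies. *)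
Definition negw (xi : R) : R := 1 + Num.max 0 (- xi).

Lemma negw_ge1 xi : 1 <= negw xi.
Proof. by rewrite /negw lerDl le_max lexx. Qed.

Lemma negw_gt0 xi : 0 < negw xi.
Proof. exact: lt_le_trans (negw_ge1 xi). Qed.

(** For xi >= 0 the uniform bound on 1/(x+ie) gives linear growth. For xi < 0 the Laplace formula
    turns the transform into - 2 i pi times the integral over s >= 0 of exp(-2 pi e s) ft f (xi -
    s), where xi - s stays away from 0 and the decay of [ft f] applies; the exponential is simply
    bounded by 1, hence no e in C. *)
Lemma negw_bound f N : test_fun setT f -> exists C : R, 0 <= C /\ forall e xi : R, 0 < e ->
  negw xi ^+ N * normc (ft (fun x => (x +i* e)^-1 * f x) xi) <= C * (1 + `|xi|).
Proof.
move=> tf; have [A [L [B [A0 L0 B0 fl]]]] := test_fun_lip0 tf.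
(* N powers for the weight in xi, two more for integrability in s. *)
have [C [C0 fC]] := ft_rapid N.+2 tf.
(* K serves for xi < 0, with 2 pi from the Laplace formula and 2 from [cI_le]. D serves for xi >= 0
   and collects the coefficients of [inv_ieps_bound] after [lip0_phase]. *)
pose K := 4 * pi * (C * \int[mu]_s w1 s).
have W0 : 0 <= \int[mu]_s w1 s by apply: Rintegral_ge0 => x _; exact/ltW/w1_gt0.
have K0 : 0 <= K by rewrite !mulr_ge0 ?pi_ge0.
pose D := 4 * A * L + 4 * A * (B * (4 * pi)) + pi * B.
have D0 : 0 <= D by rewrite !addr_ge0 ?mulr_ge0 ?pi_ge0 ?(ltW A0).
exists (K + D); split; first exact: addr_ge0.
move=> e xi e0; have [xi0|xi0] := leP 0 xi.
  rewrite /negw max_l ?oppr_le0// addr0 expr1n mul1r.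
  have -> : ft (fun x => (x +i* e)^-1 * f x) xi =
      inv_x_ieps e (fun x => f x * cis (- (2 * pi * (x * xi)))).
    by rewrite /inv_x_ieps /regular cintTE; apply: eq_cI => x; rewrite -[LHS]mulrA.
  have L'0 : 0 <= L + B * (4 * pi * `|xi|) by rewrite addr_ge0 ?mulr_ge0 ?pi_ge0 ?normr_ge0.
  apply: (le_trans (inv_ieps_bound e0 A0 L'0 (lip0_phase xi B0 fl))).
  apply: (@le_trans _ _ (D * (1 + `|xi|))); last first.
    by rewrite ler_wpM2r ?addr_ge0// lerDr.
  rewrite /D.
  have h1 : 0 <= 4 * A * L * `|xi| by rewrite !mulr_ge0 ?(ltW A0).
  have h2 : 0 <= pi * B * `|xi| by rewrite !mulr_ge0 ?pi_ge0.
  have h3 : 0 <= 4 * A * (B * (4 * pi)) by rewrite !mulr_ge0 ?pi_ge0 ?(ltW A0).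
  move: h1 h2 h3; move: (pi) => q; move: `|xi| => z h1 h2 h3; nra.
rewrite /negw max_r ?oppr_ge0 ?(ltW xi0)//.
have xiN : `|xi| = - xi by rewrite ltr0_norm.
have [A1 fA _ fB] := fl.
pose a := 2 * pi * e; have a0 : 0 < a by rewrite !mulr_gt0// pi_gt0.
have iB : rint mu (fun x => B * ind (- A) A x) by exact/rintZ/rint_ind.
have vdom y : normc (f y) <= B * ind (- A) A y.
  rewrite indE; case: ifPn => [_|/negP /fA ->]; first by rewrite mulr1.
  by rewrite normc0 mulr0.
pose F (p : RL R * RL R) := f p.1 * cis (- (2 * pi * (p.1 * xi))) * ((hexp a p.2)%:C * cis (2 * pi * p.1 * p.2)).
have mF : cmeas F.
  apply: cmeasM.
    apply: cmeasM.
      by split; [apply: measurableT_comp A1.1 _|apply: measurableT_comp A1.2 _].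
    apply: cmeas_cis; apply: (@meas2_fst R (fun x => - (2 * pi * (x * xi)))).
    exact: meas1_phaseN.
  apply: cmeasM; first by apply: cmeas_real; apply: meas2_snd; exact: measurable_hexp.
  apply: cmeas_cis; rewrite (_ : (fun p => _) = (fun p : RL R * RL R => 2 * pi * (p.1 * p.2))).
    exact: meas2_phase.
  by apply/funext => p; rewrite mulrA.
have hF x s : normc (F (x, s)) <= B * ind (- A) A x * hexp a s.
  rewrite /F/= !normcM !normc_cis !mulr1 normc_real ger0_norm ?hexp_ge0//.
  by rewrite ler_wpM2r ?hexp_ge0.
have mf : cmeas (f : RL R -> _) := A1.
have iE := rint_hexp a0.
have e1 : ft (fun x => (x +i* e)^-1 * f x) xi =
    - 'i%C * (2 * pi)%:C * cI mu (fun x => cI mu (fun s => F (x, s))).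
  rewrite -(cI_Z _ (cint_section1 iB iE mF hF)).
  apply: eq_cI => x; rewrite (inv_ieps_laplace x e0) -/a.
  rewrite (cI_Z (m := mu) (f x * cis (- (2 * pi * (x * xi))))); first by move: (cis (- _)) (cI mu _) (f x) (real_complex R (2 * pi)) => c k z P; ring.
  apply: (cint_dom _ _ iE) => [|s].
    apply: cmeasM; first by apply: cmeas_real; exact: measurable_hexp.
    by apply: cmeas_cis; exact: (meas1_scale (2 * pi * x)).
  by rewrite normcM normc_cis mulr1 normc_real (ger0_norm (hexp_ge0 _ _)).
have e2 : cI mu (fun x => cI mu (fun s => F (x, s))) = cI mu (fun s => (hexp a s)%:C * ft f (xi - s)).
  rewrite (cI_swap iB iE mF hF); apply: eq_cI => s.
  rewrite -(cI_Z (m := mu) (hexp a s)%:C (f := fun x => f x * cis (- (2 * pi * (x * (xi - s)))))).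
    apply: eq_cI => x; rewrite /F/= mulrCA -!mulrA; congr (_ * (_ * _)).
    by rewrite -cisD; congr cis; ring.
  apply: (cint_dom _ _ iB) => [|x]; last by rewrite normcM normc_cis mulr1; exact: vdom.
  by apply: cmeasM; [exact: mf|apply: cmeas_cis; exact: meas1_phaseN].
rewrite e1 e2 !normcM normcN_eq normc_real.
have -> : normc ('i%C : R[i]) = 1 by rewrite /normc expr0n/= add0r expr1n sqrtr1.
have X0 : 0 < (1 - xi) ^+ N by rewrite exprn_gt0// ltr_pwDl// oppr_ge0 ltW.
have hs s : normc ((hexp a s)%:C * ft f (xi - s)) <= (1 - xi) ^- N * C * w1 s.
  rewrite normcM normc_real (ger0_norm (hexp_ge0 _ _)).
  have [s0|s0] := leP 0 s; last first.
    by rewrite /hexp (lt_geF s0) mul0r mulr_ge0 ?(ltW (w1_gt0 _))// mulr_ge0 ?invr_ge0 ?(ltW X0).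
  apply: (@le_trans _ _ (normc (ft f (xi - s)))).
    by rewrite ler_piMl ?normc_ge0// hexp_le1.
  rewrite -mulrA -ler_pdivrMl ?invr_gt0// invrK.
  apply: le_w1; first by rewrite mulr_ge0 ?normc_ge0// ltW.
  apply: le_trans (fC (xi - s)); rewrite mulrA ler_wpM2r ?normc_ge0//.
  (* As xi < 0 <= s nothing cancels: |xi - s| dominates both |xi| and s, so the N + 2 powers can be
     shared between them. *)
  have -> : `|xi - s| = - xi + s by rewrite ltr0_norm ?subr_lt0 ?(lt_le_trans xi0)//; ring.
  have -> : (1 + (- xi + s)) ^+ N.+2 = (1 + (- xi + s)) ^+ 2 * (1 + (- xi + s)) ^+ N.
    by rewrite -exprD add2n.
  rewrite (ger0_norm s0).
  have p1 : 0 <= 1 - xi by rewrite addr_ge0// oppr_ge0 ltW.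
  have p2 : 0 <= - xi by rewrite oppr_ge0 ltW.
  have q1 : 1 - xi <= 1 + (- xi + s) by rewrite addrA lerDl.
  have q2 : 1 + s <= 1 + (- xi + s) by rewrite lerD2l lerDr.
  apply: ler_pM; [by rewrite exprn_ge0// addr_ge0|exact: exprn_ge0|..].
  - by rewrite lerXn2r ?nnegrE// ?addr_ge0// addr_ge0.
  - by rewrite lerXn2r ?nnegrE// (le_trans p1).
have mh : cmeas (fun s : RL R => (hexp a s)%:C * ft f (xi - s)).
  apply: cmeasM; first by apply: cmeas_real; exact: measurable_hexp.
  have [mft1 mft2] := cmeas_ft mf vdom iB.
  have mB : measurable_fun setT (fun s : RL R => xi - s : RL R).
    by apply: continuous_meas1 => s; apply: cvgB; [exact: cvg_cst|exact: cvg_id].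
  by split; [exact: measurableT_comp mft1 mB|exact: measurableT_comp mft2 mB].
have := cI_le mh hs (rintZ _ (@rint_w1 R)).
rewrite RintegralZl//; last exact: rint_w1.
move: (normc (cI _ _)) => z hz.
rewrite mul1r ger0_norm; last by rewrite mulr_ge0// pi_ge0.
apply: (@le_trans _ _ K); last first.
  apply: (@le_trans _ _ (K + D)); first by rewrite lerDl.
  by apply: ler_peMr; [exact: addr_ge0|rewrite lerDl].
rewrite /K; move: hz W0; move: (\int[mu]_s w1 s) => W hz W0.
have hz' : (1 - xi) ^+ N * z <= 2 * (C * W).
  by rewrite mulrC -ler_pdivlMr// (le_trans hz)//; apply: eqW; ring.
rewrite mulrCA (_ : 4 * pi * (C * W) = 2 * pi * (2 * (C * W))); last by ring.
by rewrite ler_wpM2l// mulr_ge0// pi_ge0.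
Qed.

End TestLine.

(** * The Fourier transform on the plane *)

Section ParamMeas.
Context d1 d2 (T1 : measurableType d1) (T2 : measurableType d2) (R : realType).
Variable m1 : {sigma_finite_measure set T1 -> \bar R}.
Variable m2 : {sigma_finite_measure set T2 -> \bar R}.

Lemma cmeas_comp (f : T2 -> R[i]) (g : T1 -> T2) : cmeas f -> measurable_fun setT g ->
  cmeas (fun x => f (g x)).
Proof.
by move=> [f1 f2] mg; split; [exact: measurableT_comp f1 mg|exact: measurableT_comp f2 mg].
Qed.

(* Fubini's theorem needs integrability in x too: the integral is multiplied by
   the weight [a] before it is applied, and divided by it afterwards. *)
Lemma cmeas_param (F : T1 * T2 -> R[i]) (a : T1 -> R) (b : T2 -> R) :
  rint m1 a -> (forall x, 0 < a x) -> measurable_fun setT (fun x => (a x)^-1) ->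
  rint m2 b -> cmeas F ->
  (forall x y, normc (F (x, y)) <= b y) -> cmeas (fun x => cI m2 (fun y => F (x, y))).
Proof.
move=> ia a0 mVa ib mF Fb.
have ma : cmeas (fun x => (a x)%:C) by apply: cmeas_real; exact: rint_meas ia.
have mF' : cmeas (fun p => (a p.1)%:C * F p).
  by apply: cmeasM mF; apply: (@cmeas_real _ (T1 * T2)%type _ (fun p => a p.1)); apply: measurableT_comp (rint_meas ia) _; exact: measurable_fst.
have hF' x y : normc ((a (x, y).1)%:C * F (x, y)) <= a x * b y.
  by rewrite normcM normc_real (gtr0_norm (a0 _)) ler_wpM2l// ltW.
have h := cmeas_section1 ia ib mF' hF'.
have -> : (fun x => cI m2 (fun y => F (x, y))) =
    (fun x => ((a x)^-1)%:C * cI m2 (fun y => (a x)%:C * F (x, y))).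
  apply/funext => x; rewrite cI_Z.
    by rewrite mulrA -rmorphM mulVf ?gt_eqF// rmorph1 mul1r.
  apply: (cint_dom _ (Fb x) ib).
  have [mF1 mF2] := mF.
  by split; [exact: measurableT_comp mF1 _|exact: measurableT_comp mF2 _].
apply: cmeasM h; apply: cmeas_real.
exact: mVa.
Qed.

End ParamMeas.

Section Plane.
Variable R : realType.
Notation mu := (@mu1 R).
Notation nu := (@mu2 R).
Notation R2 := (R * R)%type.
Notation T2 := (RL R * RL R)%type.
Implicit Types (phi : R2 -> R[i]) (p q z : R2).

Definition w2 p : R := w1 p.1 * w1 p.2.

Lemma w2_gt0 p : 0 < w2 p.
Proof. by rewrite mulr_gt0// w1_gt0. Qed.

Lemma rint_w2 : rint nu (w2 : T2 -> R).
Proof. exact: rint_tensor (@rint_w1 R) (@rint_w1 R). Qed.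

Definition ind2 (A B : R) p : R := ind (- A) A p.1 * ind (- B) B p.2.

Lemma rint_ind2 A B : rint nu (ind2 A B : T2 -> R).
Proof. exact: rint_tensor (rint_ind _ _) (rint_ind _ _). Qed.

Lemma ind2E A B p : ind2 A B p = if (- A <= p.1 <= A) && (- B <= p.2 <= B) then 1 else 0.
Proof. by rewrite /ind2 !indE; do 2 case: ifP => _ //=; rewrite ?mul1r ?mul0r. Qed.

Definition cmeas2 phi := cmeas (phi : T2 -> R[i]).

(* The counterpart of [lip0] on the plane. *)
Definition nice (A B L M : R) phi :=
  [/\ cmeas2 phi, forall p, normc (phi p) <= M * ind2 A B p
    & forall x t, normc (phi (x, t) - phi (0, t)) <= L * `|x|].

Definition slice phi (x : R) : R[i] := cI mu (fun t => phi (x, t)).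

Lemma cmeas_slice phi x : cmeas2 phi -> cmeas (fun t : RL R => phi (x, t)).
Proof.
by move=> [m1 m2]; split; [exact: measurableT_comp m1 _|exact: measurableT_comp m2 _].
Qed.

Lemma cmeas_slice2 phi t : cmeas2 phi -> cmeas (fun x : RL R => phi (x, t)).
Proof.
by move=> [m1 m2]; split; [exact: measurableT_comp m1 _|exact: measurableT_comp m2 _].
Qed.

(** A Lipschitz bound in x uniform in t survives integration over t in [-B, B]; 4 B is the length 2
    B times the factor 2 of [cI_le]. *)
Lemma nice_lip0 A B L M phi : 0 < B -> 0 <= M -> nice A B L M phi ->
  lip0 A (4 * B * L) (4 * B * M) (slice phi).
Proof.
move=> B0 M0 [mp pM pL].
have iB : rint mu (ind (- B) B) := rint_ind _ _.
have cs x : cintegrable mu (fun t => phi (x, t)).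
  apply: (@cint_dom _ _ _ mu _ (fun t => M * ind (- B) B t)); last exact: rintZ.
    exact: cmeas_slice.
  move=> t; apply: (le_trans (pM _)); rewrite ler_wpM2l//.
  by rewrite ler_piMl ?ind_ge0// ind_le1.
have hb (f : R -> R[i]) K : 0 <= K -> cmeas (f : RL R -> _) -> (forall t, normc (f t) <= K * ind (- B) B t) ->
    normc (cI mu f) <= 4 * B * K.
  move=> K0 mf fK; apply: (le_trans (cI_le mf fK (rintZ K iB))).
  rewrite RintegralZl// int_ind; last by rewrite ge0_cp// ltW.
  by apply: eqW; ring.
split.
- apply: (@cmeas_section1 _ _ _ _ _ mu mu (fun x => M * ind (- A) A x) (ind (- B) B) _ iB phi mp).
    exact/rintZ/rint_ind.
  by move=> x t; rewrite -mulrA; exact: pM.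
- move=> x /negP xA; rewrite /slice (@eq_cI _ _ _ mu _ (fun=> 0)) ?cI0// => t.
  apply/eq0_normc/eqP; rewrite eq_le normc_ge0 andbT (le_trans (pM _))//.
  by rewrite ind2E/= (negbTE xA) mulr0.
- move=> x.
  have L0 : 0 <= L * `|x| by apply: le_trans (pL x 0); exact: normc_ge0.
  have -> : slice phi x - slice phi 0 = cI mu (fun t => phi (x, t) - phi (0, t)).
    rewrite (@eq_cI _ _ _ mu (fun t => phi (x, t) - phi (0, t)) (fun t => - 1 * phi (0, t) + phi (x, t))); last by move=> t; ring.
    by rewrite cI_lin// /slice; ring.
  have -> : 4 * B * L * `|x| = 4 * B * (L * `|x|) by rewrite mulrA.
  apply: hb => //.
    by apply: cmeasD; [exact: cmeas_slice|apply: cmeasN; exact: cmeas_slice].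
  move=> t; rewrite indE; case: ifPn => [_|tB]; first by rewrite mulr1.
  have z y : phi (y, t) = 0.
    apply/eq0_normc/eqP; rewrite eq_le normc_ge0 andbT (le_trans (pM _))//.
    by rewrite ind2E/= (negbTE tB) andbF mulr0.
  by rewrite !z subrr normc0 mulr0.
- move=> x; apply: hb => //; first exact: cmeas_slice.
  move=> t; apply: (le_trans (pM _)); rewrite ler_wpM2l//.
  by rewrite ler_piMl ?ind_ge0// ind_le1.
Qed.

Definition u0t : (R2 -> R[i]) -> R[i] := tensor1 (@inv_x_i0 R).

Lemma u0tE phi : u0t phi = inv_x_i0 (slice phi).
Proof. by []. Qed.

Definition Un (e : R) phi : R[i] := cI nu (fun p => (p.1 +i* e)^-1 * phi p).

Lemma cmeas_inv2 e : 0 < e -> cmeas2 (fun p => (p.1 +i* e)^-1).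
Proof.
move=> e0; apply: (cmeas_comp (g := fun p : T2 => p.1) (cmeas_inv_ieps e0)).
exact: measurable_fst.
Qed.

Lemma normc_inv_e (x e : R) : 0 < e -> normc (x +i* e)^-1 <= e^-1.
Proof.
move=> e0; rewrite normcV lef_pV2 ?posrE ?normc_ieps_gt0//.
by rewrite -[leLHS]gtr0_norm//; exact: Im_le_normc (x +i* e).
Qed.

Lemma UnE A B L M e phi : 0 < e -> 0 <= M -> nice A B L M phi ->
  inv_x_ieps e (slice phi) = Un e phi.
Proof.
move=> e0 M0 [mp pM pL].
have iA : rint mu (fun x => e^-1 * (M * ind (- A) A x)) by apply: rintZ; exact/rintZ/rint_ind.
have hF x t : normc ((x +i* e)^-1 * phi (x, t)) <= e^-1 * (M * ind (- A) A x) * ind (- B) B t.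
  rewrite normcM -!mulrA; apply: ler_pM_normc.
    exact: normc_inv_e.
  by apply: (le_trans (pM _)); rewrite /ind2.
have mF : cmeas2 (fun p => (p.1 +i* e)^-1 * phi p) by apply: cmeasM => //; exact: cmeas_inv2.
rewrite /Un -(cI_fubini1 iA (rint_ind _ _) mF hF).
rewrite /inv_x_ieps /regular cintTE; apply: eq_cI => x.
rewrite -(cI_Z (m := mu) _ (f := fun t => phi (x, t)))//.
apply: (@cint_dom _ _ _ mu _ (fun t => M * ind (- B) B t)); last exact/rintZ/rint_ind.
  exact: cmeas_slice.
move=> t; apply: (le_trans (pM _)); rewrite ler_wpM2l//.
by rewrite ler_piMl ?ind_ge0// ind_le1.
Qed.

(** The bridge from the iterated functional [u0t] to absolutely convergent plane integrals:
    linearity, the spectrum, the square and the exchange of variables are all read off from [Un] and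
    carried over by uniqueness of limits. *)
Lemma Un_cvg A B L M phi : 0 < A -> 0 < B -> 0 <= L -> 0 <= M -> nice A B L M phi ->
  ccvg (fun n => Un (epsn R n) phi) (u0t phi).
Proof.
move=> A0 B0 L0 M0 np; rewrite u0tE.
under [X in ccvg X _]eq_fun do rewrite -(UnE (epsn_gt0 R _) M0 np).
apply: (inv_epsn_cvg A0 _ (nice_lip0 B0 M0 np)).
by rewrite !mulr_ge0// ltW.
Qed.

Lemma u0t_bound A B L M phi : 0 < A -> 0 < B -> 0 <= L -> 0 <= M -> nice A B L M phi ->
  normc (u0t phi) <= 4 * A * (4 * B * L) + pi * (4 * B * M).
Proof.
move=> A0 B0 L0 M0 np; rewrite u0tE.
apply: (inv_x_i0_bound A0 _ (nice_lip0 B0 M0 np)).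
by rewrite !mulr_ge0// ltW.
Qed.

Lemma nice_lin A B L L' M M' (a : R[i]) phi psi : nice A B L M phi -> nice A B L' M' psi ->
  nice A B (normc a * L + L') (normc a * M + M') (fun p => a * phi p + psi p).
Proof.
move=> [m1 M1 L1] [m2 M2 L2]; split.
- by apply: cmeasD => //; apply: cmeasM => //; exact: cmeas_cst.
- move=> p; apply: (le_trans (normcD_le _ _)); rewrite [leRHS]mulrDl; apply: lerD => //.
  by rewrite normcM -[leRHS]mulrA ler_wpM2l ?normc_ge0.
- move=> x t; rewrite (_ : _ - _ = a * (phi (x, t) - phi (0, t)) + (psi (x, t) - psi (0, t))); last by ring.
  apply: (le_trans (normcD_le _ _)); rewrite [leRHS]mulrDl; apply: lerD => //.
  by rewrite normcM -[leRHS]mulrA ler_wpM2l ?normc_ge0.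
Qed.

Lemma nice_integrable A B L M e phi : 0 < e -> nice A B L M phi ->
  cintegrable nu (fun p => (p.1 +i* e)^-1 * phi p).
Proof.
move=> e0 [mp pM pL].
apply: (@cint_dom _ _ _ nu _ (fun p : T2 => e^-1 * M * ind2 A B p)); last exact/rintZ/rint_ind2.
  by apply: cmeasM => //; exact: cmeas_inv2.
move=> p; rewrite normcM -mulrA; apply: ler_pM_normc.
  exact: normc_inv_e.
exact: pM.
Qed.

Lemma u0t_lin A B L L' M M' (a : R[i]) phi psi : 0 < A -> 0 < B -> 0 <= L -> 0 <= L' ->
  0 <= M -> 0 <= M' -> nice A B L M phi -> nice A B L' M' psi ->
  u0t (fun p => a * phi p + psi p) = a * u0t phi + u0t psi.
Proof.
move=> A0 B0 L0 L'0 M0 M'0 np nq.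
have l0 : 0 <= normc a * L + L' by rewrite addr_ge0// mulr_ge0// normc_ge0.
have m0 : 0 <= normc a * M + M' by rewrite addr_ge0// mulr_ge0// normc_ge0.
have c1 := Un_cvg A0 B0 l0 m0 (nice_lin a np nq).
apply: (ccvg_unique c1).
have := ccvgD (ccvgM (ccvg_cst a) (Un_cvg A0 B0 L0 M0 np)) (Un_cvg A0 B0 L'0 M'0 nq).
congr ccvg; apply/funext => n; rewrite /Un -cI_lin.
- by apply: eq_cI => p; ring.
- exact: nice_integrable (epsn_gt0 R n) np.
- exact: nice_integrable (epsn_gt0 R n) nq.
Qed.

End Plane.

Section PlaneFourier.
Variable R : realType.
Notation mu := (@mu1 R).
Notation nu := (@mu2 R).
Notation R2 := (R * R)%type.
Notation T2 := (RL R * RL R)%type.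
Implicit Types (phi : R2 -> R[i]) (p q z : R2).

Lemma cI_tensor (F G : R -> R[i]) (a b : R -> R) : cmeas (F : RL R -> _) -> cmeas (G : RL R -> _) ->
  rint mu a -> rint mu b -> (forall x, normc (F x) <= a x) -> (forall x, normc (G x) <= b x) ->
  cI nu (fun p => F p.1 * G p.2) = cI mu F * cI mu G.
Proof.
move=> mF mG ia ib Fa Gb.
have mFG : cmeas (fun p : T2 => F p.1 * G p.2).
  by apply: cmeasM; [apply: (cmeas_comp mF); exact: measurable_fst|apply: (cmeas_comp mG); exact: measurable_snd].
have hFG x y : normc (F (x, y).1 * G (x, y).2) <= a x * b y.
  by rewrite normcM; apply: ler_pM_normc.
rewrite -(cI_fubini1 ia ib mFG hFG) /= mulrC -cI_Z; last exact: cint_dom mF Fa ia.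
by apply: eq_cI => x; rewrite mulrC cI_Z//; exact: cint_dom mG Gb ib.
Qed.

Lemma w2V_meas : measurable_fun setT (fun z : T2 => (w2 z)^-1).
Proof.
have h : measurable_fun setT (fun x : RL R => 1 + x ^+ 2 : R).
  by apply: continuous_meas1; exact: continuous_oneDsqr.
rewrite (_ : (fun z : T2 => _) = (fun z : T2 => (1 + z.1 ^+ 2) * (1 + z.2 ^+ 2))).
  by apply: measurable_funM; [exact: measurableT_comp h (@measurable_fst _ _ _ _)|exact: measurableT_comp h (@measurable_snd _ _ _ _)].
by apply/funext => z; rewrite /w2 /w1 -invfM invrK.
Qed.

Lemma meas_coords :
  [/\ measurable_fun setT (fun p : T2 * T2 => p.1.1 : R),
      measurable_fun setT (fun p : T2 * T2 => p.1.2 : R),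
      measurable_fun setT (fun p : T2 * T2 => p.2.1 : R)
    & measurable_fun setT (fun p : T2 * T2 => p.2.2 : R)].
Proof.
have m1 := @measurable_fst _ _ (RL R) (RL R); have m2 := @measurable_snd _ _ (RL R) (RL R).
by split; [apply: (measurableT_comp m1)|apply: (measurableT_comp m2)
  |apply: (measurableT_comp m1)|apply: (measurableT_comp m2)];
  try exact: measurable_fst; exact: measurable_snd.
Qed.

Lemma meas_dotp (c : R) : measurable_fun setT (fun p : T2 * T2 => c * dotp p.2 p.1).
Proof.
have [m11 m12 m21 m22] := meas_coords.
apply: measurable_funM; first exact: measurable_cst.
by apply: measurable_funD; apply: measurable_funM.
Qed.

Lemma meas_dotp1 (c : R) z : measurable_fun setT (fun q : T2 => c * dotp q z).
Proof.
apply: measurable_funM; first exact: measurable_cst.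
apply: measurable_funD; apply: measurable_funM; try exact: measurable_cst.
  exact: measurable_fst.
exact: measurable_snd.
Qed.

(** c = - 2 pi and c = 2 pi give the direct and the inverse transform, so that each estimate is
    proved once for both. *)
Definition FT (c : R) phi z : R[i] := cI nu (fun q => cis (c * dotp q z) * phi q).

Lemma fourierE phi : fourier phi = FT (- (2 * pi)) phi.
Proof.
by apply/funext => z; rewrite /fourier cint2E; apply: eq_cI => q; rewrite mulNr.
Qed.

Lemma dotpC p q : dotp p q = dotp q p.
Proof. by rewrite /dotp mulrC [p.2 * _]mulrC. Qed.

Lemma fourier_invE phi : fourier_inv phi = FT (2 * pi) phi.
Proof.
by apply/funext => z; rewrite /fourier_inv cint2E; apply: eq_cI => q; rewrite dotpC.
Qed.

Lemma cint_phase c phi (b : R2 -> R) z : cmeas2 phi -> (forall q, normc (phi q) <= b q) ->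
  rint nu (b : T2 -> R) -> cintegrable nu (fun q => cis (c * dotp q z) * phi q).
Proof.
move=> mp pb ib; apply: (@cint_dom _ _ _ nu _ b) => //.
  by apply: cmeasM => //; apply: cmeas_cis; exact: meas_dotp1.
by move=> q; rewrite normcM normc_cis mul1r.
Qed.

Lemma cmeas_FT c phi (b : R2 -> R) : cmeas2 phi -> (forall q, normc (phi q) <= b q) ->
  rint nu (b : T2 -> R) -> cmeas2 (FT c phi).
Proof.
move=> mp pb ib.
pose F (p : T2 * T2) := cis (c * dotp p.2 p.1) * phi p.2.
have mF : cmeas F.
  apply: cmeasM; first by apply: cmeas_cis; exact: meas_dotp.
  by apply: (cmeas_comp mp); exact: measurable_snd.
have hF z q : normc (F (z, q)) <= b q by rewrite normcM normc_cis mul1r.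
have h := @cmeas_param _ _ _ _ _ nu nu F (@w2 R) b (@rint_w2 R) (@w2_gt0 R) w2V_meas ib mF hF.
exact: h.
Qed.

Lemma FT_bound c phi (b : R2 -> R) z : cmeas2 phi -> (forall q, normc (phi q) <= b q) ->
  rint nu (b : T2 -> R) -> normc (FT c phi z) <= 2 * \int[nu]_q b q.
Proof.
move=> mp pb ib; apply: cI_le => //.
  by apply: cmeasM => //; apply: cmeas_cis; exact: meas_dotp1.
by move=> q; rewrite normcM normc_cis mul1r.
Qed.

(* The factor [1 + |q.1|] makes the Fourier transform of phi Lipschitz in x. *)
Definition adm (K : R) phi :=
  cmeas2 phi /\ forall q, (1 + `|q.1|) * normc (phi q) <= K * w2 q.

Lemma adm_le K phi q : adm K phi -> normc (phi q) <= K * w2 q.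
Proof.
move=> [_ h]; apply: le_trans (h q).
by rewrite ler_peMl ?normc_ge0// lerDl.
Qed.

Lemma adm_rint K : rint nu (fun q : T2 => K * w2 q).
Proof. exact/rintZ/rint_w2. Qed.

Definition W2 : R := \int[nu]_q w2 q.

Lemma W2_ge0 : 0 <= W2.
Proof. by apply: Rintegral_ge0 => q _; exact/ltW/w2_gt0. Qed.

Lemma int_Kw2 K : \int[nu]_q (K * w2 q) = K * W2.
Proof. by rewrite RintegralZl//; exact: rint_w2. Qed.

Lemma FT_lipschitz c K phi x t : adm K phi ->
  normc (FT c phi (x, t) - FT c phi (0, t)) <= 4 * `|c| * (K * W2) * `|x|.
Proof.
move=> ap; have [mp hp] := ap.
have ic z := cint_phase c z mp (fun q => adm_le q ap) (adm_rint K).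
have -> : FT c phi (x, t) - FT c phi (0, t) =
    cI nu (fun q => (cis (c * dotp q (x, t)) - cis (c * dotp q (0, t))) * phi q).
  rewrite (@eq_cI _ _ _ nu (fun q => (cis (c * dotp q (x, t)) - cis (c * dotp q (0, t))) * phi q)
    (fun q => -1 * (cis (c * dotp q (0, t)) * phi q) + cis (c * dotp q (x, t)) * phi q)); last by move=> q; ring.
  by rewrite cI_lin// /FT; ring.
have hb q : normc ((cis (c * dotp q (x, t)) - cis (c * dotp q (0, t))) * phi q) <= (2 * `|c| * `|x|) * (K * w2 q).
  rewrite normcM.
  have h := cis_lipschitz (c * dotp q (x, t)) (c * dotp q (0, t)).
  have e : `|c * dotp q (x, t) - c * dotp q (0, t)| = `|c| * `|x| * `|q.1|.
    by rewrite -!normrM; congr `|_|; rewrite /dotp/=; ring.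
  rewrite e in h.
  apply: (le_trans (ler_wpM2r (normc_ge0 _) h)).
  have h2 : `|q.1| * normc (phi q) <= K * w2 q.
    by apply: le_trans (hp q); rewrite ler_wpM2r ?normc_ge0// lerDr.
  have h3 : 0 <= 2 * `|c| * `|x| by rewrite !mulr_ge0.
  have := ler_wpM2l h3 h2; rewrite !mulrA; exact.
have h3 : 0 <= 2 * `|c| * `|x| by rewrite !mulr_ge0.
have md : cmeas (fun q : T2 => (cis (c * dotp q (x, t)) - cis (c * dotp q (0, t))) * phi q).
  apply: cmeasM => //; apply: cmeasD; first by apply: cmeas_cis; exact: meas_dotp1.
  by apply: cmeasN; apply: cmeas_cis; exact: meas_dotp1.
have := @cI_le _ _ _ nu _ (fun q : T2 => 2 * `|c| * `|x| * (K * w2 q)) md hb (rintZ _ (adm_rint K)).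
rewrite RintegralZl//; last exact: adm_rint.
by rewrite int_Kw2 => /le_trans; apply; apply: eqW; ring.
Qed.

Lemma nice_tensor A B L M1 M2 (g1 g2 : R -> R[i]) : 0 <= M1 -> 0 <= M2 -> lip0 A L M1 g1 ->
  cmeas (g2 : RL R -> _) -> (forall t, normc (g2 t) <= M2 * ind (- B) B t) ->
  nice A B (L * M2) (M1 * M2) (fun p => g1 p.1 * g2 p.2).
Proof.
move=> M10 M20 [mg gA gL gB] m2 h2.
have g2M t : normc (g2 t) <= M2.
  by apply: (le_trans (h2 t)); rewrite ler_piMr// ind_le1.
split.
- by apply: cmeasM; [apply: (cmeas_comp mg); exact: measurable_fst|apply: (cmeas_comp m2); exact: measurable_snd].
- move=> p; rewrite normcM.
  have h1 : normc (g1 p.1) <= M1 * ind (- A) A p.1.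
    rewrite indE; case: ifPn => [_|/negP/gA ->]; first by rewrite mulr1.
    by rewrite normc0 mulr0.
  apply: (le_trans (ler_pM_normc h1 (h2 p.2))).
  by rewrite /ind2; apply: eqW; ring.
- move=> x t /=; rewrite -mulrBl normcM.
  apply: (le_trans (ler_pM_normc (gL x) (g2M t))).
  by apply: eqW; ring.
Qed.

Lemma nice_mul A B L M L' M' phi psi : nice A B L M phi -> 0 <= M -> cmeas2 psi ->
  (forall p, normc (psi p) <= M') -> (forall x t, normc (psi (x, t) - psi (0, t)) <= L' * `|x|) ->
  nice A B (L * M' + M * L') (M * M') (fun p => phi p * psi p).
Proof.
move=> [mp pM pL] M0 mq qM qL; split.
- exact: cmeasM.
- move=> p; rewrite normcM; apply: (le_trans (ler_pM_normc (pM p) (qM p))).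
  by apply: eqW; ring.
- move=> x t.
  have -> : phi (x, t) * psi (x, t) - phi (0, t) * psi (0, t) =
    (phi (x, t) - phi (0, t)) * psi (x, t) + phi (0, t) * (psi (x, t) - psi (0, t)) by ring.
  apply: (le_trans (normcD_le _ _)); rewrite !normcM [leRHS]mulrDl; apply: lerD.
    apply: (le_trans (ler_pM_normc (pL x t) (qM _))).
    by apply: eqW; ring.
  rewrite -[leRHS]mulrA; apply: ler_pM => //; try exact: normc_ge0.
  by apply: (le_trans (pM _)); rewrite ind2E; case: ifP; rewrite ?mulr1 ?mulr0.
Qed.

End PlaneFourier.

(** * The spectrum of the localised distribution on the plane *)

Section Cutoff.
Variable R : realType.
Notation mu := (@mu1 R).
Notation nu := (@mu2 R).
Notation R2 := (R * R)%type.
Notation T2 := (RL R * RL R)%type.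
Implicit Types (phi psi : R2 -> R[i]) (p q z : R2).

Variables (f1 f2 : R -> R[i]).
Hypotheses (tf1 : test_fun setT f1) (tf2 : test_fun setT f2).

(** A cutoff in product form makes the regularised spectrum [se] a product of two transforms on the
    line, of which only the first carries the singularity. *)
Definition chi p : R[i] := f1 p.1 * f2 p.2.

Definition se (e : R) q : R[i] := ft (fun x => (x +i* e)^-1 * f1 x) q.1 * ft f2 q.2.

Definition s0 : R2 -> R[i] := fourier_cut chi (@u0t R).

Lemma tf2_dom : exists B M : R, [/\ 0 < B, 0 <= M, cmeas (f2 : RL R -> _) &
  forall t, normc (f2 t) <= M * ind (- B) B t].
Proof.
have [B [L [M [B0 L0 M0 [mf fB _ fM]]]]] := test_fun_lip0 tf2.
exists B, M; split => // t; rewrite indE; case: ifPn => [_|/negP/fB ->]; first by rewrite mulr1.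
by rewrite normc0 mulr0.
Qed.

Lemma chi_phase_nice : exists A B L L' M : R, [/\ 0 < A, 0 < B, 0 <= L, 0 <= L' & 0 <= M /\
  forall q, nice A B (L + L' * `|q.1|) M (fun p => chi p * cis (- (2 * pi * dotp p q)))].
Proof.
have [A [L [M1 [A0 L0 M10 l1]]]] := test_fun_lip0 tf1.
have [B [M2 [B0 M20 m2 h2]]] := tf2_dom.
exists A, B, (L * M2), (M1 * (4 * pi) * M2), (M1 * M2); split => //.
- exact: mulr_ge0.
- by rewrite !mulr_ge0// pi_ge0.
split; first exact: mulr_ge0.
move=> q.
have h2' t : normc (f2 t * cis (- (2 * pi * (t * q.2)))) <= M2 * ind (- B) B t.
  by rewrite normcM normc_cis mulr1.
have m2' : cmeas (fun t : RL R => f2 t * cis (- (2 * pi * (t * q.2)))).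
  by apply: cmeasM m2 _; apply: cmeas_cis; exact: meas1_phaseN.
have := nice_tensor M10 M20 (lip0_phase q.1 M10 l1) m2' h2'.
have -> : (L + M1 * (4 * pi * `|q.1|)) * M2 = L * M2 + M1 * (4 * pi) * M2 * `|q.1|.
  by move: (pi : R) => c; ring.
congr nice; apply/funext => p; rewrite /chi /dotp.
have -> : - (2 * pi * (p.1 * q.1 + p.2 * q.2)) = - (2 * pi * (p.1 * q.1)) + - (2 * pi * (p.2 * q.2)).
  by move: (pi : R) => c; ring.
by rewrite cisD; move: (cis _) (cis _) => c d; ring.
Qed.

Lemma ft_inv_dom e : 0 < e -> exists b : R -> R, [/\ rint mu b,
  cmeas (fun x : RL R => (x +i* e)^-1 * f1 x) & forall x, normc ((x +i* e)^-1 * f1 x) <= b x].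
Proof.
move=> e0; have [A [L [M1 [A0 L0 M10 [mf fA _ fM]]]]] := test_fun_lip0 tf1.
exists (fun x => e^-1 * M1 * ind (- A) A x); split.
- exact/rintZ/rint_ind.
- by apply: cmeasM mf; exact: cmeas_inv_ieps.
- move=> x; rewrite normcM -mulrA; apply: ler_pM_normc.
    exact: normc_inv_e.
  rewrite indE; case: ifPn => [_|/negP/fA ->]; first by rewrite mulr1.
  by rewrite normc0 mulr0.
Qed.

Lemma Un_chi e q : 0 < e -> Un e (fun p => chi p * cis (- (2 * pi * dotp p q))) = se e q.
Proof.
move=> e0; have [b [ib mb hb]] := ft_inv_dom e0.
have [B [M2 [B0 M20 m2 h2]]] := tf2_dom.
rewrite /se /ft -(@cI_tensor R (fun x => (x +i* e)^-1 * f1 x * cis (- (2 * pi * (x * q.1))))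
   (fun x => f2 x * cis (- (2 * pi * (x * q.2)))) b (fun t => M2 * ind (- B) B t)).
- apply: eq_cI => p; rewrite /chi /dotp.
  have -> : - (2 * pi * (p.1 * q.1 + p.2 * q.2)) = - (2 * pi * (p.1 * q.1)) + - (2 * pi * (p.2 * q.2)).
    by move: (pi : R) => c; ring.
  by rewrite cisD; move: (cis _) (cis _) (_^-1) => c d k; ring.
- by apply: cmeasM mb _; apply: cmeas_cis; exact: meas1_phaseN.
- by apply: cmeasM m2 _; apply: cmeas_cis; exact: meas1_phaseN.
- exact: ib.
- exact/rintZ/rint_ind.
- by move=> x; rewrite normcM normc_cis mulr1.
- by move=> x; rewrite normcM normc_cis mulr1.
Qed.

Lemma se_cvg q : ccvg (fun n => se (epsn R n) q) (s0 q).
Proof.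
have [A [B [L [L' [M [A0 B0 L0 L'0 [M0 hn]]]]]]] := chi_phase_nice.
have L''0 : 0 <= L + L' * `|q.1| by rewrite addr_ge0// mulr_ge0.
have := Un_cvg A0 B0 L''0 M0 (hn q).
by under [X in ccvg X _]eq_fun do rewrite (Un_chi _ (epsn_gt0 R _)).
Qed.

Lemma cmeas_se e : 0 < e -> cmeas2 (se e).
Proof.
move=> e0; have [b [ib mb hb]] := ft_inv_dom e0.
have [B [M2 [B0 M20 m2 h2]]] := tf2_dom.
have c1 := cmeas_ft mb hb ib; have c2 := cmeas_ft m2 h2 (rintZ M2 (rint_ind _ _)).
by apply: cmeasM; [apply: (cmeas_comp c1); exact: measurable_fst|apply: (cmeas_comp c2); exact: measurable_snd].
Qed.

Lemma cmeas_s0 : cmeas2 s0.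
Proof.
apply: (@cmeas_lim _ _ _ (fun n => se (epsn R n))) => [n|q]; last exact: se_cvg.
exact: cmeas_se (epsn_gt0 R n).
Qed.

(** e occurs in the first factor only, where [negw_bound] is uniform; the second factor is rapidly
    decreasing in every direction. *)
Lemma se_bound N : exists C : R, 0 <= C /\ forall e q, 0 < e ->
  negw q.1 ^+ N * (1 + `|q.2|) ^+ N * normc (se e q) <= C * (1 + `|q.1|).
Proof.
have [C1 [C10 h1]] := negw_bound N tf1; have [C2 [C20 h2]] := ft_rapid N tf2.
exists (C1 * C2); split; first exact: mulr_ge0.
move=> e q e0; rewrite /se normcM.
have -> : negw q.1 ^+ N * (1 + `|q.2|) ^+ N * (normc (ft (fun x => (x +i* e)^-1 * f1 x) q.1) * normc (ft f2 q.2)) =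
  (negw q.1 ^+ N * normc (ft (fun x => (x +i* e)^-1 * f1 x) q.1)) * ((1 + `|q.2|) ^+ N * normc (ft f2 q.2)) by ring.
have n0 : 0 <= negw q.1 := ltW (negw_gt0 _).
apply: (@le_trans _ _ ((C1 * (1 + `|q.1|)) * C2)); last by rewrite mulrAC.
apply: ler_pM; [by rewrite mulr_ge0 ?normc_ge0// exprn_ge0|by rewrite mulr_ge0 ?normc_ge0// exprn_ge0// addr_ge0|exact: h1|exact: h2].
Qed.

Lemma s0_bound_of N C : (forall e q, 0 < e ->
  negw q.1 ^+ N * (1 + `|q.2|) ^+ N * normc (se e q) <= C * (1 + `|q.1|)) -> forall q,
  negw q.1 ^+ N * (1 + `|q.2|) ^+ N * normc (s0 q) <= C * (1 + `|q.1|).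
Proof.
move=> h q; have w0 : 0 < negw q.1 ^+ N * (1 + `|q.2|) ^+ N.
  by rewrite mulr_gt0// exprn_gt0// ?negw_gt0// ltr_pwDl.
rewrite mulrC -ler_pdivlMr//; apply: (ccvg_le (se_cvg q)) => n.
by rewrite ler_pdivlMr// mulrC; apply: h; exact: epsn_gt0.
Qed.

Lemma se_bound0 : exists C : R, 0 <= C /\ (forall e q, 0 < e -> normc (se e q) <= C * (1 + `|q.1|)) /\
  (forall q, normc (s0 q) <= C * (1 + `|q.1|)).
Proof.
have [C [C0 h]] := se_bound 0; exists C; split => //; split => [e q e0|q].
  by have := h e q e0; rewrite !expr0 !mul1r.
by have := s0_bound_of h q; rewrite !expr0 !mul1r.
Qed.

Lemma chi_FT_nice c K phi : 0 <= K -> adm K phi -> exists A B L M : R,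
  [/\ 0 < A, 0 < B, 0 <= L, 0 <= M & nice A B L M (fun p => chi p * FT c phi p)].
Proof.
move=> K0 ap; have [A [L [M1 [A0 L0 M10 l1]]]] := test_fun_lip0 tf1.
have [B [M2 [B0 M20 m2 h2]]] := tf2_dom.
have n1 := nice_tensor M10 M20 l1 m2 h2.
have pw q := adm_le q ap; have ir := adm_rint K.
have [mp _] := ap.
have n2 := nice_mul n1 (mulr_ge0 M10 M20) (cmeas_FT c mp pw ir)
  (fun z => FT_bound c z mp pw ir) (fun x t => FT_lipschitz c x t ap).
have W0 := W2_ge0 R.
exists A, B; eexists; eexists; split; [exact: A0|exact: B0| | |exact: n2].
- rewrite int_Kw2 addr_ge0 ?mulr_ge0//.
- by rewrite int_Kw2 !mulr_ge0.
Qed.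

Lemma cmeas_chi : cmeas2 chi.
Proof.
by apply: cmeasM; [apply: (cmeas_comp (test_fun_cmeas tf1)); exact: measurable_fst|apply: (cmeas_comp (test_fun_cmeas tf2)); exact: measurable_snd].
Qed.

Lemma chi_dom : exists A B M : R, 0 <= M /\ forall p, normc (chi p) <= M * ind2 A B p.
Proof.
have [A [L [M1 [A0 L0 M10 l1]]]] := test_fun_lip0 tf1.
have [B [M2 [B0 M20 m2 h2]]] := tf2_dom.
have [_ h _] := nice_tensor M10 M20 l1 m2 h2.
by exists A, B, (M1 * M2); split; first exact: mulr_ge0.
Qed.

(** The multiplication formula, which moves the Fourier transform from phi to the localised kernel:
    Fubini applied to the compactly supported kernel times the integrable phi. *)
Lemma Un_FT e K phi : 0 < e -> adm K phi ->
  Un e (fun p => chi p * FT (- (2 * pi)) phi p) = cI nu (fun q => se e q * phi q).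
Proof.
move=> e0 ap; have [A [B [M [M0 hM]]]] := chi_dom.
have pw q := adm_le q ap; have ir := adm_rint K; have [mp _] := ap.
have ia : rint nu (fun z : T2 => e^-1 * M * ind2 A B z) by exact/rintZ/rint_ind2.
pose v p := (p.1 +i* e)^-1 * chi p.
have mv : cmeas2 v by apply: cmeasM; [exact: cmeas_inv2|exact: cmeas_chi].
have hv z : normc (v z) <= e^-1 * M * ind2 A B z.
  by rewrite normcM -mulrA; apply: ler_pM_normc; [exact: normc_inv_e|exact: hM].
pose F (p : T2 * T2) := v p.1 * (cis (- (2 * pi) * dotp p.2 p.1) * phi p.2).
have mF : cmeas F.
  apply: cmeasM; first by apply: (cmeas_comp mv); exact: measurable_fst.
  apply: cmeasM; first by apply: cmeas_cis; exact: meas_dotp.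
  by apply: (cmeas_comp mp); exact: measurable_snd.
have hF z q : normc (F (z, q)) <= e^-1 * M * ind2 A B z * (K * w2 q).
  rewrite /F/= normcM [X in _ * X]normcM normc_cis mul1r.
  by apply: ler_pM_normc; [exact: hv|exact: pw].
have sw := cI_swap ia ir mF hF.
transitivity (cI nu (fun z => cI nu (fun q => F (z, q)))).
  apply: eq_cI => z; rewrite /F/= (cI_Z (m := nu) (v z)); last exact: cint_phase mp pw ir.
  by rewrite /v -[RHS]mulrA.
rewrite sw; apply: eq_cI => q; rewrite -(Un_chi q e0) /Un mulrC.
rewrite -(cI_Z (m := nu) (phi q)).
  apply: eq_cI => z; rewrite /F/= /v mulNr dotpC.
  by move: (cis _) (_^-1) => c k; ring.
apply: (@cint_dom _ _ _ nu _ (fun z : T2 => e^-1 * M * ind2 A B z)); last exact: ia.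
  apply: cmeasM; first exact: cmeas_inv2.
  apply: cmeasM; first exact: cmeas_chi.
  apply: cmeas_cis; rewrite (_ : (fun z => _) = (fun z : T2 => - (2 * pi) * dotp z q)).
    exact: meas_dotp1.
  by apply/funext => z; rewrite mulNr.
by move=> z; rewrite mulrA normcM normc_cis mulr1; exact: hv.
Qed.

(** Identifies the Fourier transform of the localised distribution with the function [s0]. In the
    limit of [Un_FT], the linear growth of the spectra is absorbed by the factor 1 + |q.1| built
    into [adm]. *)
Lemma u0t_FT K phi : 0 <= K -> adm K phi ->
  u0t (fun p => chi p * FT (- (2 * pi)) phi p) = cI nu (fun q => s0 q * phi q).
Proof.
move=> K0 ap; have [A [B [L [M [A0 B0 L0 M0 hn]]]]] := chi_FT_nice (- (2 * pi)) K0 ap.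
have [C [C0 [hse hs0]]] := se_bound0; have [mp hp] := ap.
have c1 := Un_cvg A0 B0 L0 M0 hn.
apply: (ccvg_unique c1).
under [X in ccvg X _]eq_fun do rewrite (Un_FT (epsn_gt0 R _) ap).
apply: (@cI_dct _ _ _ nu _ _ (fun q : T2 => C * (K * w2 q))).
- by move=> n; apply: cmeasM mp; apply: cmeas_se; exact: epsn_gt0.
- by move=> q; apply: ccvgM; [exact: se_cvg|exact: ccvg_cst].
- move=> n q; rewrite normcM.
  apply: (le_trans (ler_wpM2r (normc_ge0 _) (hse _ _ (epsn_gt0 R n)))).
  by rewrite -mulrA ler_wpM2l.
- exact/rintZ/adm_rint.
Qed.

End Cutoff.

(** * Convolution of spectra *)

Section Convolution.
Variable R : realType.
Notation mu := (@mu1 R).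
Notation nu := (@mu2 R).
Notation R2 := (R * R)%type.
Notation T2 := (RL R * RL R)%type.
Implicit Types (phi psi : R2 -> R[i]) (p q z : R2).

Lemma norm_fst p : `|p.1| <= `|p|.
Proof. by rewrite prod_normE le_max lexx. Qed.

Lemma norm_snd p : `|p.2| <= `|p|.
Proof. by rewrite prod_normE le_max lexx orbT. Qed.

Lemma w2V p : (w2 p)^-1 = (1 + p.1 ^+ 2) * (1 + p.2 ^+ 2).
Proof. by rewrite /w2 /w1 -invfM invrK. Qed.

Lemma oneDsq_le (x y : R) : `|x| <= y -> 1 + x ^+ 2 <= (1 + y) ^+ 2.
Proof.
move=> xy; have x0 := normr_ge0 x; rewrite -[x ^+ 2]real_normK ?num_real//.
nra.
Qed.

Lemma w2V_le p : (w2 p)^-1 <= (1 + `|p|) ^+ 4.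
Proof.
rewrite w2V (_ : 4 = 2 + 2)%N// exprD; apply: ler_pM.
- by rewrite addr_ge0// sqr_ge0.
- by rewrite addr_ge0// sqr_ge0.
- exact/oneDsq_le/norm_fst.
- exact/oneDsq_le/norm_snd.
Qed.

Lemma le_w2 p (c C : R) : c * (w2 p)^-1 <= C -> c <= C * w2 p.
Proof. by rewrite ler_pdivrMr// w2_gt0. Qed.

(** 5 = 1 + 4: one power for the factor 1 + |q.1|, and four for 1/w2, two per coordinate. *)
Lemma adm_of K psi : cmeas2 psi -> (forall q, (1 + `|q|) ^+ 5 * normc (psi q) <= K) ->
  adm K psi.
Proof.
move=> mp h; split => // q; apply: le_w2; apply: le_trans (h q).
rewrite mulrAC exprS; apply: ler_wpM2r; first exact: normc_ge0.
apply: ler_pM.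
- by rewrite addr_ge0.
- by rewrite invr_ge0 ltW// w2_gt0.
- by rewrite lerD2l norm_fst.
- exact: w2V_le.
Qed.

Lemma adm_lin (a : R[i]) K K' phi psi : adm K phi -> adm K' psi ->
  adm (normc a * K + K') (fun q => a * phi q + psi q).
Proof.
move=> [m1 h1] [m2 h2]; split.
  by apply: cmeasD m2; apply: cmeasM m1; exact: cmeas_cst.
move=> q; have q0 : 0 <= 1 + `|q.1| by rewrite addr_ge0.
apply: (le_trans (ler_wpM2l q0 (normcD_le _ _))).
rewrite normcM mulrDr [leRHS]mulrDl; apply: lerD; last exact: h2.
by rewrite mulrCA -mulrA; apply: ler_wpM2l; [exact: normc_ge0|exact: h1].
Qed.

(** Order 6 is what [conv_est] consumes: three powers for each of the two frequencies. *)
Definition decay (M : R) phi :=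
  cmeas2 phi /\ forall z, (1 + `|z|) ^+ 6 * normc (phi z) <= M.

Lemma decay_ge0 M phi : decay M phi -> 0 <= M.
Proof.
move=> [_ /(_ 0)]; apply: le_trans.
by rewrite mulr_ge0 ?normc_ge0// exprn_ge0// addr_ge0.
Qed.

Lemma schwartz_cmeas phi : schwartz phi -> cmeas2 phi.
Proof.
move=> [sp _]; have [c1 c2] := smooth_continuous sp.
by split; apply: continuous_meas2.
Qed.

Lemma seminorm_le0 k m phi (M : R) p : seminorm_le k m phi M -> (1 + `|p|) ^+ k * normc (phi p) <= M.
Proof. by move=> /(_ [::] p (leq0n _) isT). Qed.

Lemma schwartz_decay phi : schwartz phi -> exists M, decay M phi.
Proof.
move=> sp; have [_ /(_ 6 0)[M hM]] := sp; exists M.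
by split; [exact: schwartz_cmeas|move=> z; exact: seminorm_le0 hM].
Qed.

Lemma seminorm_adm phi (M : R) : schwartz phi -> seminorm_le 5 0 phi M -> adm M phi.
Proof.
by move=> sp h; apply: adm_of; [exact: schwartz_cmeas|move=> q; exact: seminorm_le0 h].
Qed.

Lemma adm_ge0 M phi : adm M phi -> 0 <= M.
Proof.
move=> ap; have := adm_le 0 ap.
move=> /(le_trans (normc_ge0 _)); rewrite pmulr_lge0//; exact: w2_gt0.
Qed.

Lemma meas_shift p : measurable_fun setT (fun q : T2 => p + q : T2).
Proof.
apply/measurable_fun_pairP; split => /=.
  by apply: measurable_funD; [exact: measurable_cst|exact: measurable_fst].
by apply: measurable_funD; [exact: measurable_cst|exact: measurable_snd].
Qed.

(** Rests on 1 + |q| <= (1 + |p + q|) (1 + |p|): translating by p costs a power of 1 + |p|. *)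
Lemma shift_adm M phi p : decay M phi -> adm (M * (1 + `|p|) ^+ 5) (fun q => phi (p + q)).
Proof.
move=> dp; have M0 := decay_ge0 dp; have [mp hp] := dp.
apply: adm_of; first by apply: (cmeas_comp mp); exact: meas_shift.
move=> q; have h : 1 + `|q| <= (1 + `|p + q|) * (1 + `|p|).
  have t : `|q| <= `|p + q| + `|p|.
    by rewrite {1}(_ : q = (p + q) - p) ?ler_normB// addrC addKr.
  by have := normr_ge0 p; have := normr_ge0 (p + q); nra.
have h1 : (1 + `|q|) ^+ 5 <= (1 + `|p + q|) ^+ 6 * (1 + `|p|) ^+ 5.
  apply: (@le_trans _ _ (((1 + `|p + q|) * (1 + `|p|)) ^+ 5)).
    by rewrite lerXn2r// ?nnegrE ?mulr_ge0 ?addr_ge0.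
  rewrite exprMn; apply: ler_wpM2r; first by rewrite exprn_ge0// addr_ge0.
  by rewrite exprS ler_peMl ?exprn_ge0 ?addr_ge0// lerDl.
apply: (le_trans (ler_wpM2r (normc_ge0 _) h1)).
rewrite mulrAC; apply: ler_wpM2r; last exact: hp.
by rewrite exprn_ge0// addr_ge0.
Qed.

(** If x < 0, the weight of x already contains 1 + |x|. If x and y are both nonnegative, |x| <= |x +
    y|. If y < 0 <= x, then |x| <= |x + y| + |y| and the weight of y contains 1 + |y|. Cancellation
    in x + y is thus always paid for by the negative member. *)
Lemma negw_ineq (x y : R) : 1 + `|x| <= negw x * negw y * (1 + `|x + y|).
Proof.
have hx : negw x = if 0 <= x then 1 else 1 + `|x|.
  rewrite /negw; case: (lerP 0 x) => x0; first by rewrite max_l ?addr0// oppr_le0.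
  by rewrite ltr0_norm// max_r// oppr_ge0 ltW.
have hy : negw y = if 0 <= y then 1 else 1 + `|y|.
  rewrite /negw; case: (lerP 0 y) => x0; first by rewrite max_l ?addr0// oppr_le0.
  by rewrite ltr0_norm// max_r// oppr_ge0 ltW.
have n0 := normr_ge0 (x + y); have y0 := normr_ge0 y; have x0 := normr_ge0 x.
rewrite hx hy; case: (lerP 0 x) => xs; case: (lerP 0 y) => ys.
- by rewrite !mul1r lerD2l !ger0_norm ?addr_ge0// lerDl.
- have := ler_normB (x + y) y; rewrite addrK mul1r; nra.
- rewrite mulr1; nra.
- have : 0 <= `|y| * (1 + `|x + y|) * (1 + `|x|) by rewrite !mulr_ge0// addr_ge0.
  nra.
Qed.

(* On the support of the two spectra, both frequencies are controlled by their
   sum: this is where the wave front set condition enters. *)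
Lemma conv_est (C M al be ga : R) p q : 0 <= al -> 0 <= be -> 0 <= ga -> 0 <= C -> 0 <= M ->
  negw p.1 ^+ 6 * (1 + `|p.2|) ^+ 6 * al <= C * (1 + `|p.1|) ->
  negw q.1 ^+ 6 * (1 + `|q.2|) ^+ 6 * be <= C * (1 + `|q.1|) ->
  (1 + `|p.1 + q.1|) ^+ 6 * ga <= M ->
  al * be * ga <= C ^+ 2 * M * w2 p * w2 q.
Proof.
move=> al0 be0 ga0 C0 M0 hp hq hz.
have ge1 (x : R) : 1 <= 1 + `|x| by rewrite lerDl.
have pos (x : R) : 0 < 1 + `|x| := lt_le_trans ltr01 (ge1 x).
set X := 1 + `|p.1|; set Y := 1 + `|q.1|.
have X0 : 0 < X := pos _. have Y0 : 0 < Y := pos _.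
set P := negw p.1 * negw q.1 * (1 + `|p.1 + q.1|).
have P0 : 0 < P by rewrite /P !mulr_gt0// negw_gt0.
have XP : X <= P := negw_ineq _ _.
have YP : Y <= P.
  by have := negw_ineq q.1 p.1; rewrite [negw q.1 * _]mulrC [q.1 + _]addrC.
(* By [negw_ineq] both X and Y are at most P. Of the three powers gained for each variable, one
   absorbs the growth of its spectrum and two give integrability in its first coordinate. *)
have h1 : X ^+ 3 * Y ^+ 3 <= P ^+ 6.
  rewrite (_ : 6 = 3 + 3)%N// exprD; apply: ler_pM; rewrite ?exprn_ge0 ?(ltW X0) ?(ltW Y0)//.
    by rewrite lerXn2r// ?nnegrE ?(ltW X0) ?(ltW P0).
  by rewrite lerXn2r// ?nnegrE ?(ltW Y0) ?(ltW P0).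
set X2 := 1 + `|p.2|; set Y2 := 1 + `|q.2|.
have X20 : 0 < X2 := pos _. have Y20 : 0 < Y2 := pos _.
have h2 : X2 ^+ 2 <= X2 ^+ 6 by apply: ler_weXn2l => //; exact: ge1.
have h3 : Y2 ^+ 2 <= Y2 ^+ 6 by apply: ler_weXn2l => //; exact: ge1.
have big : P ^+ 6 * (X2 ^+ 6 * Y2 ^+ 6) * (al * be * ga) <= C ^+ 2 * M * (X * Y).
  have -> : P ^+ 6 * (X2 ^+ 6 * Y2 ^+ 6) * (al * be * ga) =
    (negw p.1 ^+ 6 * X2 ^+ 6 * al) * (negw q.1 ^+ 6 * Y2 ^+ 6 * be) * ((1 + `|p.1 + q.1|) ^+ 6 * ga).
    by rewrite /P; move: (negw p.1) (negw q.1) (1 + `|p.1 + q.1|) => a b c; ring.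
  have -> : C ^+ 2 * M * (X * Y) = (C * X) * (C * Y) * M by ring.
  have n6 x : 0 <= negw x ^+ 6 by rewrite exprn_ge0// ltW// negw_gt0.
  have x6 : 0 <= X2 ^+ 6 by rewrite exprn_ge0// ltW.
  have y6 : 0 <= Y2 ^+ 6 by rewrite exprn_ge0// ltW.
  have z6 : 0 <= (1 + `|p.1 + q.1|) ^+ 6 by rewrite exprn_ge0// ltW.
  have g1 : 0 <= negw p.1 ^+ 6 * X2 ^+ 6  * al by apply: mulr_ge0 al0; apply: mulr_ge0 x6; exact: n6.
  have g2 : 0 <= negw q.1 ^+ 6 * Y2 ^+ 6 * be by apply: mulr_ge0 be0; apply: mulr_ge0 y6; exact: n6.
  apply: ler_pM; [exact: mulr_ge0|exact: mulr_ge0| |exact: hz].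
  by apply: ler_pM; [exact: g1|exact: g2|exact: hp|exact: hq].
have a0 : 0 <= al * be * ga by rewrite !mulr_ge0.
have small : X ^+ 2 * Y ^+ 2 * (X2 ^+ 2 * Y2 ^+ 2) * (al * be * ga) <= C ^+ 2 * M.
  rewrite -(ler_pM2r (mulr_gt0 X0 Y0)); apply: le_trans big.
  have -> : X ^+ 2 * Y ^+ 2 * (X2 ^+ 2 * Y2 ^+ 2) * (al * be * ga) * (X * Y) =
    X ^+ 3 * Y ^+ 3 * (X2 ^+ 2 * Y2 ^+ 2) * (al * be * ga) by ring.
  apply: ler_wpM2r => //; apply: ler_pM => //.
  - by rewrite mulr_ge0// exprn_ge0// ltW.
  - by rewrite mulr_ge0// exprn_ge0// ltW.
  - by apply: ler_pM => //; rewrite exprn_ge0// ltW.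
apply: le_w2; apply: le_w2; apply: le_trans small; rewrite !w2V -mulrA mulrC.
apply: ler_wpM2r => //.
have sq (x : R) : 1 + x ^+ 2 <= (1 + `|x|) ^+ 2 by apply: oneDsq_le.
have sq0 (x : R) : 0 <= 1 + x ^+ 2 by rewrite addr_ge0// sqr_ge0.
have -> : X ^+ 2 * Y ^+ 2 * (X2 ^+ 2 * Y2 ^+ 2) = Y ^+ 2 * Y2 ^+ 2 * (X ^+ 2 * X2 ^+ 2) by ring.
by apply: ler_pM; [exact: mulr_ge0|exact: mulr_ge0|apply: ler_pM|apply: ler_pM].
Qed.

End Convolution.

(** * Absolute convergence of the double integral of two spectra *)

Section Kernel.
Variable R : realType.
Notation mu := (@mu1 R).
Notation nu := (@mu2 R).
Notation R2 := (R * R)%type.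
Notation T2 := (RL R * RL R)%type.
Implicit Types (phi psi s : R2 -> R[i]) (p q z : R2).

(** Decay in the first coordinate alone: in the second one the spectra decay by themselves. For the
    transform of a test function it follows from integrations by parts in x only. *)
Definition xdecay (M : R) phi :=
  cmeas2 phi /\ forall z, (1 + `|z.1|) ^+ 6 * normc (phi z) <= M.

Lemma decay_xdecay M phi : decay M phi -> xdecay M phi.
Proof.
move=> [mp hp]; split => // z; apply: le_trans (hp z).
apply: ler_wpM2r; first exact: normc_ge0.
by rewrite lerXn2r// ?nnegrE ?addr_ge0// lerD2l norm_fst.
Qed.

Lemma xdecay_ge0 M phi : xdecay M phi -> 0 <= M.
Proof.
move=> [_ /(_ 0)]; apply: le_trans.
by rewrite mulr_ge0 ?normc_ge0// exprn_ge0// addr_ge0.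
Qed.

Definition spectral C s := forall q,
  negw q.1 ^+ 6 * (1 + `|q.2|) ^+ 6 * normc (s q) <= C * (1 + `|q.1|).

Definition kern s psi (p : T2 * T2) : R[i] := s p.1 * s p.2 * psi (p.1 + p.2).

Lemma meas_addT : measurable_fun setT (fun p : T2 * T2 => p.1 + p.2 : T2).
Proof.
have [m11 m12 m21 m22] := meas_coords R.
apply/measurable_fun_pairP; split => /=.
  exact: (measurable_funD m11 m21).
exact: (measurable_funD m12 m22).
Qed.

Lemma cmeas_kern s psi : cmeas2 s -> cmeas2 psi -> cmeas (kern s psi).
Proof.
move=> ms mp; apply: cmeasM; last by apply: (cmeas_comp mp); exact: meas_addT.
by apply: cmeasM; [apply: (cmeas_comp ms); exact: measurable_fst|apply: (cmeas_comp ms); exact: measurable_snd].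
Qed.

Lemma kern_le s psi C M p q : 0 <= C -> spectral C s -> xdecay M psi ->
  normc (kern s psi (p, q)) <= C ^+ 2 * M * w2 p * w2 q.
Proof.
move=> C0 hs hp; have M0 := xdecay_ge0 hp; rewrite /kern !normcM.
apply: conv_est => //; try exact: normc_ge0; try exact: hs.
by have [_ h] := hp; exact: h (p + q).
Qed.

Definition conv2 s psi : R[i] := cI nu (fun p => cI nu (fun q => kern s psi (p, q))).

Lemma cmeas_section s psi p : cmeas2 s -> cmeas2 psi ->
  cmeas (fun q : T2 => kern s psi (p, q)).
Proof.
move=> ms mp; rewrite /kern/=; apply: cmeasM; last by apply: (cmeas_comp mp); exact: meas_shift.
by apply: cmeasM; [exact: cmeas_cst|exact: ms].
Qed.

Lemma kern_int_le s psi C M p : 0 <= C -> cmeas2 s -> spectral C s -> xdecay M psi ->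
  normc (cI nu (fun q => kern s psi (p, q))) <= 2 * C ^+ 2 * M * W2 R * w2 p.
Proof.
move=> C0 ms hs hp; have [mp _] := hp.
apply: (le_trans (cI_le (cmeas_section p ms mp) (fun q => kern_le p q C0 hs hp) (adm_rint _))).
by rewrite int_Kw2; apply: eqW; ring.
Qed.

Lemma cmeas_kern_int s psi C M : 0 <= C -> cmeas2 s -> spectral C s -> xdecay M psi ->
  cmeas2 (fun p => cI nu (fun q => kern s psi (p, q))).
Proof.
move=> C0 ms hs hp; have [mp _] := hp.
have h := @cmeas_section1 _ _ _ _ _ nu nu _ _ (adm_rint (C ^+ 2 * M)) (@rint_w2 R) _
  (cmeas_kern ms mp) (fun p q => kern_le p q C0 hs hp).
exact: h.
Qed.

(** The bound [kern_le] depends on the spectra only through C, so the inner and then the outer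
    integral are dominated uniformly in n. *)
Lemma conv2_cvg (sn : nat -> R2 -> R[i]) s psi C M : 0 <= C ->
  (forall n, cmeas2 (sn n)) -> (forall n, spectral C (sn n)) ->
  (forall q, ccvg (fun n => sn n q) (s q)) -> xdecay M psi ->
  ccvg (fun n => conv2 (sn n) psi) (conv2 s psi).
Proof.
move=> C0 ms hs hc hp; have [mp _] := hp.
apply: (cI_dct (g := fun p : T2 => 2 * C ^+ 2 * M * W2 R * w2 p)).
- by move=> n; exact: cmeas_kern_int C0 (ms n) (hs n) hp.
- move=> p; apply: (cI_dct (g := fun q : T2 => C ^+ 2 * M * w2 p * w2 q)).
  + by move=> n; exact: cmeas_section.
  + by move=> q; apply: ccvgM; [apply: ccvgM; exact: hc|exact: ccvg_cst].
  + by move=> n q; exact: kern_le.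
  + exact: adm_rint.
- by move=> n p; exact: kern_int_le.
- exact: adm_rint.
Qed.

End Kernel.

(** * Existence of the S'-convolution *)

Section Convolvable.
Variable R : realType.
Notation nu := (@mu2 R).
Notation R2 := (R * R)%type.
Notation T2 := (RL R * RL R)%type.
Implicit Types (phi psi : R2 -> R[i]) (p q z : R2).
Variables (f1 f2 : R -> R[i]).
Hypotheses (tf1 : test_fun setT f1) (tf2 : test_fun setT f2).
Notation s := (s0 f1 f2).
Notation S := (fourier_distr (smul (chi f1 f2) (tensor1 (@inv_x_i0 R)))).

Lemma distrE K phi : adm K phi -> S phi = cI nu (fun q => s q * phi q).
Proof.
move=> ap; rewrite /fourier_distr /smul fourierE.
exact: (u0t_FT tf1 tf2 (adm_ge0 ap) ap).
Qed.

(** The growth 1 + |q.1| of the spectrum meets the same factor in [adm], which leaves a multiple of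
    w2. *)
Lemma s_dom : exists C : R, 0 <= C /\ forall K phi, adm K phi ->
  cmeas2 (fun q => s q * phi q) /\ forall q, normc (s q * phi q) <= C * K * w2 q.
Proof.
have [C [C0 [_ hs0]]] := se_bound0 tf1 tf2; exists C; split => // K phi [mp hp]; split.
  by apply: cmeasM mp; exact: cmeas_s0.
move=> q; rewrite normcM; apply: (le_trans (ler_wpM2r (normc_ge0 _) (hs0 q))).
by rewrite -!mulrA; apply: ler_wpM2l.
Qed.

Lemma schwartz_adm phi : schwartz phi -> exists K, adm K phi.
Proof. by move=> sp; have [_ /(_ 5 0)[M hM]] := sp; exists M; exact: seminorm_adm. Qed.

Lemma distr_lin K K' (a : R[i]) phi psi : adm K phi -> adm K' psi ->
  S (fun q => a * phi q + psi q) = a * S phi + S psi.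
Proof.
move=> ap aq; have [C [C0 hC]] := s_dom.
have [m1 h1] := hC _ _ ap; have [m2 h2] := hC _ _ aq.
rewrite (distrE ap) (distrE aq) (distrE (adm_lin a ap aq)).
have i1 := cint_dom m1 h1 (adm_rint (C * K)).
have i2 := cint_dom m2 h2 (adm_rint (C * K')).
rewrite -(cI_lin a i1 i2); apply: eq_cI => q; ring.
Qed.

Lemma distr_tempered : tempered S.
Proof.
have [C [C0 hC]] := s_dom; split.
  move=> a f g sf sg; have [K ak] := schwartz_adm sf; have [K' ak'] := schwartz_adm sg.
  exact: distr_lin ak ak'.
exists 5, 0%N, (2 * C * W2 R) => f sf M /(seminorm_adm sf) ak.
have [m h] := hC _ _ ak; rewrite (distrE ak).
apply: (le_trans (cI_le m h (adm_rint (C * M)))).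
by rewrite int_Kw2; apply: eqW; ring.
Qed.

Definition sconv phi p : R[i] := cI nu (fun q => s q * phi (p + q)).

Lemma conv_reflectE M phi p : decay M phi -> conv_reflect phi S p = sconv phi p.
Proof. by move=> dp; rewrite /conv_reflect (distrE (shift_adm p dp)). Qed.

Lemma kern_intE M phi p : decay M phi ->
  cI nu (fun q => kern s phi (p, q)) = s p * sconv phi p.
Proof.
move=> dp; have [C [C0 hC]] := s_dom; have [m h] := hC _ _ (shift_adm p dp).
rewrite /sconv -(cI_Z (m := nu) (s p)); last exact: cint_dom m h (adm_rint _).
by apply: eq_cI => q; rewrite /kern/= mulrA.
Qed.

Lemma spectral_s0 : exists C : R, [/\ 0 <= C, spectral C s &
  forall e, 0 < e -> spectral C (se f1 f2 e)].
Proof.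
have [C [C0 h]] := se_bound tf1 tf2 6; exists C; split => //.
  exact: s0_bound_of h.
by move=> e e0 q; exact: h.
Qed.

(** Makes [distrE] applicable to the product of phi * S^vee and a test function f. The constant of
    [shift_adm] grows like (1 + |p|)^5, but only points with |p| <= A count since f vanishes
    elsewhere. *)
Lemma mult_adm M phi f : decay M phi -> test_fun setT f ->
  exists K, adm K (fun p => sconv phi p * f p).
Proof.
move=> dp tf; have [mp hp] := dp; have M0 := decay_ge0 dp.
have [C [C0 hC]] := s_dom.
have [A [A0 fA]] := bounded_supp tf; have [Mf [Mf0 fM]] := test_fun_bounded tf.
have mf : cmeas2 f.
  have [sf _ _] := tf; have [c1 c2] := smooth_continuous sf.
  by split; apply: continuous_meas2.
pose KA := C * (M * (1 + A) ^+ 5).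
have A5 : 0 <= (1 + A) ^+ 5 by rewrite exprn_ge0// addr_ge0// ltW.
have KA0 : 0 <= KA := mulr_ge0 C0 (mulr_ge0 M0 A5).
have hs p : `|p| <= A -> forall q, normc (s q * phi (p + q)) <= KA * w2 q.
  move=> pA q; have [_ h] := hC _ _ (shift_adm p dp).
  apply: (le_trans (h q)); apply: ler_wpM2r; first exact/ltW/w2_gt0.
  rewrite /KA; apply: ler_wpM2l => //; apply: ler_wpM2l => //.
  by rewrite lerXn2r// ?nnegrE ?addr_ge0 ?(ltW A0)// lerD2l.
pose F (p : T2 * T2) := f p.1 * (s p.2 * phi (p.1 + p.2)).
have mF : cmeas F.
  apply: cmeasM; first by apply: (cmeas_comp mf); exact: measurable_fst.
  apply: cmeasM; last by apply: (cmeas_comp mp); exact: meas_addT.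
  by apply: (cmeas_comp (cmeas_s0 tf1 tf2)); exact: measurable_snd.
have hF p q : normc (F (p, q)) <= Mf * KA * w2 q.
  rewrite /F/= normcM; have [pA|pA] := boolP (`|p| <= A).
    by rewrite -mulrA; apply: ler_pM_normc; [exact: fM|exact: hs].
  rewrite fA; last exact/negP.
  by rewrite normc0 mul0r; exact: mulr_ge0 (mulr_ge0 Mf0 KA0) (ltW (w2_gt0 q)).
have hm := @cmeas_param _ _ _ _ _ nu nu F (@w2 R) _ (@rint_w2 R) (@w2_gt0 R) (@w2V_meas R) (adm_rint (Mf * KA)) mF hF.
have int p : cintegrable nu (fun q => s q * phi (p + q)).
  have [m h] := hC _ _ (shift_adm p dp); exact: cint_dom m h (adm_rint _).
have eF : (fun p => sconv phi p * f p) = (fun p => cI nu (fun q => F (p, q))).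
  by apply/funext => p; rewrite /sconv mulrC -(cI_Z (m := nu) (f p)).
exists ((1 + A) ^+ 5 * (2 * (KA * W2 R) * Mf)); apply: adm_of.
  by rewrite eF; exact: hm.
move=> p; have [pA|pA] := boolP (`|p| <= A).
  apply: ler_pM; [by rewrite exprn_ge0// addr_ge0|exact: normc_ge0| |].
    by rewrite lerXn2r// ?nnegrE ?addr_ge0 ?(ltW A0)// lerD2l.
  rewrite normcM; apply: ler_pM_normc; [ |exact: fM].
  have [m _] := hC _ _ (shift_adm p dp).
  by rewrite -int_Kw2; apply: (cI_le m (hs p pA)); exact: adm_rint.
rewrite fA; last exact/negP.
rewrite mulr0 normc0 mulr0; apply: mulr_ge0 => //; apply: mulr_ge0 => //.
by apply: mulr_ge0 => //; exact: mulr_ge0 (W2_ge0 R).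
Qed.

Lemma smulE M phi f : decay M phi -> test_fun setT f ->
  smul (conv_reflect phi S) S f = cI nu (fun p => cI nu (fun q => kern s phi (p, q)) * f p).
Proof.
move=> dp tf; have [K ak] := mult_adm dp tf.
have e : (fun p => conv_reflect phi S p * f p) = (fun p => sconv phi p * f p).
  by apply/funext => p; rewrite (conv_reflectE _ dp).
rewrite -[LHS]/(S (fun p => conv_reflect phi S p * f p)) e (distrE ak).
by apply: eq_cI => p; rewrite (kern_intE _ dp) mulrA.
Qed.

(** Integrating the kernel in q leaves a function H of p dominated by K w2. The product to be tested
    is therefore an integrable function: it satisfies the bound of [DL1] with no derivative, and its
    pairing with 1 is its integral, by dominated convergence along any approximate unit. *)
Lemma distr_Sconvolution : Sconvolution S S (conv2 s).
Proof.
split; [exact: distr_tempered|exact: distr_tempered|].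
move=> phi sp; have [M dp] := schwartz_decay sp; have xp := decay_xdecay dp.
have [C [C0 hs _]] := spectral_s0; have ms := cmeas_s0 tf1 tf2.
have mH := cmeas_kern_int C0 ms hs xp.
have hH p := kern_int_le p C0 ms hs xp.
set H := fun p => cI nu (fun q => kern s phi (p, q)) in mH hH *.
set K := 2 * C ^+ 2 * M * W2 R in hH.
have mHf f : test_fun setT f -> cmeas2 (fun p => H p * f p).
  move=> [sf _ _]; have [c1 c2] := smooth_continuous sf.
  by apply: cmeasM mH _; split; apply: continuous_meas2.
have hHf f (N : R) : (forall p, normc (f p) <= N) -> forall p, normc (H p * f p) <= K * N * w2 p.
  move=> fN p; rewrite normcM mulrAC.
  by apply: ler_pM_normc; [exact: hH|exact: fN].
have sn0 f (N : R) : seminorm_le 0 0 f N -> forall p, normc (f p) <= N.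
  by move=> h p; have := seminorm_le0 p h; rewrite expr0 mul1r.
have sn m f (N : R) : seminorm_le 0 m f N -> forall p, normc (f p) <= N.
  by move=> h p; have := seminorm_le0 p h; rewrite expr0 mul1r.
split; first split.
- move=> a f g tf tg.
  have [Nf [Nf0 hf]] := test_fun_bounded tf; have [Ng [Ng0 hg]] := test_fun_bounded tg.
  have [K1 ak1] := mult_adm dp tf; have [K2 ak2] := mult_adm dp tg.
  have e h : smul (conv_reflect phi S) S h = S (fun p => sconv phi p * h p).
    rewrite -[LHS]/(S (fun p => conv_reflect phi S p * h p)).
    by congr (S _); apply/funext => p; rewrite (conv_reflectE _ dp).
  rewrite !e -(distr_lin a ak1 ak2); congr (S _).
  by apply/funext => p; rewrite mulrDr mulrCA.
- exists 0%N, (2 * K * W2 R) => f tf N /sn hN.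
  rewrite (smulE dp tf); apply: (le_trans (cI_le (mHf f tf) (hHf f N hN) (adm_rint _))).
  by rewrite int_Kw2; apply: eqW; ring.
- move=> eta [te be ce]; have [N hN] := be 0%N.
  have -> : (fun k => normc (smul (conv_reflect phi S) S (eta k) - conv2 s phi)) =
      (fun k => normc (cI nu (fun p => H p * eta k p) - conv2 s phi)).
    by apply/funext => k; rewrite (smulE dp (te k)).
  apply: (cI_dct (g := fun p : T2 => K * N * w2 p)).
  + by move=> k; exact: mHf.
  + move=> p; apply: (@cvg_trans _ ((fun=> (0 : R)) @ \oo)); last exact: cvg_cst.
    (* Pointwise convergence: the third property of an approximate unit is used on the compact set
       reduced to the point p. *)
    apply: near_eq_cvg; have := ce [set (p : R * R)] (@compact_set1 _ (p : R * R)).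
    apply: filterS => k /(_ p erefl) ->.
    by rewrite mulr1 subrr normc0.
  + by move=> k p; apply: hHf; apply: sn; exact: hN.
  + exact: adm_rint.
Qed.

End Convolvable.

(** * The convolution of regularised spectra by Fourier inversion *)

Section ConvolutionSquare.
Variable R : realType.
Notation mu := (@mu1 R).
Notation nu := (@mu2 R).
Notation R2 := (R * R)%type.
Notation T2 := (RL R * RL R)%type.
Implicit Types (phi psi : R2 -> R[i]) (p q z : R2).

Lemma line_x (x t : R) : (0, t) + x *: (1, 0) = (x, t) :> R2.
Proof.
by apply: injective_projections; rewrite /= /GRing.scale/= ?add0r ?mulr1 ?mulr0 ?addr0.
Qed.

Lemma test_fun_cmeas2 (Omega : set R2) phi : test_fun Omega phi -> cmeas2 phi.
Proof.
move=> [sp _ _]; have [c1 c2] := smooth_continuous sp.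
by split; apply: continuous_meas2.
Qed.

Lemma test_fun_box (Omega : set R2) phi : test_fun Omega phi -> exists A M : R,
  [/\ 0 < A, 0 <= M, forall p, supp phi p -> `|p| <= A & forall p, normc (phi p) <= M * ind2 A A p].
Proof.
move=> tp; have [A [A0 hA]] := test_fun_supp_bounded tp.
have [M [M0 hM]] := test_fun_bounded tp.
exists A, M; split => // p; rewrite ind2E; case: ifPn => [_|pA]; first by rewrite mulr1.
rewrite (@not_supp _ _ phi p) ?normc0 ?mulr0// => /hA pA'; move/negP : pA; apply.
rewrite -!ler_norml (le_trans _ pA') ?norm_fst//=.
exact: le_trans (norm_snd _) pA'.
Qed.

(** The x-integral is done first, with t frozen, where [ft_line_rapid] gives order 6 uniformly in t;
    integration over |t| <= A then costs 4 A. *)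
Lemma FT_xdecay (Omega : set R2) phi : test_fun Omega phi -> exists M, xdecay M (FT (2 * pi) phi).
Proof.
move=> tp; have [A [M [A0 M0 sA hM]]] := test_fun_box tp.
have mp := test_fun_cmeas2 tp.
have ib : rint nu (fun p : T2 => M * ind2 A A p) := rintZ M (rint_ind2 A A).
have [C [C0 hC]] := @ft_line_rapid R _ Omega phi (1, 0) 6 A (ltW A0) tp.
exists (4 * A * C); split; first exact: cmeas_FT mp hM ib.
move=> z; pose F p := cis (2 * pi * dotp p z) * phi p.
have mF : cmeas2 F by apply: cmeasM mp; apply: cmeas_cis; exact: meas_dotp1.
have ia : rint mu (fun x : RL R => M * ind (- A) A x) := rintZ M (rint_ind _ _).
have hF x t : normc (F (x, t)) <= M * ind (- A) A x * ind (- A) A t.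
  by rewrite /F normcM normc_cis mul1r -mulrA; exact: hM.
rewrite /FT -(cI_fubini2 ia (rint_ind _ _) mF hF).
(* The phase here has the sign of the inverse transform while [ft] has the opposite one, hence the
   frequency - z.1. *)
have iE t : cI mu (fun x => F (x, t)) = cis (2 * pi * (t * z.2)) * ft (fun s => phi ((0, t) + s *: (1, 0))) (- z.1).
  have e1 x : phi ((0, t) + x *: (1, 0)) = phi (x, t) by rewrite line_x.
  rewrite /ft -cI_Z.
    apply: eq_cI => x; rewrite /F e1 /dotp/=.
    have -> : 2 * pi * (x * z.1 + t * z.2) = 2 * pi * (t * z.2) + - (2 * pi * (x * - z.1)).
      by move: (pi : R) => c; ring.
    by rewrite cisD; move: (cis _) (cis _) => c d; ring.
  apply: (cint_dom (g := fun x : RL R => M * ind (- A) A x)) => //.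
    apply: cmeasM; last by apply: cmeas_cis; exact: meas1_phaseN.
    by under eq_fun do rewrite e1; exact: (cmeas_slice2 t mp).
  move=> x; rewrite normcM normc_cis mulr1 e1; apply: (le_trans (hM _)).
  by apply: ler_wpM2l => //; rewrite ler_piMr ?ind_ge0// ind_le1.
have hb t : normc (cI mu (fun x => F (x, t))) <= ((1 + `|z.1|) ^+ 6)^-1 * C * ind (- A) A t.
  have n0 : 0 < (1 + `|z.1|) ^+ 6 by rewrite exprn_gt0// ltr_pwDl.
  rewrite indE; case: ifPn => [tA|tA].
    rewrite mulr1 mulrC ler_pdivlMr// iE normcM normc_cis mul1r mulrC -[`|z.1|]normrN.
    apply: hC => x; rewrite -ler_norml => xA /sA; rewrite line_x => h.
    by apply: xA; apply: le_trans h; exact: norm_fst (x, t).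
  rewrite mulr0 (@eq_cI _ _ _ mu _ (fun=> 0)) ?cI0 ?normc0// => x.
  apply/eq0_normc/eqP; rewrite eq_le normc_ge0 andbT (le_trans (hF x t))//.
  by rewrite [ind _ _ t]indE (negbTE tA) mulr0.
have mI := cmeas_section2 ia (rint_ind (- A) A) mF hF.
have n0 : 0 < (1 + `|z.1|) ^+ 6 by rewrite exprn_gt0// ltr_pwDl.
have := cI_le mI hb (rintZ _ (rint_ind _ _)).
rewrite RintegralZl//; last exact: rint_ind.
rewrite int_ind ?ge0_cp ?(ltW A0)// => h.
rewrite mulrC -ler_pdivlMr//; apply: (le_trans h).
by apply: eqW; move: (_ ^-1) => k; ring.
Qed.

Variables (f1 f2 : R -> R[i]).
Hypotheses (tf1 : test_fun setT f1) (tf2 : test_fun setT f2).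
Hypothesis tv : forall e : R, 0 < e -> test_fun setT (fun x => (x +i* e)^-1 * f1 x).
Notation s := (s0 f1 f2).

Definition ve (e : R) p : R[i] := (p.1 +i* e)^-1 * f1 p.1 * f2 p.2.

(** By [tv] the localised kernel is a test function for e > 0, so its spectrum decays in every
    direction. C depends on e, which is harmless: the bound only justifies exact identities at fixed
    e. *)
Lemma se_le e : 0 < e -> exists C : R, 0 <= C /\ forall q, normc (se f1 f2 e q) <= C * w2 q.
Proof.
move=> e0; have [C1 [C10 h1]] := ft_rapid 2 (tv e0); have [C2 [C20 h2]] := ft_rapid 2 tf2.
exists (C1 * C2); split; first exact: mulr_ge0.
move=> q; rewrite /se normcM /w2.
have -> : C1 * C2 * (w1 q.1 * w1 q.2) = (C1 * w1 q.1) * (C2 * w1 q.2) by ring.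
apply: ler_pM_normc; [ |].
  by apply: le_w1 (h1 _); exact: normc_ge0.
by apply: le_w1 (h2 _); exact: normc_ge0.
Qed.

Lemma se_inversion e z : 0 < e ->
  cI nu (fun q => se f1 f2 e q * cis (2 * pi * dotp z q)) = ve e z.
Proof.
move=> e0; rewrite /ve -(test_fun_inversion z.1 (tv e0)) -(test_fun_inversion z.2 tf2).
have [C1 [C10 h1]] := ft_rapid 2 (tv e0); have [C2 [C20 h2]] := ft_rapid 2 tf2.
have [b [ib mb hb]] := ft_inv_dom tf1 e0.
have [B [M2 [B0 M20 m2 g2]]] := tf2_dom tf2.
rewrite -(@cI_tensor R (fun x => ft (fun x => (x +i* e)^-1 * f1 x) x * cis (2 * pi * (z.1 * x)))
  (fun y => ft f2 y * cis (2 * pi * (z.2 * y))) (fun x => C1 * w1 x) (fun y => C2 * w1 y)).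
- apply: eq_cI => q; rewrite /se /dotp mulrDr cisD.
  by move: (cis _) (cis _) (ft _ _) (ft _ _) => a c k l; ring.
- by apply: cmeasM (cmeas_ft mb hb ib) _; apply: cmeas_cis; exact: meas1_phaseC.
- by apply: cmeasM (cmeas_ft m2 g2 (rintZ M2 (rint_ind _ _))) _; apply: cmeas_cis; exact: meas1_phaseC.
- exact: rintZ _ (@rint_w1 R).
- exact: rintZ _ (@rint_w1 R).
- by move=> x; rewrite normcM normc_cis mulr1; apply: le_w1 (h1 _); exact: normc_ge0.
- by move=> x; rewrite normcM normc_cis mulr1; apply: le_w1 (h2 _); exact: normc_ge0.
Qed.

(** Fubini moves the transform back from phi to the spectrum, where [se_inversion] recovers the
    localised kernel [ve e]. *)
Lemma se_parseval e (b : R2 -> R) phi : 0 < e -> cmeas2 phi -> (forall z, normc (phi z) <= b z) ->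
  rint nu (b : T2 -> R) ->
  cI nu (fun q => se f1 f2 e q * FT (2 * pi) phi q) = cI nu (fun z => phi z * ve e z).
Proof.
move=> e0 mp pb ib; have [C [C0 hC]] := se_le e0.
have ms := cmeas_se tf1 tf2 e0.
pose F (p : T2 * T2) := se f1 f2 e p.1 * (cis (2 * pi * dotp p.2 p.1) * phi p.2).
have mF : cmeas F.
  apply: cmeasM; first by apply: (cmeas_comp ms); exact: measurable_fst.
  apply: cmeasM; first by apply: cmeas_cis; exact: meas_dotp.
  by apply: (cmeas_comp mp); exact: measurable_snd.
have hF q z : normc (F (q, z)) <= C * w2 q * b z.
  rewrite /F/= normcM [X in _ * X]normcM normc_cis mul1r.
  by apply: ler_pM_normc; [exact: hC|exact: pb].
have ia : rint nu (fun q : T2 => C * w2 q) := adm_rint C.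
transitivity (cI nu (fun q => cI nu (fun z => F (q, z)))).
  apply: eq_cI => q; rewrite /F/= (cI_Z (m := nu) (se f1 f2 e q))//.
  exact: cint_phase mp pb ib.
rewrite (cI_swap ia ib mF hF); apply: eq_cI => z.
rewrite -(se_inversion z e0) -(cI_Z (m := nu) (phi z)).
  apply: eq_cI => q; rewrite /F/=.
  by move: (cis _) (se _ _ _ _) => c k; ring.
apply: (cint_dom (g := fun q : T2 => C * w2 q)); last exact: ia.
  apply: cmeasM ms _; apply: cmeas_cis.
  rewrite (_ : (fun q => _) = (fun q : T2 => 2 * pi * dotp q z)); first exact: meas_dotp1.
  by apply/funext => q; rewrite dotpC.
by move=> q; rewrite normcM normc_cis mulr1; exact: hC.
Qed.

(** Parseval twice: the phase of z.(p + q) factors, so for fixed p the q-integral is a Parseval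
    pairing and yields the transform of phi [ve e] at p; the p-integral is then another Parseval
    pairing. *)
Lemma conv2_se e (Omega : set R2) phi : 0 < e -> test_fun Omega phi ->
  conv2 (se f1 f2 e) (FT (2 * pi) phi) = cI nu (fun z => phi z * ve e z * ve e z).
Proof.
move=> e0 tp; have [A [M [A0 M0 sA hM]]] := test_fun_box tp.
have mp := test_fun_cmeas2 tp.
have ib : rint nu (fun p : T2 => M * ind2 A A p) := rintZ M (rint_ind2 A A).
have [C [C0 hC]] := se_le e0.
have mv : cmeas2 (ve e).
  have m1 := test_fun_cmeas (tv e0); have m2 := test_fun_cmeas tf2.
  by apply: cmeasM; [apply: (cmeas_comp m1); exact: measurable_fst|apply: (cmeas_comp m2); exact: measurable_snd].
have [N1 [N10 hN1]] := test_fun_bounded (tv e0); have [N2 [N20 hN2]] := test_fun_bounded tf2.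
have hv z : normc (ve e z) <= N1 * N2.
  rewrite /ve normcM; apply: ler_pM_normc; [exact: hN1|exact: hN2].
have hpv z : normc (phi z * ve e z) <= M * ind2 A A z * (N1 * N2).
  by rewrite normcM; apply: ler_pM_normc; [exact: hM|exact: hv].
have ipv : rint nu (fun z : T2 => M * ind2 A A z * (N1 * N2)).
  by have := rintZ (N1 * N2) ib; congr (is_true (rint _ _)); apply/funext => z; rewrite mulrC.
rewrite -(se_parseval e0 (cmeasM mp mv) hpv ipv); apply: eq_cI => p.
(* The part of the phase in p is attached to phi, which turns [FT phi (p + q)] into [FT Phi q]. *)
pose Phi z := phi z * cis (2 * pi * dotp z p).
have mPhi : cmeas2 Phi by apply: cmeasM mp _; apply: cmeas_cis; exact: meas_dotp1.
have hPhi z : normc (Phi z) <= M * ind2 A A z by rewrite normcM normc_cis mulr1; exact: hM.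
transitivity (se f1 f2 e p * cI nu (fun q => se f1 f2 e q * FT (2 * pi) Phi q)).
  rewrite -(cI_Z (m := nu) (se f1 f2 e p)).
    apply: eq_cI => q; rewrite /kern/= -mulrA; congr (_ * (_ * _)).
    apply: eq_cI => z; rewrite /Phi.
    have -> : 2 * pi * dotp z (p + q) = 2 * pi * dotp z p + 2 * pi * dotp z q.
      by rewrite /dotp/=; move: (pi : R) => c; ring.
    by rewrite cisD; move: (cis _) (cis _) => c d; ring.
  apply: (cint_dom (g := fun q : T2 => 2 * (\int[nu]_z (M * ind2 A A z)) * (C * w2 q))).
  - apply: cmeasM; first exact: cmeas_se.
    exact: cmeas_FT mPhi hPhi ib.
  - move=> q; rewrite normcM mulrC; apply: ler_pM_normc; [ |exact: hC].
    exact: FT_bound mPhi hPhi ib.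
  - by apply: rintZ; exact: adm_rint.
rewrite (se_parseval e0 mPhi hPhi ib); congr (_ * _); apply: eq_cI => z.
by rewrite /Phi; move: (cis _) => c; ring.
Qed.

End ConvolutionSquare.

(** * The square as a derivative *)

Section ComplexDerivative.
Variable R : realType.
Notation mu := (@mu1 R).
Implicit Types (f g : R -> R[i]).

Definition cder f f' := forall x : R,
  is_derive x (1 : R) (fun y : R => complex.Re (f y)) (complex.Re (f' x)) /\
  is_derive x (1 : R) (fun y : R => complex.Im (f y)) (complex.Im (f' x)).

Lemma cderM f f' g g' : cder f f' -> cder g g' ->
  cder (fun x => f x * g x) (fun x => f' x * g x + f x * g' x).
Proof.
move=> df dg x; have [f1 f2] := df x; have [g1 g2] := dg x; split.
- under [X in is_derive _ _ X _]eq_fun do rewrite ReM.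
  apply: (is_derive_eq (is_deriveB (is_deriveM f1 g1) (is_deriveM f2 g2))).
  by rewrite ReD !ReM /GRing.scale/=; ring.
- under [X in is_derive _ _ X _]eq_fun do rewrite ImM.
  apply: (is_derive_eq (is_deriveD (is_deriveM f1 g2) (is_deriveM f2 g1))).
  by rewrite ImD !ImM /GRing.scale/=; ring.
Qed.

Definition ccont f :=
  continuous (fun x => complex.Re (f x)) /\ continuous (fun x => complex.Im (f x)).

Lemma cder_continuous f f' : cder f f' -> ccont f.
Proof.
by move=> df; split; apply: derive_continuous => x; [exact: (df x).1|exact: (df x).2].
Qed.

Lemma ccontD f g : ccont f -> ccont g -> ccont (fun x => f x + g x).
Proof.
move=> [f1 f2] [g1 g2]; split.
- by under eq_fun do rewrite ReD; move=> x; apply: cvgD; [exact: f1|exact: g1].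
- by under eq_fun do rewrite ImD; move=> x; apply: cvgD; [exact: f2|exact: g2].
Qed.

Lemma ccontN f : ccont f -> ccont (fun x => - f x).
Proof.
move=> [f1 f2]; split.
- by under eq_fun do rewrite ReN; move=> x; apply: cvgN; exact: f1.
- by under eq_fun do rewrite ImN; move=> x; apply: cvgN; exact: f2.
Qed.

Lemma ccontM f g : ccont f -> ccont g -> ccont (fun x => f x * g x).
Proof.
move=> [f1 f2] [g1 g2]; split.
- under eq_fun do rewrite ReM; move=> x.
  by apply: cvgB; apply: cvgM; [exact: f1|exact: g1|exact: f2|exact: g2].
- under eq_fun do rewrite ImM; move=> x.
  by apply: cvgD; apply: cvgM; [exact: f1|exact: g2|exact: f2|exact: g1].
Qed.

Lemma cI_cder0 f f' A : 0 <= A -> cder f f' -> ccont f' ->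
  (forall x, ~ (- A <= x <= A) -> f x = 0) -> (forall x, ~ (- A <= x <= A) -> f' x = 0) ->
  cI mu f' = 0.
Proof.
move=> A0 df [c1 c2] f0 f'0; apply: complexP; rewrite /cI/=.
- apply: (int_derive0 A0 (fun x => (df x).1) c1) => x xA; first by rewrite f0.
  by rewrite f'0.
- apply: (int_derive0 A0 (fun x => (df x).2) c2) => x xA; first by rewrite f0.
  by rewrite f'0.
Qed.

Lemma is_derive_sqD (e x : R) : is_derive x (1 : R) (fun y : R => y ^+ 2 + e ^+ 2) (2 * x).
Proof.
by apply: is_derive_eq; rewrite /GRing.scale/= /GRing.scale/=; ring.
Qed.

Lemma is_derive_div (f g : R -> R) (x df dg : R) : g x != 0 -> is_derive x (1 : R) f df ->
  is_derive x (1 : R) g dg ->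
  is_derive x (1 : R) (fun y => f y / g y) ((df * g x - f x * dg) / g x ^+ 2).
Proof.
move=> g0 hf hg.
apply: (is_derive_eq (is_deriveM hf (is_deriveV g0 hg))).
by rewrite /GRing.scale/=; field.
Qed.

Lemma cder_inv (e : R) : 0 < e ->
  cder (fun x => (x +i* e)^-1) (fun x => - ((x +i* e)^-1 * (x +i* e)^-1)).
Proof.
move=> e0 x; have d0 : x ^+ 2 + e ^+ 2 != 0 by rewrite gt_eqF// sqD_gt0.
have -> : - ((x +i* e)^-1 * (x +i* e)^-1) =
    ((e ^+ 2 - x ^+ 2) / (x ^+ 2 + e ^+ 2) ^+ 2) +i* ((2 * e * x) / (x ^+ 2 + e ^+ 2) ^+ 2).
  rewrite inv_iepsE; apply: complexP; rewrite ?ReN ?ImN ?ReM ?ImM /=; by field.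
have eR : (fun y : R => complex.Re (y +i* e)^-1) = (fun y => y / (y ^+ 2 + e ^+ 2)).
  by apply/funext => y; rewrite inv_iepsE.
have eI : (fun y : R => complex.Im (y +i* e)^-1) = (fun y => - (e / (y ^+ 2 + e ^+ 2))).
  by apply/funext => y; rewrite inv_iepsE.
split; rewrite ?eR ?eI.
- apply: (is_derive_eq (@is_derive_div id (fun y => y ^+ 2 + e ^+ 2) x _ _ d0 (is_derive_id x (1 : R)) (is_derive_sqD e x))).
  by congr (_ / _); ring.
- apply: (is_derive_eq (is_deriveN (@is_derive_div (cst e) (fun y => y ^+ 2 + e ^+ 2) x _ _ d0 (is_derive_cst e x (1 : R)) (is_derive_sqD e x)))).
  by rewrite -mulNr /cst/=; congr (_ / _); ring.
Qed.

Lemma cder_line (V : normedModType R) (phi : V -> R[i]) p v : smooth phi ->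
  cder (fun x => phi (p + x *: v)) (fun x => cderive v phi (p + x *: v)).
Proof.
move=> sp x; have [d1 d2] := smooth_derivable sp (p + x *: v) v.
by split; [exact: derive_line d1|exact: derive_line d2].
Qed.

Lemma cont_line (V : normedModType R) (F : V -> R) p v : continuous F ->
  continuous (fun x : R => F (p + x *: v)).
Proof.
move=> cF x; apply: (@continuous_comp _ _ _ (fun x : R => p + x *: v) F); last exact: cF.
by apply: cvgD; [exact: cvg_cst|apply: cvgZl; exact: cvg_id].
Qed.

End ComplexDerivative.

Section Derivatives.
Variable R : realType.
Notation mu := (@mu1 R).
Notation nu := (@mu2 R).
Notation R2 := (R * R)%type.
Notation T2 := (RL R * RL R)%type.
Implicit Types (phi psi : R2 -> R[i]) (p q z : R2).

Lemma line_t (x t : R) : (x, 0) + t *: (0, 1) = (x, t) :> R2.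
Proof.
by apply: injective_projections; rewrite /= /GRing.scale/= ?add0r ?mulr1 ?mulr0 ?addr0.
Qed.

Lemma supp_box phi A : (forall p, supp phi p -> `|p| <= A) ->
  forall x t, ~ (- A <= x <= A) \/ ~ (- A <= t <= A) -> phi (x, t) = 0.
Proof.
move=> sA x t h; apply: not_supp => /sA xA; case: h => h; apply: h; rewrite -ler_norml.
  exact: le_trans (norm_fst (x, t)) xA.
exact: le_trans (norm_snd (x, t)) xA.
Qed.

Lemma box_le phi A M p : (forall p, supp phi p -> `|p| <= A) -> (forall p, normc (phi p) <= M) ->
  normc (phi p) <= M * ind2 A A p.
Proof.
move=> sA hM; case: p => x t; rewrite ind2E/=; case: ifPn => [_|/nandP h]; first by rewrite mulr1.
by rewrite (supp_box sA) ?normc0 ?mulr0//; case: h => h; [left|right]; apply/negP.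
Qed.

Lemma slice_cderive_t (Omega : set R2) phi x : test_fun Omega phi ->
  slice (cderive (@e_t R) phi) x = 0.
Proof.
move=> tp; have [sp _ _] := tp; have [A [M [A0 M0 sA hM]]] := test_fun_box tp.
have [sd _ _] := test_fun_cderive (@e_t R) tp; have [c1 c2] := smooth_continuous sd.
have := cder_line (x, 0) (@e_t R) sp.
have sA' p : supp (cderive (@e_t R) phi) p -> `|p| <= A by move=> /supp_cderive/sA.
move=> /(@cI_cder0 _ _ _ A (ltW A0)) h.
rewrite /slice -[RHS]h.
- by apply: eq_cI => t; rewrite line_t.
- by split; [exact: cont_line c1|exact: cont_line c2].
- by move=> t tA; rewrite line_t; apply: (supp_box sA); right.
- by move=> t tA; rewrite line_t; apply: (supp_box sA'); right.
Qed.

(** The bound 4 A L + pi B is 0 for the zero function, where L = B = 0. *)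
Lemma inv_x_i00 : inv_x_i0 (fun=> 0 : R[i]) = 0 :> R[i].
Proof.
have l0 : @lip0 R 1 0 0 (fun=> 0).
  split => [|//|x|x]; first exact: cmeas_cst.
    by rewrite subrr normc0 mul0r.
  by rewrite normc0.
have := inv_x_i0_bound ltr01 (lexx 0) l0; rewrite mulr0 mulr0 addr0 => h.
by apply/eq0_normc/eqP; rewrite eq_le h normc_ge0.
Qed.

Lemma u0t_cderive_t (Omega : set R2) phi : test_fun Omega phi -> u0t (cderive (@e_t R) phi) = 0.
Proof.
move=> tp; rewrite u0tE (_ : slice _ = fun=> 0) ?inv_x_i00//.
by apply/funext => x; exact: slice_cderive_t tp.
Qed.

Lemma nice_of_bound (Omega : set R2) phi A M N : test_fun Omega phi ->
  (forall p, supp phi p -> `|p| <= A) -> (forall p, normc (phi p) <= M) ->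
  (forall p, normc (cderive (@e_x R) phi p) <= N) -> nice A A (2 * N) M phi.
Proof.
move=> tp sA hM hN; split; first exact: test_fun_cmeas2 tp.
  by move=> p; exact: box_le.
move=> x t; have [sp _ _] := tp.
have := lipschitz_line (0, t) x sp hN.
by rewrite /e_x line_x.
Qed.

Lemma test_fun_nice (Omega : set R2) phi : test_fun Omega phi -> exists A L M : R,
  [/\ 0 < A, 0 <= L, 0 <= M & nice A A L M phi].
Proof.
move=> tp; have [A [M [A0 M0 sA _]]] := test_fun_box tp.
have [M' [M'0 hM']] := test_fun_bounded tp.
have [N [N0 hN]] := test_fun_bounded (test_fun_cderive (@e_x R) tp).
exists A, (2 * N), M'; split => //; first exact: mulr_ge0.
exact: nice_of_bound tp sA hM' hN.
Qed.

(** G2 - G1 is the x-derivative of (x + i e)^-1 phi(x, t), so it integrates to 0 on every horizontal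
    line. *)
Lemma Un_cderive_x (Omega : set R2) phi e : 0 < e -> test_fun Omega phi ->
  Un e (cderive (@e_x R) phi) = cI nu (fun z => phi z * (z.1 +i* e)^-1 * (z.1 +i* e)^-1).
Proof.
move=> e0 tp; have [sp _ _] := tp; have tD := test_fun_cderive (@e_x R) tp.
have [A [M [A0 M0 sA hM]]] := test_fun_box tp.
have sA' p : supp (cderive (@e_x R) phi) p -> `|p| <= A by move=> /supp_cderive/sA.
have [N [N0 hN]] := test_fun_bounded tD.
have [sD _ _] := tD; have [c1 c2] := smooth_continuous sD.
pose g p := (p.1 +i* e)^-1 : R[i].
have mg : cmeas2 g := cmeas_inv2 e0.
have mp := test_fun_cmeas2 tp; have mD := test_fun_cmeas2 tD.
have hg p : normc (g p) <= e^-1 := normc_inv_e _ e0.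
have hD p : normc (cderive (@e_x R) phi p) <= N * ind2 A A p.
  exact: box_le.
pose G1 p := phi p * g p * g p; pose G2 p := g p * cderive (@e_x R) phi p.
have mG1 : cmeas2 G1 := cmeasM (cmeasM mp mg) mg.
have mG2 : cmeas2 G2 := cmeasM mg mD.
have V0 : 0 <= e^-1 by rewrite invr_ge0 ltW.
have h1 p : normc (G1 p) <= e^-1 * e^-1 * M * ind2 A A p.
  rewrite /G1 !normcM mulrC [normc (phi p) * _]mulrC mulrA -[leRHS]mulrA.
  apply: ler_pM; [by apply: mulr_ge0; exact: normc_ge0|exact: normc_ge0| |exact: hM].
  by apply: ler_pM_normc; [exact: hg|exact: hg].
have h2 p : normc (G2 p) <= e^-1 * N * ind2 A A p.
  rewrite /G2 normcM -[leRHS]mulrA.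
  by apply: ler_pM_normc; [exact: hg|exact: hD].
have i1 : cintegrable nu G1 := cint_dom mG1 h1 (rintZ _ (rint_ind2 _ _)).
have i2 : cintegrable nu G2 := cint_dom mG2 h2 (rintZ _ (rint_ind2 _ _)).
have mG : cmeas2 (fun p => - 1 * G1 p + G2 p) by apply: cmeasD mG2; apply: cmeasM mG1; exact: cmeas_cst.
set K := e^-1 * e^-1 * M + e^-1 * N.
have hG x t : normc (- 1 * G1 (x, t) + G2 (x, t)) <= K * ind (- A) A x * ind (- A) A t.
  rewrite -[leRHS]mulrA -/(ind2 A A (x, t)) /K mulrDl; apply: (le_trans (normcD_le _ _)).
  by apply: lerD; [rewrite mulN1r normcN_eq; exact: h1|exact: h2].
suff z : cI nu (fun p => - 1 * G1 p + G2 p) = 0.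
  move: z; rewrite (cI_lin (- 1) i1 i2) mulN1r addrC => /eqP.
  by rewrite subr_eq0 => /eqP.
have ia : rint mu (fun x : RL R => K * ind (- A) A x) := rintZ K (rint_ind _ _).
rewrite -(cI_fubini2 ia (rint_ind (- A) A) mG hG) -[RHS](cI0 mu); apply: eq_cI => t.
have := cderM (cder_inv e0) (cder_line (0, t) (@e_x R) sp).
have cg := cder_continuous (cder_inv e0).
have cp := cder_continuous (cder_line (0, t) (@e_x R) sp).
have cD : ccont (fun x => cderive (@e_x R) phi ((0, t) + x *: @e_x R)).
  by split; [exact: cont_line c1|exact: cont_line c2].
move=> /(@cI_cder0 _ _ _ A (ltW A0)) h; rewrite -[RHS]h.
- by apply: eq_cI => x; rewrite line_x /G1 /G2 /g/=; move: (_^-1) => k; ring.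
- exact: ccontD (ccontM (ccontN (ccontM cg cg)) cp) (ccontM cg cD).
- by move=> x xA; rewrite line_x (supp_box sA) ?mulr0//; left.
- move=> x xA; rewrite line_x (supp_box sA) ?(supp_box sA') ?mulr0 ?addr0//; by left.
Qed.

Section Square.
Variables (f1 f2 : R -> R[i]).
Hypotheses (tf1 : test_fun setT f1) (tf2 : test_fun setT f2).
Hypothesis tv : forall e : R, 0 < e -> test_fun setT (fun x => (x +i* e)^-1 * f1 x).

(** For each e both sides become the integral of phi (x + i e)^-2: the two copies of the cutoff
    disappear because it equals 1 wherever phi is nonzero. [conv2_cvg] and [Un_cvg] then let e tend
    to 0. *)
Lemma conv2_square (Omega : set R2) phi : test_fun Omega phi ->
  (forall p, phi p != 0 -> chi f1 f2 p = 1) ->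
  fourier_inv_distr (conv2 (s0 f1 f2)) phi = u0t (cderive (@e_x R) phi).
Proof.
move=> tp hc; rewrite /fourier_inv_distr fourier_invE.
have [M xp] := FT_xdecay tp; have [C [C0 _ hs]] := spectral_s0 tf1 tf2.
have [A [L [N [A0 L0 N0 np]]]] := test_fun_nice (test_fun_cderive (@e_x R) tp).
have c1 := conv2_cvg C0 (fun n => cmeas_se tf1 tf2 (epsn_gt0 R n))
  (fun n => hs _ (epsn_gt0 R n)) (se_cvg tf1 tf2) xp.
apply: (ccvg_unique c1); have := Un_cvg A0 A0 L0 N0 np.
congr ccvg; apply/funext => n.
rewrite (conv2_se tf1 tf2 tv (epsn_gt0 R n) tp) (Un_cderive_x (epsn_gt0 R n) tp).
apply: eq_cI => z; have [->|/hc] := eqVneq (phi z) 0; first by rewrite !mul0r.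
rewrite /chi /ve => e; have -> : (z.1 +i* epsn R n)^-1 * f1 z.1 * f2 z.2 = (z.1 +i* epsn R n)^-1.
  by rewrite -mulrA e mulr1.
by [].
Qed.

End Square.

End Derivatives.

(** * The weak solution *)

Section Bounds.
Variables (R : realType) (V : normedModType R).
Implicit Types (f : V -> R[i]).

Lemma compact_norm (K : set V) : compact K -> exists A : R, 0 < A /\ forall p, K p -> `|p| <= A.
Proof.
move=> /compact_bounded[M [Mr MA]].
exists (`|M| + 1); split; first by rewrite ltr_wpDl.
by move=> p Kp; apply: MA => //; rewrite (le_lt_trans (ler_norm _))// ltrDl.
Qed.

Lemma seminorm0_le m f (M : R) p : seminorm_le 0 m f M -> normc (f p) <= M.
Proof. by move=> /(_ [::] p (leq0n _) isT); rewrite expr0 mul1r. Qed.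

Lemma seminorm0_cderive m f (M : R) v : `|v| <= 1 -> seminorm_le 0 m.+1 f M ->
  seminorm_le 0 m (cderive v f) M.
Proof.
move=> v1 h vs p sv av; rewrite cderives_rcons; apply: h; first by rewrite size_rcons.
by rewrite all_rcons v1.
Qed.

End Bounds.

Section LineDistribution.
Variable R : realType.
Implicit Types (f : R -> R[i]).

Lemma lip0_seminorm (Omega : set R) f A M : test_fun Omega f ->
  (forall x, supp f x -> `|x| <= A) -> seminorm_le 0 1 f M -> lip0 A (2 * M) M f.
Proof.
move=> tf sA h; have [sf _ _] := tf; split.
- exact: test_fun_cmeas tf.
- exact: supp_itv tf sA.
- move=> x; have n1 : `|1 : R| <= 1 by rewrite normr1.
  have := lipschitz_line 0 x sf (fun q => seminorm0_le q (seminorm0_cderive n1 h)).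
  by rewrite add0r /GRing.scale/= mulr1.
- by move=> x; exact: seminorm0_le h.
Qed.

Lemma lip0_widen A A' L B f : A <= A' -> lip0 A L B f -> lip0 A' L B f.
Proof.
move=> AA [mf fA fL fB]; split => // x xA; apply: fA => /andP[h1 h2]; apply: xA.
by rewrite (le_trans _ h1) ?lerN2// (le_trans h2).
Qed.

(** Order 1: if M bounds f and its directional derivatives along unit vectors, the Lipschitz
    constant at 0 is at most 2 M, which gives the constant 4 A 2 + pi. *)
Lemma distribution_inv_x_i0 : distribution_on setT (@inv_x_i0 R).
Proof.
split.
  move=> a f g /test_fun_lip0[A [L [B [A0 L0 B0 lf]]]] /test_fun_lip0[A' [L' [B' [A'0 L'0 B'0 lg]]]].
  have mA : A <= Num.max A A' by rewrite le_max lexx.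
  have mA' : A' <= Num.max A A' by rewrite le_max lexx orbT.
  exact: (inv_x_i0_lin a (lt_le_trans A0 mA) L0 L'0 (lip0_widen mA lf) (lip0_widen mA' lg)).
move=> K cK _; have [A [A0 hA]] := compact_norm cK.
exists 1%N, (4 * A * 2 + pi) => f tf sK M h.
have M0 : 0 <= M := le_trans (normc_ge0 _) (seminorm0_le 0 h).
have l := lip0_seminorm tf (fun x sx => hA x (sK x sx)) h.
have := inv_x_i0_bound A0 (mulr_ge0 (ler0n _ _) M0) l.
by rewrite mulrA -mulrDl.
Qed.

End LineDistribution.

Section PlaneDistribution.
Variable R : realType.
Notation mu := (@mu1 R).
Notation nu := (@mu2 R).
Notation R2 := (R * R)%type.
Notation T2 := (RL R * RL R)%type.
Implicit Types (phi psi : R2 -> R[i]) (p q z : R2) (Omega : set R2).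

Lemma e_x_le1 : `|@e_x R| <= 1.
Proof. by rewrite prod_normE/= normr1 normr0 ge_max lexx ler01. Qed.

Lemma nice_seminorm Omega phi A M : test_fun Omega phi ->
  (forall p, supp phi p -> `|p| <= A) -> seminorm_le 0 1 phi M -> nice A A (2 * M) M phi.
Proof.
move=> tp sA h; apply: nice_of_bound tp sA _ _ => p.
  exact: seminorm0_le h.
exact: seminorm0_le (seminorm0_cderive e_x_le1 h).
Qed.

Lemma u0t_test_lin Omega (a : R[i]) phi psi : test_fun Omega phi -> test_fun Omega psi ->
  u0t (fun p => a * phi p + psi p) = a * u0t phi + u0t psi.
Proof.
move=> tf tg.
have [A [M [A0 M0 sA hM]]] := test_fun_box tf; have [A' [M' [A'0 M'0 sA' hM']]] := test_fun_box tg.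
have [N [N0 hN]] := test_fun_bounded tf; have [N' [N'0 hN']] := test_fun_bounded tg.
have [D [D0 hD]] := test_fun_bounded (test_fun_cderive (@e_x R) tf).
have [D' [D'0 hD']] := test_fun_bounded (test_fun_cderive (@e_x R) tg).
have mA : A <= Num.max A A' by rewrite le_max lexx.
have mA' : A' <= Num.max A A' by rewrite le_max lexx orbT.
have B0 := lt_le_trans A0 mA.
apply: (u0t_lin a B0 B0 (mulr_ge0 (ler0n _ _) D0) (mulr_ge0 (ler0n _ _) D'0) N0 N'0).
  by apply: nice_of_bound tf _ hN hD => p /sA /le_trans; apply.
by apply: nice_of_bound tg _ hN' hD' => p /sA' /le_trans; apply.
Qed.

Lemma u0t_seminorm Omega phi A M : 0 < A -> test_fun Omega phi ->
  (forall p, supp phi p -> `|p| <= A) -> seminorm_le 0 1 phi M ->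
  normc (u0t phi) <= (4 * A * (4 * A * 2) + pi * (4 * A)) * M.
Proof.
move=> A0 tp sA h.
have M0 : 0 <= M := le_trans (normc_ge0 _) (seminorm0_le 0 h).
have := u0t_bound A0 A0 (mulr_ge0 (ler0n _ _) M0) M0 (nice_seminorm tp sA h).
move/le_trans; apply; apply: eqW.
by move: (pi : R) => c; ring.
Qed.

Lemma distribution_u0t Omega : distribution_on Omega (@u0t R).
Proof.
split; first by move=> a f g; exact: u0t_test_lin.
move=> K cK _; have [A [A0 hA]] := compact_norm cK.
eexists 1%N, _ => f tf sK M h.
exact: u0t_seminorm A0 tf (fun x sx => hA x (sK x sx)) h.
Qed.

Lemma distribution_dx_u0t Omega : distribution_on Omega (fun phi => u0t (cderive (@e_x R) phi)).
Proof.
split.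
  move=> a f g tf tg; have [sf _ _] := tf; have [sg _ _] := tg.
  rewrite -(u0t_test_lin a (test_fun_cderive (@e_x R) tf) (test_fun_cderive (@e_x R) tg)).
  by congr u0t; apply/funext => p; exact: cderive_lin.
move=> K cK _; have [A [A0 hA]] := compact_norm cK.
(* One derivative for d_x and one for the order of [u0t]. *)
eexists 2, _ => f tf sK M h.
apply: (u0t_seminorm A0 (test_fun_cderive (@e_x R) tf)).
  by move=> p /supp_cderive/sK; exact: hA.
exact: (seminorm0_cderive e_x_le1 h).
Qed.

(* The spectrum of a localisation of 1/(x+i0) decays rapidly away from the ray
   [xi.1 > 0], [xi.2 = 0]. *)
Definition cone0 : set R2 := [set q | q.1 < `|q.2|].

Lemma open_cone0 : open_cone cone0.
Proof.
split.
  have -> : cone0 = (fun q : R2 => `|q.2| - q.1) @^-1` [set x | 0 < x].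
    by apply/seteqP; split => q; rewrite /cone0/= subr_gt0.
  apply: open_comp => [q _|]; last exact: open_gt.
  by apply: cvgB; [apply: cvg_norm; exact: cvg_snd|exact: cvg_fst].
by move=> t xi t0; rewrite /cone0/= normrZ gtr0_norm// /GRing.scale/= ltr_pM2l.
Qed.

(** In the cone, a nonnegative q.1 is controlled by |q.2| and a negative one by [negw], so the
    anisotropic weight dominates the full norm. *)
Lemma cone0_ineq q : cone0 q -> 1 + `|q| <= 2 * (negw q.1 * (1 + `|q.2|)).
Proof.
rewrite /cone0/= => h; have n1 := negw_ge1 q.1.
have h2 : `|q.1| <= negw q.1 * (1 + `|q.2|).
  rewrite /negw; case: (lerP 0 q.1) => x0.
    rewrite max_l ?oppr_le0// addr0 mul1r ger0_norm//; lra.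
  by rewrite max_r ?oppr_ge0 ?ltW// ltr0_norm//; have := normr_ge0 q.2; nra.
have h3 : `|q.2| <= negw q.1 * (1 + `|q.2|) by have := normr_ge0 q.2; nra.
have h4 : 1 <= negw q.1 * (1 + `|q.2|) by have := normr_ge0 q.2; nra.
have h5 : `|q| <= negw q.1 * (1 + `|q.2|) by rewrite prod_normE ge_max h2 h3.
lra.
Qed.

Lemma s0_rapid (f1 f2 : R -> R[i]) : test_fun setT f1 -> test_fun setT f2 ->
  rapidly_decreasing_on cone0 (s0 f1 f2).
Proof.
(* One power more than asked, to absorb the growth 1 + |q.1|. *)
move=> tf1 tf2 N; have [C [C0 h]] := se_bound tf1 tf2 N.+1.
exists (2 ^+ N.+1 * C) => q cq.
have hs := s0_bound_of tf1 tf2 h q.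
have q0 : 0 < 1 + `|q| by rewrite ltr_pwDl.
rewrite -(ler_pM2l q0) mulrA -exprS.
have h1 : (1 + `|q|) ^+ N.+1 <= 2 ^+ N.+1 * (negw q.1 ^+ N.+1 * (1 + `|q.2|) ^+ N.+1).
  rewrite -!exprMn lerXn2r ?nnegrE ?(ltW q0)//; last exact: cone0_ineq.
  apply: mulr_ge0 => //; apply: mulr_ge0; first exact/ltW/negw_gt0.
  exact: addr_ge0.
apply: (le_trans (ler_wpM2r (normc_ge0 _) h1)).
rewrite -mulrA [leRHS]mulrCA; apply: ler_wpM2l; first exact: exprn_ge0.
apply: (le_trans hs); rewrite mulrC; apply: ler_wpM2r => //.
by rewrite lerD2l; exact: norm_fst.
Qed.

Lemma test_fun_line (F G : R -> R) (a b : R) : (forall n, sm n F) -> (forall n, sm n G) ->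
  (forall x, ~ (a <= x <= b) -> F x = 0) -> (forall x, ~ (a <= x <= b) -> G x = 0) ->
  test_fun setT (fun x : R => F x +i* G x).
Proof.
move=> sF sG F0 G0.
have sub : supp (fun x : R => F x +i* G x) `<=` `[a, b]%classic.
  apply: supp_sub; first exact: interval_closed.
  by move=> x; rewrite /= in_itv/= => xab; rewrite F0// G0.
split=> //; first exact: smooth_sm.
by apply: (subclosed_compact (@closed_closure _ _) (@segment_compact _ a b)).
Qed.

(** A single cutoff must localise near y within t > 0, have product form, and give a test function
    on the line after its x-factor is multiplied by (x + i e)^-1, for every e > 0. *)
Lemma cutoff y : 0 < y.2 -> exists (f1 f2 : R -> R[i]) (U : set R2),
  [/\ test_fun setT f1 /\ test_fun setT f2,
      forall e : R, 0 < e -> test_fun setT (fun x => (x +i* e)^-1 * f1 x),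
      test_fun (@spacetime R) (chi f1 f2), open U /\ U y & forall p, U p -> chi f1 f2 p = 1].
Proof.
case: y => x0 t0 /= t00.
pose F := plateau (x0 - 2) (x0 - 1) (x0 + 1) (x0 + 2).
(* The endpoints are positive multiples of t0, so the support is a compact subset of t > 0. *)
pose G := plateau (t0 / 4) (t0 / 2) (2 * t0) (3 * t0).
have F0 x : ~ (x0 - 2 <= x <= x0 + 2) -> F x = 0 by apply: plateau0; lra.
have G0 x : ~ (t0 / 4 <= x <= 3 * t0) -> G x = 0 by apply: plateau0; lra.
have F1 x : x0 - 1 < x < x0 + 1 -> F x = 1.
  by move=> /andP[h1 h2]; apply: plateau1; [lra|lra|rewrite !ltW].
have G1 x : t0 / 2 < x < 2 * t0 -> G x = 1.
  by move=> /andP[h1 h2]; apply: plateau1; [lra|lra|rewrite !ltW].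
have sF n : sm n F by exact: sm_plateau.
have sG n : sm n G by exact: sm_plateau.
have z0 n : sm n (fun _ : R => 0 : R) by exact: sm_cst.
pose U : set R2 := [set p | x0 - 1 < p.1 < x0 + 1 /\ t0 / 2 < p.2 < 2 * t0].
have chiE : chi (fun x => (F x)%:C) (fun t => (G t)%:C) = (fun p => (F p.1 * G p.2)%:C).
  by apply/funext => p; apply: complexP; rewrite /chi ?ReM ?ImM /=; ring.
exists (fun x => (F x)%:C), (fun t => (G t)%:C), U; split.
- split; first exact: (@test_fun_line F (fun=> 0) _ _ sF z0 F0 (fun _ _ => erefl)).
  exact: (@test_fun_line G (fun=> 0) _ _ sG z0 G0 (fun _ _ => erefl)).
- move=> e e0.
  have -> : (fun x => (x +i* e)^-1 * (F x)%:C) =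
     (fun x => (F x * x * (x ^+ 2 + e ^+ 2)^-1) +i* (F x * - e * (x ^+ 2 + e ^+ 2)^-1)).
    by apply/funext => x; rewrite inv_iepsE; apply: complexP; rewrite ?ReM ?ImM /=; ring.
  have sI n : sm n (fun x : R => x).
    apply: sm_weaken; apply: (@sm_derive R n (fun x => x) (fun=> 1)); exact: sm_cst.
  have sV n : sm n (fun x : R => (x ^+ 2 + e ^+ 2)^-1).
    apply: (@smV _ _ n (fun x : R => x ^+ 2 + e ^+ 2)); first by move=> x; rewrite gt_eqF// sqD_gt0.
    by apply: smD; [exact: (smM (sI n) (sI n))|exact: sm_cst].
  apply: (test_fun_line (a := x0 - 2) (b := x0 + 2)).
  + by move=> n; apply: smM (sV n); apply: smM.
  + by move=> n; apply: smM (sV n); apply: smM => //; exact: sm_cst.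
  + by move=> x /F0 ->; rewrite !mul0r.
  + by move=> x /F0 ->; rewrite !mul0r.
- rewrite chiE; apply: (test_fun_tensor sF sG F0 G0) => p _ /andP[h _].
  by rewrite /spacetime/=; apply: lt_le_trans h; rewrite divr_gt0.
- split; last by rewrite /U/=; split; lra.
  have -> : U = (fst @^-1` [set` `]x0 - 1, x0 + 1[ ]) `&` (snd @^-1` [set` `]t0 / 2, 2 * t0[ ]).
    by apply/seteqP; split => p; rewrite /U/= !in_itv.
  apply: openI; apply: open_comp => [q _|]; try exact: itv_open.
    exact: cvg_fst.
  exact: cvg_snd.
- by move=> p [/F1 h1 /G1 h2]; rewrite chiE h1 h2 mulr1.
Qed.

End PlaneDistribution.

Section WeakSolution.
Variable R : realType.
Notation mu := (@mu1 R).
Notation nu := (@mu2 R).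
Notation R2 := (R * R)%type.
Notation T2 := (RL R * RL R)%type.
Implicit Types (phi psi : R2 -> R[i]) (p q z : R2).

(** A nonzero xi with xi.1 <= 0 lies in [cone0], where the localised spectrum decreases rapidly.
    This one-sided bound on the wave front set is enough for the criterion, as xi.1 and - xi.1 are
    not both positive. *)
Lemma WF_u0t y xi : WF (@spacetime R) (@u0t R) y xi -> 0 < xi.1.
Proof.
move=> [sy xi0 nx]; rewrite ltNge; apply/negP => x1; apply: nx.
have [f1 [f2 [U [[tf1 tf2] _ tc [oU Uy] hU]]]] := cutoff sy.
exists (chi f1 f2), (@cone0 R); split => //.
- by rewrite hU ?oner_neq0.
- exact: open_cone0.
- rewrite /cone0/= lt_neqAle (le_trans x1)// andbT; apply: contra xi0 => /eqP e.
  have : `|xi.2| <= 0 by rewrite -e.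
  rewrite normr_le0 => /eqP x2; rewrite x2 normr0 in e.
  by case: xi e x2 {x1} => a b /= -> ->.
- exact: s0_rapid.
Qed.

Lemma hormander_u0t : hormander_criterion (@spacetime R) (@u0t R) (@u0t R).
Proof.
move=> y xi _ /WF_u0t h /WF_u0t /=; rewrite oppr_gt0 => /(lt_trans h).
by rewrite ltxx.
Qed.

(** The candidate for the square is - d_x u; since [ddistr] carries a minus sign, its value at phi
    is u applied to d_x phi. *)
Lemma square_u0t : hormander_product (@spacetime R) (@u0t R) (@u0t R)
  (fun phi => u0t (cderive (@e_x R) phi)).
Proof.
split; [exact: distribution_dx_u0t|exact: hormander_u0t|].
move=> y sy; have [f1 [f2 [U [[tf1 tf2] tv tc oU hU]]]] := cutoff sy.
exists U, (chi f1 f2), (conv2 (s0 f1 f2)); split => //; first exact: distr_Sconvolution.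
move=> phi tp; have [_ _ sU] := tp; rewrite (conv2_square tf1 tf2 tv tp)// => p p0.
by apply: hU; apply: sU; exact: subset_closure.
Qed.

(** The constants are kept proportional to the indicator of [-A, A] in t, which makes them
    integrable in t for [u0t_swap]. *)
Lemma slice_lip0 (Omega : set R2) phi : test_fun Omega phi -> exists A L M : R,
  [/\ 0 < A, 0 <= L, 0 <= M &
  (forall t, lip0 A (L * ind (- A) A t) (M * ind (- A) A t) (fun x => phi (x, t))) /\ nice A A L M phi].
Proof.
move=> tp; have [A [L [M [A0 L0 M0 np]]]] := test_fun_nice tp.
exists A, L, M; split => //; split => // t; have [mp pM pL] := np; split.
- exact: cmeas_slice2.
- move=> x /negP xA; apply/eq0_normc/eqP; rewrite eq_le normc_ge0 andbT (le_trans (pM _))//.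
  by rewrite ind2E/= (negbTE xA) mulr0.
- move=> x; rewrite indE; case: ifPn => tA; first by rewrite mulr1; exact: pL.
  have z y : phi (y, t) = 0.
    apply/eq0_normc/eqP; rewrite eq_le normc_ge0 andbT (le_trans (pM _))//.
    by rewrite ind2E/= (negbTE tA) andbF mulr0.
  by rewrite !z subrr normc0 mulr0 mul0r.
- move=> x; apply: (le_trans (pM _)); rewrite /ind2/=; apply: ler_wpM2l => //.
  by rewrite ler_piMl ?ind_ge0 ?ind_le1.
Qed.

(** [tensor1] integrates in t before applying 1/(x+i0), whereas [represented_by] integrates in t
    last. For e > 0 the exchange is Fubini, and the uniform bound on slices lets e tend to 0 under
    the t-integral. *)
Lemma u0t_swap (Omega : set R2) phi : test_fun Omega phi ->
  u0t phi = cI mu (fun t => inv_x_i0 (fun x => phi (x, t))).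
Proof.
move=> tp; have [A [L [M [A0 L0 M0 [l np]]]]] := slice_lip0 tp.
have [mp pM pL] := np.
have c1 := Un_cvg A0 A0 L0 M0 np.
apply: (ccvg_unique c1).
have mF e : 0 < e -> cmeas2 (fun p => (p.1 +i* e)^-1 * phi p).
  by move=> e0; apply: cmeasM mp; exact: cmeas_inv2.
have hF e (e0 : 0 < e) x t : normc ((x +i* e)^-1 * phi (x, t)) <= e^-1 * M * ind (- A) A x * ind (- A) A t.
  by rewrite normcM -!mulrA; apply: ler_pM_normc; [exact: normc_inv_e|exact: pM].
have ia e : rint mu (fun x : RL R => e^-1 * M * ind (- A) A x) := rintZ _ (rint_ind _ _).
have UE e : 0 < e -> cI mu (fun t => inv_x_ieps e (fun x => phi (x, t))) = Un e phi.
  by move=> e0; rewrite /Un -(cI_fubini2 (ia e) (rint_ind (- A) A) (mF _ e0) (hF _ e0)).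
have mU e : 0 < e -> cmeas (fun t : RL R => inv_x_ieps e (fun x => phi (x, t))).
  by move=> e0; exact: (cmeas_section2 (ia e) (rint_ind (- A) A) (mF _ e0) (hF _ e0)).
have := @cI_dct _ _ _ mu (fun n t => inv_x_ieps (epsn R n) (fun x => phi (x, t)))
  (fun t => inv_x_i0 (fun x => phi (x, t))) (fun t => (4 * A * L + pi * M) * ind (- A) A t).
have Li t : 0 <= L * ind (- A) A t by rewrite mulr_ge0// ind_ge0.
move=> H; have {H} : ccvg (fun n => cI mu (fun t => inv_x_ieps (epsn R n) (fun x => phi (x, t))))
    (cI mu (fun t => inv_x_i0 (fun x => phi (x, t)))).
  apply: H.
  - by move=> n; apply: mU; exact: epsn_gt0.
  - by move=> t; exact: inv_epsn_cvg A0 (Li t) (l t).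
  - move=> n t; apply: (le_trans (inv_ieps_bound (epsn_gt0 R n) A0 (Li t) (l t))).
    by rewrite !mulrA -mulrDl.
  - exact/rintZ/rint_ind.
by congr ccvg; apply/funext => n; rewrite (UE _ (epsn_gt0 R n)).
Qed.

Lemma represented_u0t : represented_by (@u0t R) (fun _ => @inv_x_i0 R).
Proof.
split.
- by move=> t _; exact: distribution_inv_x_i0.
- by move=> phi _; split => t; exact: cvg_cst.
- move=> phi tp; rewrite (u0t_swap tp).
  (* Test functions on the half-plane vanish for t < 0, so the integral over all t reduces to one
     over [0, oo[. *)
  have z t : ~ 0 <= t -> inv_x_i0 (fun x => phi (x, t)) = 0.
    move=> t0; rewrite -[RHS](@inv_x_i00 R); apply: eq_inv_x_i0 => x.
    by apply: not_supp => /(let: And3 _ _ h := tp in h) /ltW.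
  rewrite /cI /cint; congr (_ +i* _).
  + rewrite [RHS]Rintegral_mkcond; apply: eq_Rintegral => t _.
    rewrite patchE; case: ifPn => // /negP tn; rewrite z// => t0.
    by apply: tn; rewrite inE/= in_itv/= t0.
  + rewrite [RHS]Rintegral_mkcond; apply: eq_Rintegral => t _.
    rewrite patchE; case: ifPn => // /negP tn; rewrite z// => t0.
    by apply: tn; rewrite inE/= in_itv/= t0.
Qed.

Lemma weak_solution_u0t (c : R) :
  weak_solution c (tensor1 (@inv_x_i0 R)) (fun _ => @inv_x_i0 R) (@inv_x_i0 R).
Proof.
split; [exact: distribution_u0t| |exact: represented_u0t|by []].
exists (fun phi => u0t (cderive (@e_x R) phi)); split; first exact: square_u0t.
move=> phi tp; rewrite /ddistr -!/(u0t _) (u0t_cderive_t tp).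
by rewrite oppr0 mulr0 add0r addNr.
Qed.

End WeakSolution.

(** * The principal value *)

Section FatouReal.
Context d (T : measurableType d) (R : realType).
Variable m : {measure set T -> \bar R}.

(** Produces the integrability of ln |x| near 0 from a uniform bound on the integrals of its
    regularisations. *)
Lemma rint_fatou (fn : nat -> T -> R) (f : T -> R) (C : R) :
  (forall n x, 0 <= fn n x) -> (forall n, rint m (fn n)) ->
  (forall n, \int[m]_x fn n x <= C) -> (forall x, fn n x @[n --> \oo] --> f x) -> rint m f.
Proof.
move=> f0 fi fC fc.
have mf : measurable_fun setT f.
  by apply: (@measurable_fun_cvg _ _ _ _ fn) => // n; exact: rint_meas (fi n).
have p0 x : 0 <= f x.
  have := fc x; move/cvgr_to_ge; apply; exact: nearW.
apply/integrableP; split; first exact/measurable_EFinP.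
have mfn n : measurable_fun setT (EFin \o fn n) by apply/measurable_EFinP; exact: rint_meas (fi n).
have := @fatou _ _ _ m setT measurableT (fun n => EFin \o fn n) mfn (fun n x _ => f0 n x).
move=> h; apply: (@le_lt_trans _ _ C%:E); last exact: ltry.
apply: (@le_trans _ _ (\int[m]_x limn_einf (fun n => (fn n x)%:E))%E).
  apply: eqW; apply: eq_integral => x _.
  have /cvg_limn_einf_sup[-> _] : (fn n x)%:E @[n --> \oo] --> (f x)%:E.
    by apply: cvg_EFin; [exact: nearW|exact: fc].
  by rewrite /= ger0_norm.
apply: (le_trans h); rewrite limn_einf_lim; apply: lime_le; first exact: is_cvg_einfs.
apply: nearW => n; apply: ereal_inf_le; eexists; first by exists n => //=.
rewrite -(@fineK _ (\int[m]_x (fn n x)%:E)%E) ?lee_fin; first exact: fC.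
exact: integrable_fin_num (fi n).
Qed.

End FatouReal.

Section PrincipalValue.
Variable R : realType.
Notation mu := (@mu1 R).
Implicit Types (f : R -> R[i]).

Definition lne (e x : R) : R := ln (x ^+ 2 + e ^+ 2) / 2.

Lemma continuous_lne e : 0 < e -> continuous (lne e).
Proof.
by move=> e0; apply: derive_continuous => x; exact: is_derive_lnsq.
Qed.

Lemma ln_half_sq (x : R) : 0 < x -> ln (x ^+ 2) / 2 = ln x.
Proof. by move=> x0; rewrite lnXn// -[ln x *+ 2]mulr_natr mulfK. Qed.

Lemma lne_ge_ln e x : x != 0 -> ln `|x| <= lne e x.
Proof.
move=> x0; have n0 : 0 < `|x| by rewrite normr_gt0.
rewrite -ln_half_sq// /lne ler_pM2r ?invr_gt0//.
have p : 0 < `|x| ^+ 2 by rewrite exprn_gt0.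
rewrite real_normK ?num_real// in p *.
by rewrite ler_ln ?posrE// ?ltr_pwDl ?sqr_ge0// lerDl sqr_ge0.
Qed.

Lemma lne_ge e x : 0 < e -> ln e <= lne e x.
Proof.
move=> e0; rewrite -ln_half_sq// /lne ler_pM2r ?invr_gt0//.
by rewrite ler_ln ?posrE ?exprn_gt0// ?sqD_gt0// lerDr sqr_ge0.
Qed.

Lemma lne_le A e x : 0 < e -> e <= 1 -> - A <= x <= A -> lne e x <= lne 1 A.
Proof.
move=> e0 e1 xA; rewrite /lne ler_pM2r ?invr_gt0//.
rewrite ler_ln ?posrE ?sqD_gt0//.
have h : `|x| ^+ 2 <= A ^+ 2.
  rewrite -ler_norml in xA; rewrite lerXn2r// nnegrE; exact: le_trans xA.
by rewrite real_normK ?num_real// in h; nra.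
Qed.

Lemma lne_cvg x (u : nat -> R) : x != 0 -> u n @[n --> \oo] --> (0 : R) ->
  lne (u n) x @[n --> \oo] --> ln `|x|.
Proof.
move=> x0 uc; have n0 : 0 < `|x| by rewrite normr_gt0.
rewrite -ln_half_sq// real_normK ?num_real//.
apply: cvgM; last exact: cvg_cst.
apply: (@cvg_comp _ _ _ (fun n => x ^+ 2 + u n ^+ 2) (@ln R) _ (nbhs (x ^+ 2))); last first.
  by apply: continuous_ln; rewrite -real_normK ?num_real// exprn_gt0.
have h : x ^+ 2 + u n ^+ 2 @[n --> \oo] --> x ^+ 2 + 0 ^+ 2.
  apply: cvgD; first exact: cvg_cst.
  by rewrite expr2; under eq_fun do rewrite expr2; exact: cvgM.
by rewrite expr0n/= addr0 in h; exact: h.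
Qed.

Lemma is_derive_lne_prim e (x : R) : 0 < e ->
  is_derive x (1 : R) (fun y : R => y * lne e y - y + e * atan (y / e)) (lne e x).
Proof.
move=> e0; have d0 := sqD_gt0 x e0.
have h1 := is_deriveM (is_derive_id x (1 : R)) (is_derive_lnsq x e0).
have h2 := is_deriveM (is_derive_cst e x (1 : R)) (is_derive_atanV x e0).
apply: (is_derive_eq (is_deriveD (is_deriveB h1 (is_derive_id x (1 : R))) h2)).
rewrite /GRing.scale/= /cst/= /lne.
move: (ln _) => l; field; exact: lt0r_neq0.
Qed.

(** The right-hand side is free of e: in the primitive of [lne e], e atan(A/e) >= 0 and [lne e A] >=
    ln A, and both enter with a minus sign. *)
Lemma int_lneB e A K : 0 < e -> 0 < A ->
  \int[mu]_(x in `[(- A), A]) (K - lne e x) <= 2 * A * K - (2 * A * ln A - 2 * A).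
Proof.
move=> e0 A0; have AA : - A < A by rewrite gtrN.
have dF (x : R) : is_derive x (1 : R) (fun y : R => K * y - (y * lne e y - y + e * atan (y / e))) (K - lne e x).
  have hK : is_derive x (1 : R) (fun y : R => K * y) K.
    by apply: is_derive_eq; rewrite /GRing.scale/= mulr1.
  exact: (is_deriveB hK (is_derive_lne_prim x e0)).
have cF : continuous (fun x => K - lne e x).
  by move=> x; apply: cvgB; [exact: cvg_cst|exact: continuous_lne].
rewrite (ftc_itv AA dF cF).
rewrite [- A / e]mulNr atanN (_ : lne e (- A) = lne e A); last by rewrite /lne sqrrN.
have a0 : 0 <= e * atan (A / e).
  by rewrite mulr_ge0 ?(ltW e0)// -atan0 le_atan// divr_ge0// ltW.
have := lne_ge_ln e (lt0r_neq0 A0); rewrite gtr0_norm// => h.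
by have := ler_wpM2l (ltW A0) h; lra.
Qed.

(** Removes the origin, where [lne e] tends to minus infinity while [ln 0] is a default value:
    pointwise convergence can fail at this single point. *)
Definition nz (x : R) : R := 1 - ind 0 0 x.

Lemma nzE x : nz x = if x == 0 then 0 else 1.
Proof.
rewrite /nz indE; case: (eqVneq x 0) => [->|x0]; first by rewrite lexx subrr.
case: ifPn => [/andP[a b]|_]; last by rewrite subr0.
by move/negP : x0; case; rewrite eq_le a b.
Qed.

(** The part removed is [f 0] times the indicator of a point, whose integral is 0. *)
Lemma cI_nz f : cintegrable mu (fun x => (nz x)%:C * f x) ->
  cI mu f = cI mu (fun x => (nz x)%:C * f x).
Proof.
move=> i1; have ii : cintegrable mu (fun x => (ind 0 0 x)%:C).
  by split => /=; [exact: rint_ind|exact: (cintegrable0 mu).1].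
rewrite (@eq_cI _ _ _ mu f (fun x => f 0 * (ind 0 0 x)%:C + (nz x)%:C * f x)).
  rewrite (cI_lin (f 0) ii i1) (_ : cI mu (fun x => (ind 0 0 x)%:C) = 0) ?mulr0 ?add0r//.
  apply: complexP; rewrite /cI/=; first by rewrite int_ind// subrr.
  exact: (congr1 (@complex.Im R) (cI0 mu)).
move=> x; rewrite /nz indE; case: ifPn => [/andP[a b]|_].
  have -> : x = 0 by apply/eqP; rewrite eq_le a b.
  by rewrite subrr mulr1 mul0r addr0.
by rewrite subr0 mulr0 add0r mul1r.
Qed.

Lemma meas_nz : meas1 nz.
Proof. by apply: measurable_funB; [exact: measurable_cst|exact: rint_meas (rint_ind 0 0)]. Qed.

(** For e <= 1 and |x| <= A, x nonzero, [lne e x] lies between ln |x| and [lne 1 A]. Up to a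
    constant this difference therefore dominates all the regularised logarithms, and it is
    nonnegative, as Fatou's lemma requires. *)
Definition lnbd A (x : R) : R := nz x * (ind (- A) A x * (lne 1 A - ln `|x|)).

Lemma rint_lnbd A : 0 < A -> rint mu (lnbd A).
Proof.
move=> A0; pose gn n (x : R) := ind (- A) A x * (lne 1 A - lne (epsn R n) x).
have e0 n := epsn_gt0 R n; have e1 n := epsn_le1 R n.
have g0 n x : 0 <= gn n x.
  rewrite /gn indE; case: ifPn => xA; last by rewrite mul0r.
  by rewrite mul1r subr_ge0 lne_le.
have gi n : rint mu (gn n).
  apply: (@rint_le _ _ _ mu _ (fun x => (lne 1 A - ln (epsn R n)) * ind (- A) A x)); last exact/rintZ/rint_ind.
    apply: measurable_funM; first exact: rint_meas (rint_ind (- A) A).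
    by apply: measurable_funB; [exact: measurable_cst|apply: continuous_meas1; exact: continuous_lne].
  move=> x; rewrite ger0_norm// mulrC; apply: ler_wpM2l; first exact: ind_ge0.
  by rewrite lerD2l lerN2 lne_ge.
have nz01 x : 0 <= nz x <= 1 by rewrite nzE; case: ifP; rewrite ?lexx ?ler01.
have fi n : rint mu (fun x => nz x * gn n x).
  apply: (@rint_le _ _ _ mu _ (gn n)) => //.
    by apply: measurable_funM; [exact: meas_nz|exact: rint_meas (gi n)].
  move=> x; have /andP[n0 n1] := nz01 x.
  by rewrite normrM (ger0_norm n0) (ger0_norm (g0 n x)) ler_piMl.
apply: (rint_fatou (C := 2 * A * lne 1 A - (2 * A * ln A - 2 * A)) _ fi).
- by move=> n x; rewrite mulr_ge0//; have /andP[] := nz01 x.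
- move=> n; apply: (@le_trans _ _ (\int[mu]_x gn n x)).
    apply: (le_Rintegral measurableT (fi n) (gi n)) => x _.
    by have /andP[_ ?] := nz01 x; rewrite ler_piMl.
  by rewrite /gn int_indM; exact: int_lneB.
- move=> x; rewrite /lnbd nzE; case: eqVneq => [_|x0].
    by rewrite mul0r; under eq_fun do rewrite mul0r; exact: cvg_cst.
  rewrite mul1r; under eq_fun do rewrite mul1r.
  apply: cvgM; first exact: cvg_cst.
  by apply: cvgB; [exact: cvg_cst|apply: lne_cvg => //; exact: epsn_cvg].
Qed.

Lemma lne_bound A e x : 0 < e -> e <= 1 ->
  nz x * (ind (- A) A x * `|lne e x|) <= `|lne 1 A| * ind (- A) A x + lnbd A x.
Proof.
move=> e0 e1; rewrite /lnbd nzE indE; case: ifPn => x0.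
  by rewrite !mul0r addr0 mulr_ge0//; case: ifP.
case: ifPn => xA; last by rewrite !mul0r mulr0 addr0.
rewrite !mul1r mulr1; have h1 := lne_ge_ln e x0; have h2 := lne_le e0 e1 xA.
have := ler_norm (lne 1 A); have := ler_norm (- lne 1 A); rewrite normrN => h3 h4.
rewrite ler_norml; lra.
Qed.

(** Dominated convergence is run on the integrands multiplied by [nz], for which it holds at every
    point; [cI_nz] restores the original integrals. *)
Lemma vp_cvg (phi : R -> R[i]) : test_fun setT phi ->
  ccvg (fun n => cI mu (fun x => (lne (epsn R n) x)%:C * cderive (1 : R) phi x))
       (cI mu (fun x => (ln `|x|)%:C * cderive (1 : R) phi x)).
Proof.
move=> tp; have tD := test_fun_cderive (1 : R) tp.
have [A [L [B [A0 L0 B0 [mD fA _ fB]]]]] := test_fun_lip0 tD.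
set D := cderive (1 : R) phi in mD fA fB *.
have fB' x : normc (D x) <= ind (- A) A x * B.
  rewrite indE; case: ifPn => [_|/negP/fA ->]; first by rewrite mul1r.
  by rewrite normc0 mul0r.
pose G x := B * (`|lne 1 A| * ind (- A) A x + lnbd A x).
have iG : rint mu G by apply: rintZ; apply: rintD; [exact/rintZ/rint_ind|exact: rint_lnbd].
have bd n x : normc ((nz x)%:C * ((lne (epsn R n) x)%:C * D x)) <= G x.
  rewrite !normcM !normc_real.
  have nz0 : 0 <= nz x by rewrite nzE; case: ifP.
  rewrite (ger0_norm nz0).
  apply: (@le_trans _ _ (B * (nz x * (ind (- A) A x * `|lne (epsn R n) x|)))).
    rewrite [leRHS](_ : _ = nz x * (`|lne (epsn R n) x| * (ind (- A) A x * B))); last by ring.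
    by apply: ler_wpM2l => //; apply: ler_wpM2l.
  by apply: ler_wpM2l => //; apply: lne_bound; [exact: epsn_gt0|exact: epsn_le1].
have mn n : cmeas (fun x : RL R => (nz x)%:C * ((lne (epsn R n) x)%:C * D x)).
  apply: cmeasM; first by apply: cmeas_real; exact: meas_nz.
  apply: cmeasM mD; apply: cmeas_real; apply: continuous_meas1.
  exact: continuous_lne (epsn_gt0 R n).
have cv x : ccvg (fun n => (nz x)%:C * ((lne (epsn R n) x)%:C * D x))
                 ((nz x)%:C * ((ln `|x|)%:C * D x)).
  rewrite nzE; case: eqVneq => [_|x0].
    by rewrite mul0r; under [X in ccvg X _]eq_fun do rewrite mul0r; exact: ccvg_cst.
  apply: ccvgM; first exact: ccvg_cst.
  apply: ccvgM; last exact: ccvg_cst.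
  by apply: ccvg_real; apply: lne_cvg => //; exact: epsn_cvg.
have h := cI_dct mn cv bd iG.
have m0 := cmeas_lim mn cv.
have b0 x : normc ((nz x)%:C * ((ln `|x|)%:C * D x)) <= G x.
  by apply: (ccvg_le (cv x)) => n; exact: bd.
rewrite (cI_nz (cint_dom m0 b0 iG)).
under [X in ccvg X _]eq_fun do rewrite (cI_nz (cint_dom (mn _) (bd _) iG)).
exact: h.
Qed.

Lemma cderive_line1 (phi : R -> R[i]) : smooth phi -> cder phi (cderive (1 : R) phi).
Proof.
move=> sp x; have := cder_line 0 (1 : R) sp x.
have e (g : R -> R[i]) y : g (0 + y *: (1 : R)) = g y by rewrite add0r /GRing.scale/= mulr1.
by rewrite e; under [X in is_derive _ _ X _]eq_fun do rewrite e; under [X in _ /\ is_derive _ _ X _]eq_fun do rewrite e.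
Qed.

Lemma ccont_real (g : R -> R) : continuous g -> ccont (fun x => (g x)%:C).
Proof. by move=> cg; split => //= x; exact: cvg_cst. Qed.

(** The difference x - 0 is kept so that the second integral is the one of [poisson_cvg] at the
    point 0. *)
Lemma inv_ieps_parts (phi : R -> R[i]) e : 0 < e -> e <= 1 -> test_fun setT phi ->
  inv_x_ieps e phi = - cI mu (fun x => (lne e x)%:C * cderive (1 : R) phi x) -
    'i%C * cI mu (fun x => (e / ((x - 0) ^+ 2 + e ^+ 2))%:C * phi x).
Proof.
move=> e0 e1 tp; have [sp _ _] := tp; have tD := test_fun_cderive (1 : R) tp.
have [sD _ _] := tD; have mf := test_fun_cmeas tp; have mD := test_fun_cmeas tD.
set D := cderive (1 : R) phi in tD sD mD *.
have [A [A0 sA]] := test_fun_supp_bounded tp.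
have fA := supp_itv tp sA.
have gA : forall x, ~ (- A <= x <= A) -> D x = 0.
  by apply: (supp_itv tD) => x /supp_cderive; exact: sA.
have [M [M0 hM]] := test_fun_bounded tp; have [N [N0 hN]] := test_fun_bounded tD.
pose g (x : R) := x / (x ^+ 2 + e ^+ 2); pose h (x : R) := e / (x ^+ 2 + e ^+ 2).
have gV x : `|g x| <= e^-1.
  apply: le_trans (normc_inv_e x e0); rewrite inv_iepsE.
  exact: (Re_le_normc (g x +i* - h x)).
have hV x : `|h x| <= e^-1.
  apply: le_trans (normc_inv_e x e0); rewrite inv_iepsE -normrN.
  exact: (Im_le_normc (g x +i* - h x)).
have cg : continuous g by apply: continuous_divsq => // x; exact: cvg_id.
have ch : continuous h by apply: continuous_divsq => // x; exact: cvg_cst.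
have cl := continuous_lne e0.
have bnd (k : R -> R) (f : R -> R[i]) (K P : R) : 0 <= K -> 0 <= P -> continuous k -> cmeas (f : RL R -> _) ->
    (forall x, - A <= x <= A -> `|k x| <= K) -> (forall x, normc (f x) <= P) ->
    (forall x, ~ (- A <= x <= A) -> f x = 0) -> cintegrable mu (fun x => (k x)%:C * f x).
  move=> K0 P0 ck mf' kK fP f0.
  apply: (cint_dom (g := fun x : RL R => K * P * ind (- A) A x)); last exact/rintZ/rint_ind.
    by apply: cmeasM mf'; apply: cmeas_real; exact: continuous_meas1.
  move=> x; rewrite normcM normc_real indE; case: ifPn => [xA|/negP xA].
    by rewrite mulr1; apply: ler_pM => //; [exact: normc_ge0|exact: kK].
  by rewrite f0// normc0 !mulr0.
have V0 : 0 <= e^-1 by rewrite invr_ge0 ltW.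
have ig := bnd g phi _ _ V0 M0 cg mf (fun x _ => gV x) hM fA.
have ih := bnd h phi _ _ V0 M0 ch mf (fun x _ => hV x) hM fA.
have il : cintegrable mu (fun x => (lne e x)%:C * D x).
  apply: (bnd (lne e) D (`|lne 1 A| + `|ln e|) N (addr_ge0 (normr_ge0 _) (normr_ge0 _)) N0 cl mD _ hN gA).
  move=> x xA; have k1 := lne_ge x e0; have k2 := lne_le e0 e1 xA.
  have := ler_norm (lne 1 A); have := ler_norm (- ln e); rewrite normrN => k3 k4.
  have := normr_ge0 (lne 1 A); have := normr_ge0 (ln e) => k5 k6.
  by rewrite ler_norml; lra.
have dl : cder (fun x => (lne e x)%:C) (fun x => (g x)%:C).
  by move=> x; split => /=; [exact: is_derive_lnsq|exact: is_derive_cst].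
have parts : cI mu (fun x => (g x)%:C * phi x) + cI mu (fun x => (lne e x)%:C * D x) = 0.
  rewrite -(cI_D ig il).
  apply: (cI_cder0 (ltW A0) (cderM dl (cderive_line1 sp))).
  - by apply: ccontD; apply: ccontM; try exact: ccont_real; exact: smooth_continuous.
  - by move=> x /fA ->; rewrite mulr0.
  - by move=> x xA; rewrite fA// -/D gA// !mulr0 addr0.
have -> : - cI mu (fun x => (lne e x)%:C * D x) = cI mu (fun x => (g x)%:C * phi x).
  by apply/eqP; rewrite eq_sym -subr_eq0 opprK parts.
rewrite (@eq_cI _ _ _ mu (fun x => (e / ((x - 0) ^+ 2 + e ^+ 2))%:C * phi x) (fun x => (h x)%:C * phi x)); last by move=> x; rewrite subr0.
rewrite /inv_x_ieps /regular cintTE.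
rewrite (@eq_cI _ _ _ mu _ (fun x => - 'i%C * ((h x)%:C * phi x) + (g x)%:C * phi x)).
  by rewrite (cI_lin (- 'i%C) ih ig) mulNr addrC.
move=> x; rewrite inv_iepsE -/(g x) -/(h x) mulrA -mulrDl; congr (_ * _).
by apply: complexP; rewrite ?ReD ?ImD ?ReM ?ImM ?ReN ?ImN /=; ring.
Qed.

Lemma inv_x_i0_vp (phi : R -> R[i]) : test_fun setT phi ->
  inv_x_i0 phi = vp_inv phi - 'i%C * pi%:C * dirac_distr (0 : R) phi.
Proof.
move=> tp; have [A [L [B [A0 L0 B0 lp]]]] := test_fun_lip0 tp.
have c1 := inv_epsn_cvg A0 L0 lp; apply: (ccvg_unique c1).
under [X in ccvg X _]eq_fun do rewrite (inv_ieps_parts (epsn_gt0 R _) (epsn_le1 R _) tp).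
have [mf fA fL fB] := lp.
have fL' y : normc (phi y - phi 0) <= L * `|y - 0| by rewrite subr0.
have c2 := poisson_cvg A0 L0 mf fA fL' fB (epsn_gt0 R) (@epsn_cvg R).
have c3 := ccvgD (ccvgM (ccvg_cst (- 1)) (vp_cvg tp)) (ccvgM (ccvg_cst (- 'i%C)) c2).
have -> : vp_inv phi - 'i%C * pi%:C * dirac_distr (0 : R) phi =
   - 1 * cI mu (fun x => (ln `|x|)%:C * cderive (1 : R) phi x) + - 'i%C * (pi%:C * phi 0).
  by rewrite mulN1r mulNr mulrA.
by move: c3; congr ccvg; apply/funext => n; rewrite mulN1r mulNr.
Qed.

End PrincipalValue.

(** The first part makes the definition of u_0 meaningful: the limit exists against every test
    function, which is convergence in D'(R), and has the stated decomposition. *)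
Theorem proposition3p1 (R : realType) :
  (forall phi : R -> R[i], test_fun setT phi ->
     normc (inv_x_ieps eps phi - inv_x_i0 phi) @[eps --> 0^'+] --> (0 : R) /\
     inv_x_i0 phi = vp_inv phi - 'i%C * pi%:C * dirac_distr (0 : R) phi) /\
  (forall c : R, c != 0 ->
     weak_solution c (tensor1 (@inv_x_i0 R)) (fun _ => @inv_x_i0 R)
       (@inv_x_i0 R)).
Proof.
split=> [phi tphi|c _]; last exact: weak_solution_u0t.
split; last exact: inv_x_i0_vp.
have [A [L [B [A0 L0 B0 lphi]]]] := test_fun_lip0 tphi.
exact: inv_x_i0_cvg A0 L0 lphi.
Qed.
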